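(* Let $M$ be a symmetric real $4\times4$ matrix. The restriction $\mathfrak A_M$ of $\mathfrak A^*$ onto the linear space $$\mathfrak D(\mathfrak A_M)=\bigl\{w\in\mathfrak D(\mathfrak A^* ):\ d^\sharp(\nabla_y,0)^\top\widehat w(\mathcal O)=Ma,\ \widehat w_3(\mathcal O)=0\bigr\},\qquad \widehat w(y)=w_{(\mathrm{reg})}(y)+a_0\,(0,0,G_3(y,\mathcal O))^\top,$$ where $w_{(\mathrm{reg})}$, $a_0\in\mathbb R$, $a\in\mathbb R^4$ are the attributes of $w$ in the representation of elements of $\mathfrak D(\mathfrak A^* )$, is a self-adjoint extension (in $L^2(\omega)^3$) of the operator $\mathfrak A$.
   Context: $\omega\subset\mathbb R^2$ is a bounded domain with smooth boundary, $\mathcal O\in\omega$ is the origin, $\partial_n$ the normal derivative. $A$ is a constant real symmetric positive definite $6\times6$ matrix with $3\times3$ blocks $A_{(yy)},A_{(yz)},A_{(zy)},A_{(zz)}$, $A^0=A_{(yy)}-A_{(yz)}A_{(zz)}^{-1}A_{(zy)}$. With $$\mathcal D'(\nabla_y)^\top=\begin{pmatrix}\partial_1&0&2^{-1/2}\partial_2\\0&\partial_2&2^{-1/2}\partial_1\end{pmatrix},\quad \mathcal D_3(\nabla_y)=(2^{-1/2}\partial_1^2,2^{-1/2}\partial_2^2,\partial_1\partial_2)^\top,$$ set $\mathcal L'=\mathcal D'(-\nabla_y)^\top A^0\mathcal D'(\nabla_y)$ ($2\times2$), $\mathcal L_3=\frac16\mathcal D_3(\nabla_y)^\top A^0\mathcal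 D_3(\nabla_y)$ and $\mathcal L=\operatorname{diag}\{\mathcal L',\mathcal L_3\}$. $G'(\cdot,\mathcal O)$ is the $2\times2$ Green matrix: $\mathcal L'G'=\delta\,\mathbb I_2$ in $\omega$, $G'=0$ on $\partial\omega$. $G_3(y,\mathbf y)$ is the Green function of $\mathcal L_3$ in $\omega$ with $G_3=\partial_nG_3=0$ on $\partial\omega$; $G_{3,i}(y,\mathcal O)=\partial_{\mathbf y_i}G_3(y,\mathbf y)|_{\mathbf y=0}$; $G_3^i(y,\mathcal O)=G_{3,i}(y,\mathcal O)-G_{3,i}(\mathcal O,\mathcal O)G_3(\mathcal O,\mathcal O)^{-1}G_3(y,\mathcal O)$. $G^\sharp(y)$ is the $3\times4$ matrix whose upper-left $2\times2$ block is $G'(y,\mathcal O)$, whose third row is $(0,0,G_3^2(y,\mathcal O),-G_3^1(y,\mathcal O))$, and whose other entries are zero. $\mathfrak A$ is the unbounded symmetric operator in $L^2(\omega)^3$ with differential expression $\mathcal L(\nabla_y)$ and domain $$\mathfrak D(\mathfrak A)=\{w\in H^2(\omega)^2\times H^4(\omega):\ w=0,\ \partial_nw_3=0\text{ on }\partial\omega,\ w(\mathcal O)=0\in\mathbb R^3,\ \nabla_yw_3(\mathcal O)=0\in\mathbb R^2\}.$$ Its adjoint $\mathfrak A^*$ acts as $\mathcal L(\nabla_y)$ (applied in $\omega\setminus\mathcal O$), with domain $$\mathfrak D(\mathfrak A^* )=\{w=w_{(\mathrm{reg})}+a_0(0,0,G_3(\cdot,\mathcal O))^\top+G^\sharp a:\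 w_{(\mathrm{reg})}\in H^2(\omega)^2\times H^4(\omega),\ w_{(\mathrm{reg})}=0,\ \partial_nw_{(\mathrm{reg})3}=0\text{ on }\partial\omega,\ a_0\in\mathbb R,\ a\in\mathbb R^4\};$$ the attributes $w_{(\mathrm{reg})},a_0,a$ are uniquely determined by $w$. Finally $$d^\sharp(\nabla_y,0)^\top\widehat w(\mathcal O)=(\widehat w_1,\widehat w_2,\partial_2\widehat w_3,-\partial_1\widehat w_3)^\top(\mathcal O).$$ *)

(* Defs.v *)
From mathcomp Require Export all_boot all_order all_algebra.
From mathcomp Require Export all_classical all_reals all_analysis.
Export Order.TTheory GRing.Theory Num.Theory numFieldNormedType.Exports.

Set Implicit Arguments.
Unset Strict Implicit.
Unset Printing Implicit Defensive.

Global Open Scope classical_set_scope.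
Global Open Scope ring_scope.

Section Plane.
Variable R : realType.

Definition leb2 := (@lebesgue_measure R \x @lebesgue_measure R)%E.

Definition O2 : R * R := (0, 0).

Definition basis (i : 'I_2) : R * R := ((i == 0)%:R, (i == 1)%:R).

Definition pd (i : 'I_2) (f : R * R -> R) : R * R -> R :=
  fun y => 'D_(basis i) f y.

Definition pds (s : seq 'I_2) (f : R * R -> R) : R * R -> R := foldr pd f s.

Definition smooth (f : R * R -> R) : Prop :=
  forall s, continuous (pds s f) /\
    forall x i, derivable (pds s f) x (basis i).

Definition test_fun (U : set (R * R)) (phi : R * R -> R) : Prop :=
  smooth phi /\ exists K : set (R * R),
    [/\ compact K, K `<=` U & forall y, ~ K y -> phi y = 0].

Definition bdry (omega : set (R * R)) : set (R * R) := closure omega `\` interior omega.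

(* Near p the set omega is {rho < 0}, for a smooth rho with nonzero gradient. *)
Definition bdry_chart (omega : set (R * R)) (p : R * R) (rho : R * R -> R) : Prop :=
  [/\ smooth rho, (exists i, pd i rho p != 0) &
      \forall y \near p, omega y <-> rho y < 0].

Definition smooth_bdry (omega : set (R * R)) : Prop :=
  forall p, bdry omega p -> exists rho, bdry_chart omega p rho.

Definition outer_normal (omega : set (R * R)) (p : R * R) (n : 'I_2 -> R) : Prop :=
  exists2 rho, bdry_chart omega p rho &
    forall i, n i = pd i rho p / Num.sqrt (\sum_j pd j rho p ^+ 2).

(* The normal derivative at p is the limit of n(p) . grad f (y) as y -> p in omega;
   it is only used for functions of class C1bar. *)
Definition dnormal0 (omega : set (R * R)) (f : R * R -> R) : Prop :=
  forall p n, bdry omega p -> outer_normal omega p n ->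
    (\sum_i n i * pd i f y) @[y --> within omega (nbhs p)] --> (0 : R).

Definition C0bar (omega : set (R * R)) (f : R * R -> R) : Prop :=
  {within closure omega, continuous f}.

Definition C1bar (omega : set (R * R)) (f : R * R -> R) : Prop :=
  C0bar omega f /\ forall i, (forall y, omega y -> derivable f y (basis i)) /\
    exists2 g, C0bar omega g & forall y, omega y -> g y = pd i f y.

Definition L2 (omega : set (R * R)) (f : R * R -> R) : Prop :=
  measurable_fun omega f /\ leb2.-integrable omega (fun y => (f y ^+ 2)%:E).

Definition weak_deriv (omega : set (R * R)) (s : seq 'I_2) (f g : R * R -> R) :
    Prop :=
  forall phi, test_fun omega phi ->
    \int[leb2]_(y in omega) (f y * pds s phi y) =
    (-1) ^+ size s * \int[leb2]_(y in omega) (g y * phi y).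

(* H^k(omega) *)
Definition sobolev (omega : set (R * R)) (k : nat) (f : R * R -> R) : Prop :=
  L2 omega f /\ forall s : seq 'I_2, (size s <= k)%N ->
    exists2 g, L2 omega g & weak_deriv omega s f g.

(* Vector fields on the plane; all columns (w_1, w_2 | w_3) are split 2 + 1. *)
Definition entry n (w : R * R -> 'cV[R]_n) (i : 'I_n) : R * R -> R :=
  fun y => w y i 0.

Definition vfield := R * R -> 'cV[R]_(2 + 1).

Definition entry3 (w : vfield) : R * R -> R := entry w (rshift 2 0).

Definition L2f (omega : set (R * R)) (v : vfield) : Prop := forall i, L2 omega (entry v i).

Definition inner n (omega : set (R * R)) (u v : R * R -> 'cV[R]_n) : R :=
  \int[leb2]_(y in omega) \sum_i u y i 0 * v y i 0.

Section DifferentialExpression.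
Variable B : 'M[R]_3.

Let k : R := (Num.sqrt 2)^-1.

(* D'(nabla) u *)
Definition Dprime (u : R * R -> 'cV[R]_2) : R * R -> 'cV[R]_3 := fun y =>
  \col_i [:: pd 0 (entry u 0) y;
             pd 1 (entry u 1) y;
             k * pd 1 (entry u 0) y + k * pd 0 (entry u 1) y]`_i.

(* D'(-nabla)^T s *)
Definition Dprime_negT (s : R * R -> 'cV[R]_3) : R * R -> 'cV[R]_2 := fun y =>
  \col_i [:: - pd 0 (entry s 0) y - k * pd 1 (entry s ord_max) y;
             - pd 1 (entry s 1) y - k * pd 0 (entry s ord_max) y]`_i.

Definition D3 (u : R * R -> R) : R * R -> 'cV[R]_3 := fun y =>
  \col_i [:: k * pds [:: 0; 0] u y;
             k * pds [:: 1; 1] u y;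
             pds [:: 0; 1] u y]`_i.

Definition D3T (s : R * R -> 'cV[R]_3) : R * R -> R := fun y =>
  k * pds [:: 0; 0] (entry s 0) y + k * pds [:: 1; 1] (entry s 1) y +
  pds [:: 0; 1] (entry s ord_max) y.

Definition Lprime (u : R * R -> 'cV[R]_2) : R * R -> 'cV[R]_2 :=
  Dprime_negT (fun y => B *m Dprime u y).

Definition L3 (u : R * R -> R) : R * R -> R := fun y =>
  6^-1 * D3T (fun z => B *m D3 u z) y.

Definition Lfull (w : vfield) : vfield := fun y =>
  col_mx (Lprime (fun z => usubmx (w z)) y) (L3 (entry3 w) y)%:M.

End DifferentialExpression.

(* L w = f in the sense of distributions on U.  The transpose of the
   differential expression with coefficient matrix B is the one with
   coefficient matrix B^T. *)
Definition distr_eq (B : 'M[R]_3) (U : set (R * R)) (w f : vfield) : Prop :=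
  forall phi : vfield, (forall i, test_fun U (entry phi i)) ->
    inner U w (Lfull B^T phi) = inner U f phi.

Definition schur (A : 'M[R]_(3 + 3)) : 'M[R]_3 :=
  ulsubmx A - ursubmx A *m invmx (drsubmx A) *m dlsubmx A.

Definition posdef n (A : 'M[R]_n) : Prop :=
  A^T = A /\ forall x : 'cV[R]_n, x != 0 -> 0 < (x^T *m A *m x) 0 0.

(* chi f belongs to X for all smooth cut-offs chi vanishing near the pole p. *)
Definition off_pole (p : R * R) (X : (R * R -> R) -> Prop) (f : R * R -> R) :
    Prop :=
  forall chi, smooth chi -> (\forall y \near p, chi y = 0) ->
    X (fun y => chi y * f y).

(* G' = G'(., O): its columns solve L' G' = delta_O Id, G' = 0 on the boundary;
   G' is logarithmically singular at O and H^2 away from O. *)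
Definition green_prime (B : 'M[R]_3) (omega : set (R * R)) (G : R * R -> 'M[R]_2) :
    Prop :=
  [/\ forall i j, L2 omega (fun y => G y i j),
      forall i j, off_pole O2 (sobolev omega 2) (fun y => G y i j),
      forall i j, {within closure omega `\ O2, continuous (fun y => G y i j)},
      forall p, bdry omega p -> G p = 0 &
      forall (phi : R * R -> 'cV[R]_2) j, (forall i, test_fun omega (entry phi i)) ->
        inner omega (fun y => col j (G y)) (Lprime B^T phi) = phi O2 j 0].

(* G_3(y, z) with pole z.  It behaves like |y - z|^2 ln |y - z| near the pole:
   C^1 up to the boundary and in H^2 globally, in H^4 away from the pole; and
   its z-gradient is continuous. *)
Definition green3 (B : 'M[R]_3) (omega : set (R * R)) (G : R * R -> R * R -> R) :
    Prop :=
  (forall z, omega z ->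
    [/\ C1bar omega (G^~ z), sobolev omega 2 (G^~ z), off_pole z (sobolev omega 4) (G^~ z),
        (forall p, bdry omega p -> G p z = 0) /\ dnormal0 omega (G^~ z) &
        forall phi, test_fun omega phi ->
          \int[leb2]_(y in omega) (G y z * L3 B^T phi y) = phi z]) /\
  (forall i,
    (forall y z, closure omega y -> omega z -> derivable (G y) z (basis i)) /\
    {within closure omega `*` omega, continuous (fun q => pd i (G q.1) q.2)}).

Section GreenColumns.
Variables (G' : R * R -> 'M[R]_2) (G3 : R * R -> R * R -> R).

(* The derivative is taken in the second argument, the pole. *)
Definition G3_ (i : 'I_2) (y : R * R) : R := pd i (G3 y) O2.

Definition G3sup (i : 'I_2) (y : R * R) : R :=
  G3_ i y - G3_ i O2 * (G3 O2 O2)^-1 * G3 y O2.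

Definition Gsharp (y : R * R) : 'M[R]_(2 + 1, 2 + 2) :=
  block_mx (G' y) 0 0 (\row_j [:: G3sup 1 y; - G3sup 0 y]`_j).

Definition what (wreg : vfield) (a0 : R) : vfield := fun y =>
  wreg y + a0 *: col_mx 0 (G3 y O2)%:M.

Definition wrepr (wreg : vfield) (a0 : R) (a : 'cV[R]_(2 + 2)) : vfield := fun y =>
  what wreg a0 y + Gsharp y *m a.

End GreenColumns.

(* H^2(omega)^2 x H^4(omega) with the boundary conditions.  Members are taken to be
   the representatives that are continuous up to the boundary (C^1 for the third
   component) given by Sobolev embedding, so that point values make sense. *)
Definition regD (omega : set (R * R)) (u : vfield) : Prop :=
  [/\ forall i : 'I_2, sobolev omega 2 (entry u (lshift 1 i)) /\
                       C0bar omega (entry u (lshift 1 i)),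
      sobolev omega 4 (entry3 u), C1bar omega (entry3 u),
      forall p, bdry omega p -> u p = 0 & dnormal0 omega (entry3 u)].

Definition ae_on (omega : set (R * R)) (u v : vfield) : Prop :=
  {ae leb2, forall y, omega y -> u y = v y}.

(* An unbounded operator in L^2(omega)^3 is given by its graph, a relation on
   square-integrable functions that is compatible with a.e. equality. *)
Definition operator := vfield -> vfield -> Prop.

Definition opA (B : 'M[R]_3) (omega : set (R * R)) : operator := fun v f =>
  [/\ L2f omega v, L2f omega f, distr_eq B omega v f &
      exists u, [/\ regD omega u, u O2 = 0, forall i, pd i (entry3 u) O2 = 0 &
                    ae_on omega v u]].

Definition adjoint (omega : set (R * R)) (T : operator) : operator := fun v f =>
  [/\ L2f omega v, L2f omega f & forall u g, T u g -> inner omega g v = inner omega u f].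

Definition densely_defined (omega : set (R * R)) (T : operator) : Prop :=
  forall v, L2f omega v -> forall e : R, 0 < e -> exists u f,
    T u f /\ inner omega (fun y => v y - u y) (fun y => v y - u y) < e.

Definition self_adjoint (omega : set (R * R)) (T : operator) : Prop :=
  densely_defined omega T /\ forall v f, T v f <-> adjoint omega T v f.

Definition op_extends (T S : operator) : Prop := forall v f, S v f -> T v f.

Definition attributes (omega : set (R * R)) (G' : R * R -> 'M[R]_2)
    (G3 : R * R -> R * R -> R) (v : vfield)
    (wreg : vfield) (a0 : R) (a : 'cV[R]_(2 + 2)) : Prop :=
  regD omega wreg /\ ae_on omega v (wrepr G' G3 wreg a0 a).

(* The explicit form of the adjoint of opA: L is applied in omega minus the
   origin, so the delta functions produced by the Green columns are dropped. *)
Definition opAstar (B : 'M[R]_3) (omega : set (R * R)) (G' : R * R -> 'M[R]_2)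
    (G3 : R * R -> R * R -> R) : operator := fun v f =>
  [/\ L2f omega v, L2f omega f, distr_eq B (omega `\ O2) v f &
      exists wreg a0 a, attributes omega G' G3 v wreg a0 a].

(* d^#(nabla, 0)^T u (O) *)
Definition dsharp (u : vfield) : 'cV[R]_(2 + 2) :=
  \col_i [:: entry u (lshift 1 0) O2; entry u (lshift 1 1) O2;
             pd 1 (entry3 u) O2; - pd 0 (entry3 u) O2]`_i.

Definition domAM (omega : set (R * R)) (G' : R * R -> 'M[R]_2)
    (G3 : R * R -> R * R -> R) (M : 'M[R]_(2 + 2)) (v : vfield) : Prop :=
  exists wreg a0 a, [/\ attributes omega G' G3 v wreg a0 a,
    dsharp (what G3 wreg a0) = M *m a & entry3 (what G3 wreg a0) O2 = 0].

Definition op_restrict (T : operator) (D : vfield -> Prop) : operator :=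
  fun v f => T v f /\ D v.

End Plane.

(* Main.v *)
(** Let [u, v] = <A* u, v> - <u, A* v>.  Up to the domain of A, a regular field is a test field
    with the same jet at O, and the Green columns are annihilated by A*.  Hence [u, v] only
    involves test fields phi and Green columns g, and <L phi, g> is a value of phi at O: a value
    of phi_1, phi_2 or phi_3 by definition of the Green functions, of grad phi_3 by
    differentiating the defining property of G_3 with respect to the pole.  In terms of
    W = d^#(nabla) w^(O) and h = w^_3(O) this gives, for a suitable bilinear r,
      [psi, v] = - b_0 h + b . (M a - W) + h r(b)
    for psi in D(A_M) with coefficients b_0, b; since b_0 and b are arbitrary and M is symmetric,
    A_M is symmetric and has no proper symmetric extension.

    Two facts on G_3 are needed: G_3(O, O) is nonzero, and the gradients of G_3(y, z) in y and
    in z agree at (O, O).  Both follow from (1/6) int B D_3 G_z . D_3 G_w = G_w(z), that is, from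
    the equation for G_z tested with G_w.  To approximate G_w by test functions we show that its
    gradient vanishes on the boundary, that the extension of G_w by zero has square-integrable
    second weak derivatives on the plane, and we mollify it locally with kernels whose support
    is shifted inwards. *)

From HB Require Import structures.
Require Import Defs.
From mathcomp Require Import measurable_realfun simple_functions ring lra.

Set Implicit Arguments.
Unset Strict Implicit.
Unset Printing Implicit Defensive.

(** * Smooth functions and bump functions *)

Section DeriveWrappers.
Variables (R : realType) (V : normedModType R).
Implicit Types (f g : V -> R) (x v : V) (a b : R).

(** For u in the domain of A, both pairings with an element of the adjoint domain agree by
    definition of the adjoint. Hence regular fields are never integrated by parts up to the
    boundary; only test fields are integrated by parts.

    The term h r(b) stems from the normalisation of the columns G_3^i. Subtracting c_i G_3(., O),
    with c_i = G_{3,i}(O, O) / G_3(O, O), makes them return d_i phi_3 - c_i phi_3 at O, a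
    combination that does not change when a multiple of G_3(., O) is added to phi_3. Passing from w
    to w^ in it uses both facts on G_3.

    The obstacle is that G_w is only known to be C^1 up to the boundary with zero value and zero
    normal derivative, while the equation for G_z admits only test functions of compact support. The
    boundary is given by a defining function and is not straightened, so the tangential derivative
    is read off from increments of G_w along a path with both ends on the boundary; and
    mollification must push supports into omega. *)

Lemma is_derive_mul f g x v a b : is_derive x v f a -> is_derive x v g b ->
  is_derive x v (fun y => f y * g y) (a * g x + f x * b).
Proof.
move=> fa gb; apply: (is_derive_eq (is_deriveM fa gb)).
by rewrite /GRing.scale /= addrC mulrC.
Qed.

Lemma is_derive_add f g x v a b : is_derive x v f a -> is_derive x v g b ->
  is_derive x v (fun y => f y + g y) (a + b).
Proof. by move=> fa gb; exact: is_deriveD. Qed.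

Lemma is_derive_sub f g x v a b : is_derive x v f a -> is_derive x v g b ->
  is_derive x v (fun y => f y - g y) (a - b).
Proof. by move=> fa gb; exact: is_deriveB. Qed.

Lemma is_derive_scale f x v a (k : R) : is_derive x v f a ->
  is_derive x v (fun y => k * f y) (k * a).
Proof. by move=> fa; exact: is_deriveZ. Qed.

Lemma is_derive_const x v (k : R) : is_derive x v (fun=> k) 0.
Proof. exact: is_derive_cst. Qed.

Lemma is_deriveE f x v a : is_derive x v f a -> 'D_v f x = a.
Proof. by move=> fa; exact: derive_val. Qed.

Lemma is_derive_derivable f x v a : is_derive x v f a -> derivable f x v.
Proof. by move=> fa; exact: ex_derive. Qed.

End DeriveWrappers.

Section SmoothStep.
Variable R : realType.
Implicit Types (f g : R -> R) (x : R).

Lemma is_derive_inv f x (v a : R) : f x != 0 -> is_derive x v f a ->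
  is_derive x v (fun y => (f y)^-1) (- a * ((f x)^-1 * (f x)^-1)).
Proof.
move=> f0 fa; apply: (is_derive_eq (is_deriveV f0 fa)).
by rewrite /GRing.scale /= expr2 invfM; ring.
Qed.

(** The derivative is an existential witness at each level, so closure under sums, products and
    inverses is an induction on [n] that never names higher derivatives. *)
Fixpoint Cn1 n f : Prop := if n is m.+1 then
    exists2 f', (forall x, is_derive x 1 f (f' x)) & Cn1 m f' else True.

Definition smooth1 f := forall n, Cn1 n f.

Lemma Cn1S n f : Cn1 n.+1 f -> Cn1 n f.
Proof.
elim: n f => [//|n IH] f [f' ff' cf']; exists f' => //; exact: IH.
Qed.

Lemma Cn1D n f g : Cn1 n f -> Cn1 n g -> Cn1 n (fun x => f x + g x).
Proof.
elim: n f g => [//|n IH] f g [f' ff' cf'] [g' gg' cg'].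
exists (fun x => f' x + g' x); last exact: IH.
by move=> x; exact: is_derive_add.
Qed.

Lemma Cn1M n f g : Cn1 n f -> Cn1 n g -> Cn1 n (fun x => f x * g x).
Proof.
elim: n f g => [//|n IH] f g cf cg.
have {}IHf := IH _ _ (Cn1S cf); have {}IHg := fun h ch => IH h _ ch (Cn1S cg).
case: cf => f' ff' cf'; case: cg => g' gg' cg'.
exists (fun x => f' x * g x + f x * g' x); first by move=> x; exact: is_derive_mul.
by apply: Cn1D; [exact: IHg | exact: IHf].
Qed.

Lemma Cn1_cst n (k : R) : Cn1 n (fun=> k).
Proof.
elim: n k => [//|n IH] k; exists (fun=> 0) => // x; exact: is_derive_const.
Qed.

Lemma Cn1V n f : (forall x, f x != 0) -> Cn1 n f -> Cn1 n (fun x => (f x)^-1).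
Proof.
move=> f0; elim: n => [//|n IH] cf.
have {}IH := IH (Cn1S cf); case: cf => f' ff' cf'.
exists (fun x => - f' x * ((f x)^-1 * (f x)^-1)).
  by move=> x; exact: is_derive_inv.
apply: Cn1M; last exact: Cn1M.
under [X in Cn1 _ X]funext do rewrite -mulN1r.
by apply: Cn1M => //; exact: Cn1_cst.
Qed.

Lemma is_derive_pow f (x v a : R) k : is_derive x v f a ->
  is_derive x v (fun y => f y ^+ k) (k%:R * f x ^+ k.-1 * a).
Proof.
move=> fa; elim: k => [|k IH].
  by rewrite !mul0r; under [X in is_derive _ _ X]funext do rewrite expr0; exact: is_derive_cst.
under [X in is_derive _ _ X]funext do rewrite exprS.
apply: (is_derive_eq (is_derive_mul fa IH)); case: k {IH} => [|k] /=.
  by rewrite !expr0; ring.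
by rewrite (exprS (f x) k) -(natr1 k.+1); ring.
Qed.

Lemma is_derive_affine (a b x : R) : is_derive x 1 (fun y => a * y + b) a.
Proof.
have := is_derive_add (is_derive_scale a (@is_derive_id _ _ x (1:R))) (is_derive_const x 1 b).
by move=> H; apply: (is_derive_eq H); rewrite mulr1 addr0.
Qed.

Lemma is_derive_comp_affine f (f' a b x : R) : is_derive (a * x + b) 1 f f' ->
  is_derive x 1 (fun y => f (a * y + b)) (a * f').
Proof.
by move=> ff'; rewrite mulrC; apply: is_derive1_comp => //; exact: is_derive_affine.
Qed.

Lemma Cn1_affine n f (a b : R) : Cn1 n f -> Cn1 n (fun x => f (a * x + b)).
Proof.
elim: n f => [//|n IH] f [f' ff' cf'].
exists (fun x => a * f' (a * x + b)).
  by move=> x; exact: is_derive_comp_affine.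
by apply: Cn1M; [exact: Cn1_cst | exact: IH].
Qed.

(** The powers of 1/x make the family of flat functions x^(-k) exp(-1/x) stable under
    differentiation; smoothness then only requires the derivative at 0 for every [k]. *)
Definition flat k x : R := if 0 < x then x^-1 ^+ k * expR (- x^-1) else 0.

Lemma flat_gt0 k x : 0 < x -> 0 < flat k x.
Proof. by move=> x0; rewrite /flat x0 mulr_gt0 ?expR_gt0 ?exprn_gt0 ?invr_gt0. Qed.

Lemma flat_ge0 k x : 0 <= flat k x.
Proof. by have [/flat_gt0/ltW|x0] := boolP (0 < x); rewrite // /flat (negPf x0). Qed.

Lemma flat_le0 k x : x <= 0 -> flat k x = 0.
Proof. by rewrite leNgt /flat => /negPf ->. Qed.

(** exp t is the (n+1)-th power of exp (t / (n+1)), which is at least t / (n+1). *)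
Lemma exp_dominates_pow n (t : R) : 0 < t -> t ^+ n.+1 * expR (- t) <= n.+1%:R ^+ n.+1.
Proof.
move=> t0; rewrite expRN ler_pdivrMr ?expR_gt0//.
have -> : expR t = expR (t / n.+1%:R) ^+ n.+1.
  by rewrite -expRM_natr divfK// pnatr_eq0.
rewrite -exprMn lerXn2r ?nnegrE ?(ltW t0) ?mulr_ge0 ?ler0n ?expR_ge0//.
rewrite mulrC -ler_pdivrMr ?ltr0n//.
by apply: le_trans (expR_ge1Dx _); rewrite lerDr.
Qed.

Lemma is_derive_flat0 k : is_derive (0 : R) 1 (flat k) 0.
Proof.
suff H : h^-1 *: (flat k (h *: 1 + 0) - flat k 0) @[h --> (0:R)^'] --> (0:R).
  by apply: DeriveDef; [apply/cvg_ex; exists 0 | exact/cvg_lim].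
(* The difference quotient at h > 0 is h^(-k-1) exp(-1/h). Bounding h^(-k-2) exp(-1/h) by [C] spares
   a factor h, so the quotient is at most [C] |h|. *)
pose C : R := k.+2%:R ^+ k.+2.
apply/norm_cvg0P.
apply: (@squeeze_cvgr _ _ _ _ (cst 0) (fun h : R => C * `|h|)).
- near=> h; rewrite normr_ge0 /= (flat_le0 _ (lexx 0)) subr0 addr0.
  rewrite /GRing.scale /= mulr1 normrM.
  have [h0|h0] := ltP 0 h; last first.
    by rewrite flat_le0// normr0 mulr0 mulr_ge0// exprn_ge0// ler0n.
  have hi : 0 <= h^-1 by rewrite invr_ge0 ltW.
  rewrite /flat h0 !ger0_norm ?mulr_ge0 ?expR_ge0 ?exprn_ge0 ?(ltW h0)//.
  rewrite mulrA -exprS -[leLHS]mulr1 -(@mulVf _ h) ?gt_eqF// mulrA.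
  rewrite ler_wpM2r ?(ltW h0)// mulrAC -exprSr.
  by apply: exp_dominates_pow; rewrite invr_gt0.
- exact: cvg_cst.
- rewrite -[X in _ --> X](mulr0 C); apply: cvgM; first exact: cvg_cst.
  have : `|h| @[h --> (0:R)^'] --> `|0 : R|.
    by apply: cvg_norm; apply: cvg_within_filter; exact: cvg_id.
  by rewrite normr0.
Unshelve. all: by end_near. Qed.

Lemma is_derive_flat k x : is_derive x 1 (flat k) (flat k.+2 x - k%:R * flat k.+1 x).
Proof.
have [x0|x0|<-] := ltgtP 0 x; last first.
- by rewrite !flat_le0// mulr0 subr0; exact: is_derive_flat0.
- apply: (@near_eq_is_derive _ _ _ (fun=> 0)).
    near=> y; rewrite flat_le0//; near: y.
    by apply: filterS (lt_nbhsl x0) => y /ltW.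
  rewrite !flat_le0 ?ltW// mulr0 subr0; exact: is_derive_const.
- apply: (@near_eq_is_derive _ _ _ (fun y : R => y^-1 ^+ k * expR (- y^-1))).
    by near=> y; rewrite /flat ifT//; near: y; exact: lt_nbhsr.
  have dV : is_derive x 1 (fun y : R => y^-1) (- (x^-1 * x^-1)).
    have x0' : x != 0 by rewrite gt_eqF.
    by apply: (is_derive_eq (is_derive_inv x0' (@is_derive_id _ _ x (1:R)))); rewrite mulN1r.
  have dN : is_derive x 1 (fun y : R => - y^-1) (x^-1 * x^-1).
    by rewrite -[X in is_derive _ _ _ X]opprK; exact: is_deriveN.
  have dE : is_derive x 1 (fun y : R => expR (- y^-1)) (expR (- x^-1) * (x^-1 * x^-1)).
    exact: (@is_derive1_comp _ expR (fun y => - y^-1)).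
  apply: (is_derive_eq (is_derive_mul (is_derive_pow k dV) dE)).
  rewrite /flat x0 /GRing.scale /=; case: k => [|k].
    by rewrite /= !expr0 !mul1r; ring.
  by rewrite /= !exprS; ring.
Unshelve. all: by end_near. Qed.

Lemma smooth1_flat k : smooth1 (flat k).
Proof.
move=> n; elim: n k => [//|n IH] k.
exists (fun x => flat k.+2 x - k%:R * flat k.+1 x); first by move=> x; exact: is_derive_flat.
have -> : (fun x => flat k.+2 x - k%:R * flat k.+1 x) =
          (fun x => flat k.+2 x + (- k%:R) * flat k.+1 x).
  by apply/funext => x; rewrite mulNr.
by apply: Cn1D => //; apply: Cn1M => //; exact: Cn1_cst.
Qed.

Lemma flat_sum_gt0 x : 0 < flat 0 x + flat 0 (- 1 * x + 1).
Proof.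
have [x0|x0] := ltP 0 x; first by apply: ltr_pwDl; [exact: flat_gt0|exact: flat_ge0].
by apply: ltr_wpDl; [exact: flat_ge0|apply: flat_gt0; lra].
Qed.

(** Transition from 0 on x <= 0 to 1 on x >= 1. The reflection 1 - x is spelt [- 1 * x + 1] to match
    the rule for affine substitutions. *)
Definition step x := flat 0 x * (flat 0 x + flat 0 (- 1 * x + 1))^-1.

Lemma smooth1_step : smooth1 step.
Proof.
move=> n; apply: Cn1M; first exact: smooth1_flat.
apply: Cn1V; first by move=> x; rewrite gt_eqF ?flat_sum_gt0.
by apply: Cn1D; [exact: smooth1_flat | apply: Cn1_affine; exact: smooth1_flat].
Qed.

Lemma step0 x : x <= 0 -> step x = 0.
Proof. by move=> x0; rewrite /step flat_le0// mul0r. Qed.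

Lemma step1 x : 1 <= x -> step x = 1.
Proof.
move=> x1; rewrite /step [X in _ + X]flat_le0; last lra.
by rewrite addr0 mulfV// gt_eqF// flat_gt0//; lra.
Qed.

Lemma step_ge0 x : 0 <= step x.
Proof. by rewrite /step mulr_ge0 ?flat_ge0// invr_ge0 ltW ?flat_sum_gt0. Qed.

Lemma step_le1 x : step x <= 1.
Proof.
by rewrite /step ler_pdivrMr ?flat_sum_gt0// mul1r lerDl flat_ge0.
Qed.

(** Nonnegative, supported in [0, 1], of integral [step 1 - step 0] = 1: the profile of the
    mollifiers. With a known primitive, their normalisation is an instance of the fundamental
    theorem of calculus. *)
Definition dstep : R -> R := derive1 step.

Lemma is_derive_step x : is_derive x 1 step (dstep x).
Proof.
have [f' sf' _] := smooth1_step 1; rewrite /dstep derive1E (is_deriveE (sf' x)).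
exact: sf'.
Qed.

Lemma smooth1_dstep : smooth1 dstep.
Proof.
move=> n; have [f' sf' cf'] := smooth1_step n.+1.
suff -> : dstep = f' by [].
by apply/funext => x; rewrite /dstep derive1E (is_deriveE (sf' x)).
Qed.

Lemma dstep_ge0 x : 0 <= dstep x.
Proof.
pose a := flat 0 x; pose b := flat 0 (- 1 * x + 1).
pose a' := flat 2 x; pose b' := - 1 * flat 2 (- 1 * x + 1).
have da : is_derive x 1 (flat 0) a'.
  by apply: (is_derive_eq (is_derive_flat 0 x)); rewrite mul0r subr0.
have db : is_derive x 1 (fun y => flat 0 (- 1 * y + 1)) b'.
  apply: is_derive_comp_affine.
  by apply: (is_derive_eq (is_derive_flat 0 _)); rewrite mul0r subr0.
have ab0 : a + b != 0 by rewrite gt_eqF ?flat_sum_gt0.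
have dS := is_derive_mul da (@is_derive_inv (fun y => flat 0 y + flat 0 (- 1 * y + 1)) x 1 _ ab0
    (is_derive_add da db)).
rewrite /dstep derive1E (is_deriveE dS).
have -> : a' * (a + b)^-1 + a * (- (a' + b') * ((a + b)^-1 * (a + b)^-1)) =
   (a' * b - a * b') * ((a + b)^-1 * (a + b)^-1) by field.
rewrite mulr_ge0 ?mulr_ge0 ?invr_ge0 ?(ltW (flat_sum_gt0 x))//.
rewrite /b' mulN1r mulrN opprK addr_ge0 ?mulr_ge0 ?flat_ge0//.
Qed.

(** [step] is constant on x < 0; at 0 the derivative is the limit of its values from the left. *)
Lemma dstep_le0 x : x <= 0 -> dstep x = 0.
Proof.
have [f' sf' [f'' sf'' _]] := smooth1_step 2; have E y : dstep y = f' y.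
  by rewrite /dstep derive1E (is_deriveE (sf' y)).
have N (y : R) : y < 0 -> f' y = 0.
  move=> y0; rewrite -E /dstep derive1E.
  apply: is_deriveE; apply: (@near_eq_is_derive _ _ _ (fun _ : R => 0 : R)).
    by near=> z; rewrite step0// ltW//; near: z; exact: lt_nbhsl.
rewrite le_eqVlt => /orP[/eqP->|/N]; last by rewrite E.
rewrite E; apply/eqP; rewrite eq_le; apply/andP; split; last by rewrite -E dstep_ge0.
have cf' : f' @ (0:R)^'- --> f' 0.
  apply: cvg_at_left_filter; apply: differentiable_continuous.
  by apply/derivable1_diffP; exact: is_derive_derivable (sf'' 0).
rewrite -(cvg_lim _ cf')//; apply: limr_le; first by apply/cvg_ex; exists (f' 0).
by near=> y; rewrite N//; near: y; exact: nbhs_left_lt.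
Unshelve. all: by end_near. Qed.

(** The reflection x -> 1 - x exchanges the two ends: step (1 - x) = 1 - step x. *)
Lemma dstep_ge1 x : 1 <= x -> dstep x = 0.
Proof.
have S y : step (- 1 * y + 1) = 1 - step y.
  rewrite /step; have -> : - 1 * (- 1 * y + 1) + 1 = y by ring.
  have := flat_sum_gt0 y; rewrite [X in _ / X = _]addrC.
  move: (flat 0 y) (flat 0 (- 1 * y + 1)) => u w.
  by move=> /lt0r_neq0 h; field.
move=> x1; rewrite /dstep derive1E.
have H : is_derive x 1 (fun y => 1 - step (- 1 * y + 1)) (0 - (- 1 * dstep (- 1 * x + 1))).
  apply: (is_derive_sub (is_derive_const x (1 : R) 1)).
  apply: is_derive_comp_affine; exact: is_derive_step.
have -> : step = (fun y => 1 - step (- 1 * y + 1)).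
  by apply/funext => y; rewrite S opprB addrC subrK.
by rewrite (is_deriveE H) dstep_le0 ?mulr0 ?subr0//; lra.
Unshelve. all: by end_near. Qed.

End SmoothStep.

Section SmoothPlane.
Variable R : realType.
Local Notation plane := (R * R)%type.
Implicit Types (f g : plane -> R) (x y : plane) (i : 'I_2).

Lemma ord2P i : i = 0 \/ i = 1.
Proof. by case: i => [[|[|//]] p]; [left|right]; apply: val_inj. Qed.

Lemma is_derive_line f y i t a : is_derive (t *: basis R i + y) (basis R i) f a ->
  is_derive t 1 (fun s : R => f (s *: basis R i + y)) a.
Proof.
have E : (fun h : R => h^-1 *: (f ((h *: 1 + t) *: basis R i + y) - f (t *: basis R i + y))) =
         (fun h : R => h^-1 *: (f (h *: basis R i + (t *: basis R i + y)) - f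
             (t *: basis R i + y))).
  by apply/funext => h; rewrite scalerDl addrA [h *: 1]mulr1.
by case=> df <-; apply: DeriveDef; rewrite /derivable /derive E.
Qed.

Lemma is_derive_line0 f y i a : is_derive (0 : R) 1 (fun s : R => f (s *: basis R i + y)) a ->
  is_derive y (basis R i) f a.
Proof.
have E : (fun h : R => h^-1 *: (f ((h *: 1 + 0) *: basis R i + y) - f (0 *: basis R i + y))) =
         (fun h : R => h^-1 *: (f (h *: basis R i + y) - f y)).
  by apply/funext => h; rewrite addr0 [h *: 1]mulr1 scale0r add0r.
by case=> df <-; apply: DeriveDef; move: df; rewrite /derivable /derive E.
Qed.

(** Continuity is carried along at each level because, unlike on the line, it does not follow from
    the existence of the partial derivatives. *)
Fixpoint Cn2 n f : Prop := continuous f /\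
  if n is m.+1 then forall i, exists2 f', (forall x, is_derive x (basis R i) f (f' x)) & Cn2 m f'
  else True.

Lemma Cn2S n f : Cn2 n.+1 f -> Cn2 n f.
Proof.
elim: n f => [|n IH] f [cf df]; first by split.
split=> // i; have [f' ff' cf'] := df i; exists f' => //; exact: IH.
Qed.

Lemma pds_rcons s i f : pds (rcons s i) f = pds s (pd i f).
Proof. by rewrite /pds foldr_rcons. Qed.

Lemma smooth_pd f i : smooth f -> smooth (pd i f).
Proof. by move=> sf s; rewrite -pds_rcons; exact: sf. Qed.

Lemma smooth_pds f s : smooth f -> smooth (pds s f).
Proof. by move=> sf; elim: s => [//|i s IH]; exact: smooth_pd. Qed.

Lemma smooth_is_derive f : smooth f -> forall x i, is_derive x (basis R i) f (pd i f x).
Proof. by move=> /(_ [::])[_ df] x i; apply: DeriveDef. Qed.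

Lemma smooth_cont f : smooth f -> continuous f.
Proof. by move=> /(_ [::])[]. Qed.

(** [pds] applies the last index of its list first, hence the induction from the end of the list in
    the converse direction. *)
Lemma smoothP f : smooth f <-> forall n, Cn2 n f.
Proof.
split=> [sf n|cf s].
  elim: n f sf => [|n IH] f sf; (split; first exact: smooth_cont) => // i.
  by exists (pd i f); [move=> x; exact: smooth_is_derive | apply: IH; exact: smooth_pd].
have {cf} := cf (size s).+1; move: s f.
elim/last_ind => [f [cf df]|s i IH f].
  by split=> //= x i; have [f' ff' _] := df i; apply: is_derive_derivable (ff' x).
rewrite size_rcons => -[cf df]; rewrite pds_rcons; apply: IH.
have [f' ff' cf'] := df i; suff -> : pd i f = f' by [].
by apply/funext => x; exact: is_deriveE.
Qed.

Lemma Cn2_cst n (k : R) : Cn2 n (fun _ : plane => k).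
Proof.
elim: n k => [|n IH] k; (split; first exact: cst_continuous) => // i.
by exists (fun=> 0) => // x; exact: is_derive_const.
Qed.

Lemma Cn2D n f g : Cn2 n f -> Cn2 n g -> Cn2 n (fun x => f x + g x).
Proof.
elim: n f g => [|n IH] f g [cf df] [cg dg].
  by split=> // x; apply: cvgD; [exact: cf|exact: cg].
split=> [x|i]; first by apply: cvgD; [exact: cf|exact: cg].
have [f' ff' cf'] := df i; have [g' gg' cg'] := dg i.
exists (fun x => f' x + g' x); last exact: IH.
by move=> x; exact: is_derive_add.
Qed.

Lemma Cn2M n f g : Cn2 n f -> Cn2 n g -> Cn2 n (fun x => f x * g x).
Proof.
elim: n f g => [|n IH] f g [cf df] [cg dg].
  by split=> // x; apply: cvgM; [exact: cf|exact: cg].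
have cf0 := Cn2S (conj cf df : Cn2 n.+1 f); have cg0 := Cn2S (conj cg dg : Cn2 n.+1 g).
split=> [x|i]; first by apply: cvgM; [exact: cf|exact: cg].
have [f' ff' cf'] := df i; have [g' gg' cg'] := dg i.
exists (fun x => f' x * g x + f x * g' x); first by move=> x; exact: is_derive_mul.
by apply: Cn2D; exact: IH.
Qed.

Lemma smooth_cst (k : R) : smooth (fun _ : plane => k).
Proof. by apply/smoothP => n; exact: Cn2_cst. Qed.

Lemma smoothD f g : smooth f -> smooth g -> smooth (fun x => f x + g x).
Proof. by move=> /smoothP cf /smoothP cg; apply/smoothP => n; exact: Cn2D. Qed.

Lemma smoothM f g : smooth f -> smooth g -> smooth (fun x => f x * g x).
Proof. by move=> /smoothP cf /smoothP cg; apply/smoothP => n; exact: Cn2M. Qed.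

Lemma smoothZ (k : R) f : smooth f -> smooth (fun x => k * f x).
Proof. by move=> sf; apply: smoothM => //; exact: smooth_cst. Qed.

Lemma smoothN f : smooth f -> smooth (fun x => - f x).
Proof.
move=> sf; have -> : (fun x => - f x) = (fun x => -1 * f x).
  by apply/funext => x; rewrite mulN1r.
exact: smoothZ.
Qed.

Lemma smoothB f g : smooth f -> smooth g -> smooth (fun x => f x - g x).
Proof. by move=> sf sg; exact: (smoothD sf (smoothN sg)). Qed.

Lemma pdD f g i : smooth f -> smooth g -> pd i (fun x => f x + g x) =
    (fun x => pd i f x + pd i g x).
Proof.
by move=> sf sg; apply/funext => x; apply: is_deriveE; apply: is_derive_add;
    exact: smooth_is_derive.
Qed.

Lemma pdM f g i : smooth f -> smooth g ->
  pd i (fun x => f x * g x) = (fun x => pd i f x * g x + f x * pd i g x).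
Proof.
by move=> sf sg; apply/funext => x; apply: is_deriveE; apply: is_derive_mul;
    exact: smooth_is_derive.
Qed.

Lemma pdZ (k : R) f i : smooth f -> pd i (fun x => k * f x) = (fun x => k * pd i f x).
Proof.
by move=> sf; apply/funext => x; apply: is_deriveE; apply: is_derive_scale; exact: smooth_is_derive.
Qed.

Lemma pd_cst (k : R) i : pd i (fun _ : plane => k) = (fun=> 0).
Proof. by apply/funext => x; apply: is_deriveE; exact: is_derive_const. Qed.

Lemma pdN f i : smooth f -> pd i (fun x => - f x) = (fun x => - pd i f x).
Proof.
move=> sf; have -> : (fun x => - f x) = (fun x => -1 * f x).
  by apply/funext => x; rewrite mulN1r.
by rewrite pdZ//; apply/funext => x; rewrite mulN1r.
Qed.

Lemma pdB f g i : smooth f -> smooth g -> pd i (fun x => f x - g x) =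
    (fun x => pd i f x - pd i g x).
Proof. by move=> sf sg; rewrite (pdD i sf (smoothN sg)) (pdN i sg). Qed.

Lemma is_derive_fst (h : R -> R) x (a : R) i : is_derive x.1 1 h a ->
  is_derive x (basis R i) (fun y => h y.1) (if i == 0 then a else 0).
Proof.
move=> ha; apply: is_derive_line0; case: (ord2P i) => -> /=.
  have -> : (fun s : R => h (s * (0 == 0 :> 'I_2)%:R + x.1)) = (fun s : R => h (1 * s + x.1)).
    by apply/funext => s; rewrite eqxx mulr1 mul1r.
  rewrite -[a]mul1r; apply: is_derive_comp_affine; by rewrite mulr0 add0r.
have -> : (fun s : R => h (s * (1 == 0 :> 'I_2)%:R + x.1)) = (fun s : R => h x.1).
  by apply/funext => s; rewrite mulr0 add0r.
exact: is_derive_const.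
Qed.

Lemma is_derive_snd (h : R -> R) x (a : R) i : is_derive x.2 1 h a ->
  is_derive x (basis R i) (fun y => h y.2) (if i == 0 then 0 else a).
Proof.
move=> ha; apply: is_derive_line0; case: (ord2P i) => -> /=; last first.
  have -> : (fun s : R => h (s * (1 == 1 :> 'I_2)%:R + x.2)) = (fun s : R => h (1 * s + x.2)).
    by apply/funext => s; rewrite eqxx mulr1 mul1r.
  rewrite -[a]mul1r; apply: is_derive_comp_affine; by rewrite mulr0 add0r.
have -> : (fun s : R => h (s * (0 == 1 :> 'I_2)%:R + x.2)) = (fun s : R => h x.2).
  by apply/funext => s; rewrite mulr0 add0r.
exact: is_derive_const.
Qed.

Lemma smooth1_cont (h : R -> R) : smooth1 h -> continuous h.
Proof.
move=> sh x; have [h' hh' _] := sh 1%N; apply: differentiable_continuous.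
by apply/derivable1_diffP; exact: is_derive_derivable (hh' x).
Qed.

Lemma smooth1_derive (h : R -> R) : smooth1 h ->
  exists2 h' : R -> R, (forall t : R, is_derive t 1 h (h' t)) & smooth1 h'.
Proof.
move=> sh; have [h' hh' _] := sh 1%N; exists h' => // n.
have [h'' hh'' c] := sh n.+1; suff -> : h' = h'' by [].
by apply/funext => x; rewrite -(is_deriveE (hh' x)) (is_deriveE (hh'' x)).
Qed.

Lemma smooth_tensor (h k : R -> R) : smooth1 h -> smooth1 k -> smooth (fun x => h x.1 * k x.2).
Proof.
move=> sh sk; apply/smoothP => n; apply: Cn2M.
  elim: n h sh => [|n IH] h sh; (split; first by move=> x;
      apply: (continuous_comp (@cvg_fst _ _ _ _ _)); exact: smooth1_cont) => // i.
  have [h' hh' sh'] := smooth1_derive sh.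
  exists (fun x => if i == 0 then h' x.1 else 0); first by move=> x; exact: is_derive_fst.
  by case: (i == 0); [exact: IH | exact: Cn2_cst].
elim: n k sk => [|n IH] k sk; (split; first by move=> x;
    apply: (continuous_comp (@cvg_snd _ _ _ _ _)); exact: smooth1_cont) => // i.
have [k' kk' sk'] := smooth1_derive sk.
exists (fun x => if i == 0 then 0 else k' x.2); first by move=> x; exact: is_derive_snd.
by case: (i == 0); [exact: Cn2_cst | exact: IH].
Qed.

Lemma smooth1_id : smooth1 (fun t : R => t).
Proof.
case=> [//|n]; exists (fun=> 1); last exact: Cn1_cst.
by move=> x; exact: is_derive_id.
Qed.

Lemma smooth1_cst (k : R) : smooth1 (fun _ : R => k).
Proof. by move=> n; exact: Cn1_cst. Qed.

(** Product of a rising and a falling transition around [q]: equal to 1 at distance at most [r], to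
    0 at distance at least 2 [r]. *)
Definition bump (q r t : R) := step (r^-1 * t + (2 - q / r)) * step (- r^-1 * t + (2 + q / r)).

Lemma smooth1_bump q r : smooth1 (bump q r).
Proof. by move=> n; apply: Cn1M; apply: Cn1_affine; exact: smooth1_step. Qed.

Lemma bump_ge0 q r t : 0 <= bump q r t.
Proof. by rewrite mulr_ge0 ?step_ge0. Qed.

Lemma bump_le1 q r t : bump q r t <= 1.
Proof. by rewrite mulr_ile1 ?step_ge0 ?step_le1. Qed.

Lemma bump1 q r t : 0 < r -> `|t - q| <= r -> bump q r t = 1.
Proof.
move=> r0; rewrite ler_norml => /andP[h1 h2].
have E : (t - q) / r = r^-1 * t - q / r by ring.
have a1 : - 1 <= (t - q) / r by rewrite ler_pdivlMr// mulN1r.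
have a2 : (t - q) / r <= 1 by rewrite ler_pdivrMr// mul1r.
by rewrite /bump !step1 ?mul1r//; rewrite ?mulNr; lra.
Qed.

Lemma bump0 q r t : 0 < r -> 2 * r <= `|t - q| -> bump q r t = 0.
Proof.
move=> r0; have E : (t - q) / r = r^-1 * t - q / r by ring.
rewrite ler_normr => /orP[h|h].
  have a : 2 <= (t - q) / r by rewrite ler_pdivlMr.
  by rewrite /bump [X in _ * X]step0 ?mulr0// mulNr; lra.
have a : (t - q) / r <= - 2 by rewrite ler_pdivrMr//; lra.
by rewrite /bump step0 ?mul0r//; lra.
Qed.

Definition box (p : plane) (r : R) : set plane := [set x | `|x.1 - p.1| <= r /\ `|x.2 - p.2| <= r].

Definition bump2 (p : plane) (r : R) x := bump p.1 r x.1 * bump p.2 r x.2.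

Lemma smooth_bump2 p r : smooth (bump2 p r).
Proof. by apply: smooth_tensor; exact: smooth1_bump. Qed.

Lemma bump2_ge0 p r x : 0 <= bump2 p r x.
Proof. by rewrite mulr_ge0 ?bump_ge0. Qed.

Lemma bump2_le1 p r x : bump2 p r x <= 1.
Proof. by rewrite mulr_ile1 ?bump_ge0 ?bump_le1. Qed.

Lemma bump2_1 p r x : 0 < r -> box p r x -> bump2 p r x = 1.
Proof. by move=> r0 [h1 h2]; rewrite /bump2 !bump1 ?mulr1. Qed.

Lemma bump2_0 p r x : 0 < r -> ~ box p (2 * r) x -> bump2 p r x = 0.
Proof.
move=> r0 nb; rewrite /bump2; have [h1|/ltW h1] := leP `|x.1 - p.1| (2 * r); last first.
  by rewrite bump0// mul0r.
have [h2|/ltW h2] := leP `|x.2 - p.2| (2 * r); first by case: nb.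
by rewrite [X in _ * X]bump0// mulr0.
Qed.

Lemma box_prod p r : box p r = `[p.1 - r, p.1 + r] `*` `[p.2 - r, p.2 + r].
Proof.
apply/seteqP; split=> x; rewrite /box /= !in_itv /= !ler_distl.
  by case=> /andP[-> ->] /andP[-> ->].
by case=> /andP[-> ->] /andP[-> ->].
Qed.

Lemma compact_box p r : compact (box p r).
Proof. by rewrite box_prod; apply: compact_setX; exact: segment_compact. Qed.

Lemma nbhs_box p r : 0 < r -> nbhs p (box p r).
Proof.
move=> r0; exists (ball p.1 r, ball p.2 r); first by split; exact: nbhsx_ballx.
move=> [a b] [/=]; rewrite -!ball_normE /= => /ltW h1 /ltW h2.
by split; rewrite /= distrC.
Qed.

Lemma nbhs_boxP (p : plane) (A : set plane) : nbhs p A -> exists2 r : R, 0 < r & box p r `<=` A.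
Proof.
case=> -[P Q] [/= /nbhs_ballP[e1 /= e1p H1] /nbhs_ballP[e2 /= e2p H2]] PQ.
exists (Num.min e1 e2 / 2); first by rewrite divr_gt0// lt_min e1p.
have m0 : 0 < Num.min e1 e2 by rewrite lt_min e1p.
move=> x [h1 h2]; apply: PQ; split; [apply: H1|apply: H2]; rewrite -ball_normE /= distrC.
  apply: le_lt_trans h1 _; apply: (@lt_le_trans _ _ (Num.min e1 e2)); last by rewrite ge_min lexx.
  lra.
apply: le_lt_trans h2 _; apply: (@lt_le_trans _ _ (Num.min e1 e2));
    last by rewrite ge_min lexx orbT.
lra.
Qed.

End SmoothPlane.

(** * Integrals on the plane and density of test functions *)

Section RealIntegrals.
Context d (T : measurableType d) (R : realType).
Variable mu : {measure set T -> \bar R}.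
Implicit Types f g h : T -> R.

(** Functions on omega will be extended by zero, so integrals are taken over the whole space and
    carry no domain. *)
Definition ig f := mu.-integrable setT (EFin \o f).

Definition ii f : R := \int[mu]_x f x.

Lemma ig_meas f : ig f -> measurable_fun setT f.
Proof. by move=> /integrableP[/measurable_EFinP]. Qed.

Lemma ig_le f g : measurable_fun setT f -> (forall x, `|f x| <= g x) -> ig g -> ig f.
Proof.
move=> mf fg ig; apply: le_integrable ig => //; first exact/measurable_EFinP.
by move=> x _ /=; rewrite lee_fin (le_trans (fg x))// ler_norm.
Qed.

Lemma ig0 : ig (fun=> 0). Proof. exact: integrable0. Qed.

Lemma igD f g : ig f -> ig g -> ig (fun x => f x + g x).
Proof. by move=> If Ig; have := integrableD measurableT If Ig. Qed.

Lemma igB f g : ig f -> ig g -> ig (fun x => f x - g x).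
Proof. by move=> If Ig; have := integrableB measurableT If Ig. Qed.

Lemma igZ (k : R) f : ig f -> ig (fun x => k * f x).
Proof. by move=> If; have := integrableZl measurableT k If. Qed.

Lemma ig_abs f : ig f -> ig (fun x => `|f x|).
Proof. by move=> If; have := integrable_abse If. Qed.

Lemma ig_mulb f h (M : R) : ig f -> measurable_fun setT h -> (forall x, `|h x| <= M) ->
  ig (fun x => f x * h x).
Proof.
move=> If mh hM; apply: (@ig_le _ (fun x => M * `|f x|)); last exact/igZ/ig_abs.
  by apply: measurable_funM => //; exact: ig_meas.
by move=> x; rewrite normrM mulrC ler_wpM2r.
Qed.

Lemma ig_mul f g : measurable_fun setT f -> measurable_fun setT g ->
  ig (fun x => f x ^+ 2) -> ig (fun x => g x ^+ 2) -> ig (fun x => f x * g x).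
Proof.
move=> mf mg If Ig; apply: (ig_le _ _ (igD If Ig)); first exact: measurable_funM.
move=> x; rewrite normrM -(real_normK (num_real (f x))) -(real_normK (num_real (g x))).
by have := sqr_ge0 (`|f x| - `|g x|); nra.
Qed.

Lemma iiD f g : ig f -> ig g -> ii (fun x => f x + g x) = ii f + ii g.
Proof. by move=> If Ig; exact: RintegralD. Qed.

Lemma iiB f g : ig f -> ig g -> ii (fun x => f x - g x) = ii f - ii g.
Proof. by move=> If Ig; exact: RintegralB. Qed.

Lemma iiZ (k : R) f : ig f -> ii (fun x => k * f x) = k * ii f.
Proof. by move=> If; exact: RintegralZl. Qed.

Lemma iiN f : ig f -> ii (fun x => - f x) = - ii f.
Proof.
move=> If; rewrite -mulN1r -iiZ//; congr ii.
by apply/funext => x; rewrite mulN1r.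
Qed.

Lemma ii_le f g : ig f -> ig g -> (forall x, f x <= g x) -> ii f <= ii g.
Proof. by move=> If Ig fg; apply: le_Rintegral => // x _; exact: fg. Qed.

Lemma ii_ge0 f : (forall x, 0 <= f x) -> 0 <= ii f.
Proof. by move=> f0; apply: Rintegral_ge0 => x _; exact: f0. Qed.

Lemma ii0 : ii (fun=> 0) = 0.
Proof.
by rewrite /ii /Rintegral integral0.
Qed.

Lemma ii_abs f : ig f -> `|ii f| <= ii (fun x => `|f x|).
Proof. by move=> If; exact: le_normr_Rintegral. Qed.

Lemma iiE f : ig f -> (ii f)%:E = (\int[mu]_x (f x)%:E)%E.
Proof. by move=> If; rewrite /ii /Rintegral fineK//; exact: integrable_fin_num. Qed.

Lemma ii_cvg (F : nat -> T -> R) f g : (forall n, measurable_fun setT (F n)) -> ig g ->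
  (forall n x, `|F n x| <= g x) -> (forall x, F n x @[n --> \oo] --> f x) ->
  ig f /\ (ii (F n) @[n --> \oo] --> ii f).
Proof.
move=> mF Ig Fg Ff.
have mf : measurable_fun setT f by apply: (measurable_fun_cvg mF) => x _; exact: Ff.
have cF : {ae mu, forall x, setT x -> (EFin \o (fun n => F n x)) n @[n --> \oo] --> (EFin \o f) x}.
  by apply: aeW => x _; apply: cvg_EFin; [exact: nearW | exact: Ff].
have bF : {ae mu, forall x n, setT x -> (`|(EFin \o F n) x| <= (EFin \o g) x)%E}.
  by apply: aeW => x n _ /=; rewrite lee_fin.
have mF' n : measurable_fun setT (EFin \o F n) by exact/measurable_EFinP.
have mf' : measurable_fun setT (EFin \o f) by exact/measurable_EFinP.
have [If _ C] := @dominated_convergence _ _ _ mu _ measurableT (fun n => EFin \o F n) _ _ mF' mf'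
    cF Ig bF.
split=> //.
have IF n : ig (F n) by apply: ig_le Ig.
move: C; rewrite -iiE// => /fine_cvgP[_].
by apply: cvg_trans; apply: near_eq_cvg; near=> n.
Unshelve. all: by end_near. Qed.

End RealIntegrals.

(** * Open sets of the plane and test functions increasing to their indicators *)

Section OpenSets.
Variable R : realType.
Local Notation plane := (R * R)%type.
Implicit Types (f g : plane -> R) (x y : plane) (U : set plane).

(** Enumeration of the countably many squares with rational centre and radius 1/(n+1). They yield
    both the measurability of open sets and the approximation of their indicators. *)
Definition cen (k : nat) : plane := if @unpickle (rat * rat * nat)%type k is Some q then
    (ratr q.1.1, ratr q.1.2) else (0, 0).

Definition rad (k : nat) : R := if @unpickle (rat * rat * nat)%type k is Some q then q.2.+1%:R^-1
    else 1.

Lemma rad_gt0 k : 0 < rad k.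
Proof. by rewrite /rad; case: unpickle => [q|//]; rewrite invr_gt0 ltr0n. Qed.

Lemma rat_box U x : open U -> U x -> exists k,
    box (cen k) (rad k) x /\ box (cen k) (2 * rad k) `<=` U.
Proof.
move=> oU Ux; have [r r0 rU] := nbhs_boxP (open_nbhs_nbhs (conj oU Ux)).
have [n nr] : exists n, 3 * n.+1%:R^-1 <= r.
  have t0 : 0 < r / 3 by rewrite divr_gt0.
  have [n /ltW nt] := ltr_add_invr t0.
  by exists n; rewrite mulrC -ler_pdivlMr//; move: nt; rewrite add0r.
set t : R := n.+1%:R^-1 in nr.
have t0 : 0 < t by rewrite invr_gt0.
have P (u : R) : exists q : rat, `|u - ratr q| <= t.
  have [q] : exists q : rat, ratr q \in `]u - t, u + t[ by apply: rat_in_itvoo; lra.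
  rewrite in_itv /= => /andP[q1 q2]; exists q; rewrite ler_norml; apply/andP; split; lra.
have [q1 h1] := P x.1; have [q2 h2] := P x.2.
exists (pickle (q1, q2, n)); rewrite /cen /rad pickleK /= -/t; split; first by [].
move=> y [/= k1 k2]; apply: rU; split => /=.
  have := ler_normD (y.1 - ratr q1) (ratr q1 - x.1); rewrite addrA subrK (distrC (ratr q1) x.1);
      lra.
have := ler_normD (y.2 - ratr q2) (ratr q2 - x.2); rewrite addrA subrK (distrC (ratr q2) x.2); lra.
Qed.

Lemma measurable_box (p : plane) (r : R) : measurable (box p r).
Proof. by rewrite box_prod; apply: measurableX; exact: measurable_itv. Qed.

Lemma open_measurable2 U : open U -> measurable U.
Proof.
move=> oU.
have -> : U = \bigcup_k [set x | box (cen k) (rad k) x /\ box (cen k) (2 * rad k) `<=` U].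
  apply/seteqP; split=> x; first by move=> Ux; have [k [h1 h2]] := rat_box oU Ux; exists k.
  case=> k _ [[h1 h2] h]; apply: h; have := rad_gt0 k; move=> r0.
  by split; [apply: le_trans h1 _|apply: le_trans h2 _]; lra.
apply: bigcup_measurable => k _.
have [h|h] := pselect (box (cen k) (2 * rad k) `<=` U).
  have -> : [set x | box (cen k) (rad k) x /\ box (cen k) (2 * rad k) `<=` U] = box (cen k) (rad k).
    by apply/seteqP; split=> x; [case|].
  exact: measurable_box.
have -> : [set x | box (cen k) (rad k) x /\ box (cen k) (2 * rad k) `<=` U] = set0.
  by apply/seteqP; split=> x //; case.
exact: measurable0.
Qed.

Lemma continuous_measurable2 f : continuous f -> measurable_fun setT f.
Proof.
move=> /continuousP cf; apply: (measurability _ (RGenOpens.measurableE R)).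
move=> _ [_ [a [b ->] <-]]; rewrite setTI; apply: open_measurable2.
exact/cf/interval_open.
Qed.

Definition inside U k : bool := `[< box (cen k) (2 * rad k) `<=` U >].

(** Product of 1 - bump over those of the first [n] rational squares whose double lies in [U]. One
    minus this product has compact support in [U] and is eventually 1 at each point of an open
    [U]. *)
Fixpoint coapprox U n x : R := if n is m.+1 then
  coapprox U m x * (1 - (inside U m)%:R * bump2 (cen m) (rad m) x) else 1.

Lemma factor01 U k x : 0 <= 1 - (inside U k)%:R * bump2 (cen k) (rad k) x <= 1.
Proof.
have := bump2_ge0 (cen k) (rad k) x; have := bump2_le1 (cen k) (rad k) x.
by case: (inside U k) => h1 h2; rewrite ?mul1r ?mul0r; apply/andP; split; lra.
Qed.

Lemma coapprox01 U n x : 0 <= coapprox U n x <= 1.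
Proof.
elim: n => [|n /andP[h1 h2]] /=; first by rewrite ler01 lexx.
have /andP[h3 h4] := factor01 U n x.
by rewrite mulr_ge0// mulr_ile1.
Qed.

Lemma smooth_coapprox U n : smooth (coapprox U n).
Proof.
elim: n => [|n IH] /=; first exact: smooth_cst.
apply: (smoothM IH); apply: (smoothB (smooth_cst 1)); apply: smoothZ; exact: smooth_bump2.
Qed.

Definition approx1 U n x : R := 1 - coapprox U n x.

Lemma approx1_test U n : test_fun U (approx1 U n).
Proof.
split; first by apply: (smoothB (smooth_cst 1)); exact: smooth_coapprox.
suff [K [cK KU K0]] : exists K, [/\ compact K, K `<=` U & forall y, ~ K y -> coapprox U n y = 1].
  by exists K; split => // y /K0; rewrite /approx1 => ->; rewrite subrr.
elim: n => [|n [K [cK KU K0]]]; first by exists set0; split => //; exact: compact0.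
have [h|h] := boolP (inside U n); last first.
  by exists K; split=> // y /K0 /= ->; rewrite (negPf h) mul0r subr0 mulr1.
exists (K `|` box (cen n) (2 * rad n)); split.
- by apply: compactU => //; exact: compact_box.
- by move=> y [/KU//|]; move: h => /asboolP; exact.
- move=> y /not_orP[/K0 /= -> nb]; rewrite bump2_0 ?rad_gt0//.
  by rewrite mulr0 subr0 mulr1.
Qed.

Lemma approx1_01 U n x : 0 <= approx1 U n x <= 1.
Proof. by have /andP[h1 h2] := coapprox01 U n x; rewrite /approx1; apply/andP; split; lra. Qed.

Lemma approx1_in U x : open U -> U x -> exists N, forall n, (N <= n)%N -> approx1 U n x = 1.
Proof.
move=> oU Ux; have [k [h1 h2]] := rat_box oU Ux; exists k.+1; elim=> [//|n IH].
rewrite leq_eqVlt => /orP[/eqP[<-]|].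
  rewrite /approx1 /= (_ : inside U k = true); last exact/asboolP.
  by rewrite mul1r bump2_1 ?rad_gt0// subrr mulr0 subr0.
rewrite ltnS => /IH; rewrite /approx1 /= => h.
have -> : coapprox U n x = 0 by lra.
by rewrite mul0r subr0.
Qed.

Lemma test_fun_out U f x : test_fun U f -> ~ U x -> f x = 0.
Proof. by move=> [_ [K [_ KU K0]]] nU; apply: K0 => /KU. Qed.

Lemma approx1_cvg U x : open U -> approx1 U n x @[n --> \oo] --> (\1_U x : R).
Proof.
move=> oU; have [Ux|nU] := pselect (U x).
  have [N hN] := approx1_in oU Ux; rewrite indicE mem_set//.
  apply: (@cvg_trans _ ((fun=> 1%:R) @ \oo)); last exact: cvg_cst.
  by apply: near_eq_cvg; near=> n; rewrite hN//; near: n; exact: nbhs_infty_ge.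
rewrite indicE memNset//.
have -> : (fun n => approx1 U n x) = (fun=> 0).
  by apply/funext => n; exact: (test_fun_out (approx1_test U n)).
exact: cvg_cst.
Unshelve. all: by end_near. Qed.

End OpenSets.

Import HBSimple HBNNSimple.

Section PlaneIntegrals.
Variable R : realType.
Local Notation plane := (R * R)%type.
Local Notation mu := (@leb2 R).
Local Notation ig2 := (ig (@leb2 R)).
Local Notation ii2 := (ii (@leb2 R)).
Implicit Types (f g : plane -> R) (x y p : plane) (U : set plane).

Lemma leb2_box p r : (mu (box p r) < +oo)%E.
Proof.
rewrite box_prod /leb2 product_measure1E; try exact: measurable_itv.
have h (q : R) : (lebesgue_measure (`[(q - r)%R, (q + r)%R]%classic : set R) < +oo)%E.
  by rewrite lebesgue_measure_itv /=; case: ifP => _ //; rewrite -EFinB ltry.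
by apply: lte_mul_pinfty => //; rewrite ?ge0_fin_numE//; exact: h.
Qed.

Lemma ig_indic (A : set plane) : measurable A -> (mu A < +oo)%E -> ig2 (\1_A).
Proof.
move=> mA Af; apply/integrableP; split; first exact/measurable_EFinP/measurable_indicP.
rewrite (_ : (fun x => _) = (fun x => (\1_A x)%:E)).
  by rewrite integral_indic// setIT.
by apply/funext => x /=; rewrite ger0_norm// indicE ler0n.
Qed.

Lemma ig_bounded_box f p r (M : R) : measurable_fun setT f -> (forall x, `|f x| <= M) ->
  (forall x, ~ box p r x -> f x = 0) -> ig2 f.
Proof.
move=> mf fM f0; have := igZ M (ig_indic (measurable_box p r) (leb2_box p r)).
apply: ig_le => // x; rewrite indicE; have [bx|nb] := pselect (box p r x).
  by rewrite mem_set// mulr1.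
by rewrite f0// normr0 memNset// mulr0.
Qed.

Lemma continuous_box_bounded f p r : continuous f -> (forall x, ~ box p r x -> f x = 0) ->
  exists2 M : R, 0 < M & forall x, `|f x| <= M.
Proof.
move=> cf f0.
have /compact_bounded : compact [set f x | x in box p r].
  by apply: continuous_compact; [exact: continuous_subspaceT | exact: compact_box].
case/pinfty_ex_gt0 => M M0 H; exists M => // x.
have [bx|/f0 ->] := pselect (box p r x); last by rewrite normr0 ltW.
by apply: H; exists x.
Qed.

Lemma ig_continuous_box f p r : continuous f -> (forall x, ~ box p r x -> f x = 0) -> ig2 f.
Proof.
move=> cf f0; have [M M0 fM] := continuous_box_bounded cf f0.
exact: (ig_bounded_box (continuous_measurable2 cf) fM f0).
Qed.

Lemma FTC_line (F f : R -> R) (a b : R) : a < b -> (forall t : R, is_derive t 1 F (f t)) ->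
  continuous f -> (forall t : R, t \notin `[a, b] -> f t = 0) ->
  (\int[lebesgue_measure]_t (f t)%:E)%E = (F b - F a)%:E.
Proof.
move=> ab dF cf f0.
have cF : continuous F.
  move=> t; apply: differentiable_continuous; apply/derivable1_diffP.
  exact: is_derive_derivable (dF t).
have := @continuous_FTC2 R f F a b ab.
rewrite EFinB => <- //.
- rewrite [RHS]integral_mkcond; apply: eq_integral => t _; rewrite patchE.
  by case: ifPn => // /negP nab; rewrite f0//; apply/negP => h; apply: nab; exact/mem_set.
- exact: continuous_subspaceT.
- split.
  + by move=> t _; exact: is_derive_derivable (dF t).
  + by apply: cvg_at_right_filter; exact: cF.
  + by apply: cvg_at_left_filter; exact: cF.
- by move=> t _; rewrite derive1E; exact: is_deriveE.
Qed.

Lemma is_derive_slice0 f x a : is_derive x (basis R 0) f a ->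
  is_derive x.1 1 (fun t => f (t, x.2)) a.
Proof.
move=> h; have := @is_derive_line R f (0, x.2) 0 x.1 a.
have E : (fun s : R => f (s *: basis R 0 + (0, x.2))) = (fun t => f (t, x.2)).
  by apply/funext => s; congr f; apply/pair_equal_spec; split=> /=;
      rewrite /GRing.scale/= ?mulr1 ?mulr0 ?addr0 ?add0r.
rewrite E; apply; rewrite (_ : _ + _ = x)//; case: x {h E} => x1 x2.
by apply/pair_equal_spec; split=> /=; rewrite /GRing.scale/= ?mulr1 ?mulr0 ?addr0 ?add0r.
Qed.

Lemma is_derive_slice1 f x a : is_derive x (basis R 1) f a ->
  is_derive x.2 1 (fun t => f (x.1, t)) a.
Proof.
move=> h; have := @is_derive_line R f (x.1, 0) 1 x.2 a.
have E : (fun s : R => f (s *: basis R 1 + (x.1, 0))) = (fun t => f (x.1, t)).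
  by apply/funext => s; congr f; apply/pair_equal_spec; split=> /=;
      rewrite /GRing.scale/= ?mulr1 ?mulr0 ?addr0 ?add0r.
rewrite E; apply; rewrite (_ : _ + _ = x)//; case: x {h E} => x1 x2.
by apply/pair_equal_spec; split=> /=; rewrite /GRing.scale/= ?mulr1 ?mulr0 ?addr0 ?add0r.
Qed.

Lemma continuous_slice0 f (s : R) : continuous f -> continuous (fun t : R => f (t, s)).
Proof.
move=> cf t; apply: (@continuous_comp _ _ _ (fun t : R => (t, s)) f); last exact: cf.
move=> A /nbhs_boxP[r r0 rA]; apply: filterS (nbhsx_ballx t r r0) => u.
rewrite -ball_normE /= => /ltW h; apply: rA; split => /=; first by rewrite distrC.
by rewrite subrr normr0 ltW.
Qed.

Lemma continuous_slice1 f (s : R) : continuous f -> continuous (fun t : R => f (s, t)).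
Proof.
move=> cf t; apply: (@continuous_comp _ _ _ (fun t : R => (s, t)) f); last exact: cf.
move=> A /nbhs_boxP[r r0 rA]; apply: filterS (nbhsx_ballx t r r0) => u.
rewrite -ball_normE /= => /ltW h; apply: rA; split => /=; last by rewrite distrC.
by rewrite subrr normr0 ltW.
Qed.

Lemma derive_out_box f f' i M : (forall x, is_derive x (basis R i) f (f' x)) ->
  (forall x, ~ box 0 M x -> f x = 0) -> continuous f' -> forall x, ~ box 0 M x -> f' x = 0.
Proof.
move=> df f0 cf' x nb; rewrite -(is_deriveE (df x)).
apply: is_deriveE; apply: (@near_eq_is_derive _ _ _ (fun _ : plane => 0 : R)).
  have oC : open (~` box (0 : plane) M).
    apply: closed_openC; apply: compact_closed; [exact: norm_hausdorff|exact: compact_box].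
  near=> y; rewrite f0//; near: y.
  by apply: open_nbhs_nbhs; split.
Unshelve. all: by end_near. Qed.

(** By Fubini, integrating first along the lines parallel to the [i]-th axis, where the fundamental
    theorem gives 0. *)
Lemma ii_derive_eq0 f f' i M : (forall x, is_derive x (basis R i) f (f' x)) -> continuous f' ->
  (forall x, ~ box 0 M x -> f x = 0) -> ii2 f' = 0.
Proof.
move=> df cf' f0; have f'0 := derive_out_box df f0 cf'.
have Ig : ig2 f' by exact: ig_continuous_box f'0.
(* Strictly larger than [M], so that both end points of the interval lie outside the box, where [f]
   vanishes. *)
pose N : R := `|M| + 1.
have NM : M < N by rewrite /N; have := ler_norm M; lra.
have N0 : - N < N by rewrite /N; have := normr_ge0 M; lra.
have outN (t : R) : t \notin `[- N, N] -> M < `|t|.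
  by move=> h; rewrite ltNge; apply: contra h; rewrite in_itv /= ler_norml => /andP[? ?];
      apply/andP; split; lra.
have nN : M < `|- N| by apply: lt_le_trans NM _; rewrite normrN ler_norm.
have nN' : M < `|N| by apply: lt_le_trans NM _; rewrite ler_norm.
apply: EFin_inj; rewrite iiE//.
case: (ord2P i) => ei; subst i.
  rewrite -[LHS](integral21_prod_meas1 Ig); apply: integral0_eq => s _.
  have out t : t \notin `[- N, N] -> f' (t, s) = 0.
    by move=> /outN h; apply: f'0 => -[/=]; rewrite subr0 leNgt h.
  apply: (etrans (@FTC_line (fun t => f (t, s)) (fun t => f' (t, s)) (- N) N N0
    (fun t => @is_derive_slice0 f (t, s) _ (df (t, s))) (continuous_slice0 cf') out)).
  by rewrite !f0 ?subrr//= => -[/= ]; rewrite subr0 leNgt ?nN ?nN'.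
rewrite -[LHS](integral12_prod_meas1 Ig); apply: integral0_eq => s _.
have out t : t \notin `[- N, N] -> f' (s, t) = 0.
  by move=> /outN h; apply: f'0 => -[/=] _; rewrite subr0 leNgt h.
apply: (etrans (@FTC_line (fun t => f (s, t)) (fun t => f' (s, t)) (- N) N N0
  (fun t => @is_derive_slice1 f (s, t) _ (df (s, t))) (continuous_slice1 cf') out)).
by rewrite !f0 ?subrr//= => -[/= _]; rewrite subr0 leNgt ?nN ?nN'.
Qed.

Lemma compact_in_box (K : set plane) : compact K -> exists2 M : R, 0 < M & K `<=` box 0 M.
Proof.
move=> /compact_bounded /pinfty_ex_gt0[M M0 H]; exists M => // x Kx.
have /= := H x Kx; rewrite prod_normE ge_max => /andP[h1 h2].
by split; rewrite /= subr0.
Qed.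

Lemma bounded_in_box (K : set plane) : bounded_set K -> exists2 M : R, 0 < M & K `<=` box 0 M.
Proof.
move=> /pinfty_ex_gt0[M M0 H]; exists M => // x Kx.
have /= := H x Kx; rewrite prod_normE ge_max => /andP[h1 h2].
by split; rewrite /= subr0.
Qed.

Lemma test_out_box U f : test_fun U f -> exists2 M : R, 0 < M & forall x, ~ box 0 M x -> f x = 0.
Proof.
move=> [_ [K [cK _ K0]]]; have [M M0 KM] := compact_in_box cK.
by exists M => // x nb; apply: K0 => /KM.
Qed.

(** The measurable structure of the plane is generated by rectangles with measurable sides, and both
    projections are measurable for the sigma-algebra generated by open sets. This allows a
    lambda-system argument starting from open sets. *)
Lemma plane_sigma_open (E : set plane) : measurable E -> <<s [set U : set plane | open U] >> E.
Proof.
pose S := g_sigma_algebraType [set U : set plane | open U].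
have mfst : measurable_fun setT (fst : S -> R).
  apply: (measurability _ (RGenOpens.measurableE R)) => _ [_ [a [b ->] <-]].
  rewrite setTI; apply: sub_sigma_algebra => /=; apply: open_comp; last exact: interval_open.
  by move=> x _; exact: cvg_fst.
have msnd : measurable_fun setT (snd : S -> R).
  apply: (measurability _ (RGenOpens.measurableE R)) => _ [_ [a [b ->] <-]].
  rewrite setTI; apply: sub_sigma_algebra => /=; apply: open_comp; last exact: interval_open.
  by move=> x _; exact: cvg_snd.
rewrite measurable_prod_measurableType; apply: smallest_sub => /=.
  exact: smallest_sigma_algebra.
move=> _ [A mA [B mB <-]].
have -> : A `*` B = ((setT `&` fst @^-1` A) `&` (setT `&` snd @^-1` B) : set S).
  by rewrite !setTI; apply/seteqP; split=> x.
by apply: (@measurableI _ S); [exact: mfst | exact: msnd].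
Qed.

Lemma indic_in (A : set plane) x : A x -> \1_A x = 1 :> R.
Proof. by move=> Ax; rewrite indicE mem_set. Qed.

Lemma indic_notin (A : set plane) x : ~ A x -> \1_A x = 0 :> R.
Proof. by move=> Ax; rewrite indicE memNset. Qed.

Section Density.
Variables (U : set plane) (M0 : R).
Hypotheses (oU : open U) (UM : U `<=` box 0 M0).

Definition sq f g x : R := (f x - g x) ^+ 2.

(** Density is proved by showing that this class contains, in turn, indicators of open sets,
    indicators of measurable sets, simple functions and all of L^2. *)
Definition apx f := measurable_fun setT f /\ forall e : R, 0 < e ->
  exists2 phi, test_fun U phi & ig2 (sq f phi) /\ ii2 (sq f phi) < e.

Lemma test_meas phi : test_fun U phi -> measurable_fun setT phi.
Proof. by move=> [sp _]; apply: continuous_measurable2; exact: smooth_cont. Qed.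

Lemma measurable_sq f g : measurable_fun setT f -> measurable_fun setT g ->
  measurable_fun setT (sq f g).
Proof.
move=> mf mg; have mB := measurable_funB mf mg.
exact: (measurable_funX 2 mB).
Qed.

Lemma sq_tri f g h x : sq f h x <= 2 * sq f g x + 2 * sq g h x.
Proof. by rewrite /sq; have := sqr_ge0 (f x - g x - (g x - h x)); nra. Qed.

Lemma sq_ge0 f g x : 0 <= sq f g x.
Proof. exact: sqr_ge0. Qed.

Lemma apx_lim f : measurable_fun setT f -> (forall e : R, 0 < e ->
   exists2 g, apx g & ig2 (sq f g) /\ ii2 (sq f g) < e) -> apx f.
Proof.
move=> mf H; split=> // e e0.
(* A quarter each: the squared error of a two-step approximation is at most twice the sum of the
   squared errors. *)
have e4 : 0 < e / 4 by rewrite divr_gt0.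
have [g [mg ag] [Ig ge]] := H _ e4; have [phi tp [Ip pe]] := ag _ e4.
exists phi => //.
have I2 : ig2 (fun x => 2 * sq f g x + 2 * sq g phi x) by apply: igD; exact: igZ.
have I : ig2 (sq f phi).
  apply: ig_le I2; first exact: measurable_sq (test_meas tp).
  by move=> x; rewrite ger0_norm ?sq_ge0// sq_tri.
split=> //; apply: le_lt_trans (ii_le I I2 (sq_tri _ _ _)) _.
by rewrite iiD ?iiZ//; try exact: igZ; lra.
Qed.

Lemma test_funD f g : test_fun U f -> test_fun U g -> test_fun U (fun x => f x + g x).
Proof.
move=> [sf [K [cK KU K0]]] [sg [L [cL LU L0]]]; split; first exact: smoothD.
exists (K `|` L); split; first exact: compactU.
- by move=> x [/KU|/LU].
- by move=> x /not_orP[/K0 -> /L0 ->]; rewrite addr0.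
Qed.

Lemma test_funZ (k : R) f : test_fun U f -> test_fun U (fun x => k * f x).
Proof.
move=> [sf [K [cK KU K0]]]; split; first exact: smoothZ.
by exists K; split => // x /K0 ->; rewrite mulr0.
Qed.

Lemma test_fun0 : test_fun U (fun=> 0).
Proof. by split; [exact: smooth_cst | exists set0; split => //; exact: compact0]. Qed.

Lemma apx0 : apx (fun=> 0).
Proof.
split; first exact: measurable_cst.
move=> e e0; exists (fun=> 0); first exact: test_fun0.
have -> : sq (fun=> 0) (fun=> 0) = (fun=> 0) by apply/funext => x; rewrite /sq subrr expr0n.
by rewrite ii0; split => //; exact: ig0.
Qed.

Lemma apxZ (k : R) f : apx f -> apx (fun x => k * f x).
Proof.
move=> [mf af]; split; first exact: measurable_funM (measurable_cst _) mf.
move=> e e0; have k0 : 0 < k ^+ 2 + 1 by rewrite ltr_wpDl ?sqr_ge0.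
have [phi tp [Ip pe]] := af (e / (k ^+ 2 + 1)) (divr_gt0 e0 k0).
exists (fun x => k * phi x); first exact: test_funZ.
have -> : sq (fun x => k * f x) (fun x => k * phi x) = (fun x => k ^+ 2 * sq f phi x).
  by apply/funext => x; rewrite /sq -mulrBr exprMn.
split; first exact: igZ.
rewrite iiZ//; move: pe; rewrite ltr_pdivlMr// => pe.
have := ii_ge0 mu (sq_ge0 f phi); have := sqr_ge0 k; nra.
Qed.

Lemma apxD f g : apx f -> apx g -> apx (fun x => f x + g x).
Proof.
move=> [mf af] [mg ag]; split; first exact: measurable_funD.
move=> e e0; have e4 : 0 < e / 4 by rewrite divr_gt0.
have [p tp [Ip pe]] := af _ e4; have [q tq [Iq qe]] := ag _ e4.
exists (fun x => p x + q x); first exact: test_funD.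
have I2 : ig2 (fun x => 2 * sq f p x + 2 * sq g q x) by apply: igD; exact: igZ.
have le x : sq (fun x => f x + g x) (fun x => p x + q x) x <= 2 * sq f p x + 2 * sq g q x.
  by rewrite /sq; have := sqr_ge0 (f x - p x - (g x - q x)); nra.
have I : ig2 (sq (fun x => f x + g x) (fun x => p x + q x)).
  apply: ig_le I2; last by move=> x; rewrite ger0_norm ?sq_ge0// le.
  by apply: measurable_sq; [exact: measurable_funD | exact: test_meas (test_funD tp tq)].
split=> //; apply: le_lt_trans (ii_le I I2 le) _.
by rewrite iiD ?iiZ//; try exact: igZ; lra.
Qed.

Lemma apx_sum n (F : 'I_n -> plane -> R) : (forall i, apx (F i)) ->
  apx (fun x => \sum_(i < n) F i x).
Proof.
elim: n F => [|n IH] F aF.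
  rewrite (_ : (fun x => _) = (fun=> 0)); first exact: apx0.
  by apply/funext => x; rewrite big_ord0.
rewrite (_ : (fun x => _) = (fun x => \sum_(i < n) F (widen_ord (leqnSn n) i) x + F ord_max x)).
  by apply: apxD => //; exact: IH.
by apply/funext => x; rewrite big_ord_recr.
Qed.

Lemma apx_cvg (F : nat -> plane -> R) f g : (forall n, apx (F n)) -> measurable_fun setT f ->
  ig2 g -> (forall n x, sq f (F n) x <= g x) -> (forall x, F n x @[n --> \oo] --> f x) -> apx f.
Proof.
move=> aF mf Ig le cF; apply: apx_lim => // e e0.
have mF n : measurable_fun setT (sq f (F n)) by apply: measurable_sq => //; exact: (aF n).1.
have bF n x : `|sq f (F n) x| <= g x by rewrite ger0_norm ?sq_ge0.
have c0 x : sq f (F n) x @[n --> \oo] --> (0 : R).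
  have d0 : f x - F n x @[n --> \oo] --> f x - f x by apply: cvgB; [exact: cvg_cst | exact: cF].
  have -> : (fun n => sq f (F n) x) = (fun n => (f x - F n x) * (f x - F n x)).
    by apply/funext => n; rewrite /sq expr2.
  by rewrite -(mulr0 (0 : R)) -(subrr (f x)); apply: cvgM.
have [_] := @ii_cvg _ _ R mu _ _ _ mF Ig bF c0; rewrite ii0.
move=> /cvgrPdist_lt /(_ e e0)[n _ /(_ n (leqnn n))].
rewrite sub0r normrN ger0_norm ?ii_ge0//; last by move=> x; exact: sq_ge0.
move=> ne; exists (F n) => //; split => //.
exact: (@ig_le _ _ R mu _ _ (mF n) (bF n) Ig).
Qed.

Lemma ig_indic_sub (A : set plane) : measurable A -> A `<=` U -> ig2 (\1_A).
Proof.
move=> mA AU; apply: (@ig_bounded_box _ 0 M0 1).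
- exact/measurable_indicP.
- by move=> x; rewrite indicE ger0_norm ?ler0n// lern1 leq_b1.
- by move=> x nb; rewrite indicE memNset// => /AU /UM.
Qed.

Lemma apx_open W : open W -> apx (\1_(W `&` U)).
Proof.
move=> oW; have oV : open (W `&` U) by exact: openI.
have mV := open_measurable2 oV.
apply: (@apx_cvg (approx1 (W `&` U)) _ (\1_(W `&` U))).
- move=> n; have tn : test_fun U (approx1 (W `&` U) n).
    have [s [K [cK KU K0]]] := approx1_test (W `&` U) n; split => //.
    by exists K; split => // x /KU[].
  split; first exact: test_meas tn.
  move=> e e0; exists (approx1 (W `&` U) n) => //.
  have -> : sq (approx1 (W `&` U) n) (approx1 (W `&` U) n) = (fun=> 0).
    by apply/funext => x; rewrite /sq subrr expr0n.
  by rewrite ii0; split => //; exact: ig0.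
- exact/measurable_indicP.
- by apply: ig_indic_sub => // x [].
- move=> n x; have /andP[h1 h2] := approx1_01 (W `&` U) n x.
  have [Wx|nW] := pselect ((W `&` U) x).
    by rewrite /sq (indic_in Wx); nra.
  by rewrite /sq (indic_notin nW) (test_fun_out (approx1_test _ n) nW) subrr expr0n.
- by move=> x; exact: approx1_cvg.
Qed.

(** Dynkin's lemma: the sets in question form a lambda-system, and the open sets are stable under
    intersection and generate the measurable ones. *)
Lemma apx_measurable (E : set plane) : measurable E -> apx (\1_(E `&` U)).
Proof.
have mU := open_measurable2 oU.
pose H := [set E : set plane | measurable E /\ apx (\1_(E `&` U))].
suff sub : <<s [set W : set plane | open W] >> `<=` H by move=> /plane_sigma_open /sub[].
apply: lambda_system_subset => //.
- by move=> A B oA oB; exact: openI.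
- split => //.
  + by split => //; apply: apx_open; exact: openT.
  + move=> A B BA [mA aA] [mB aB]; split; first exact: measurableD.
    have -> : \1_((A `\` B) `&` U) = (fun x => \1_(A `&` U) x + - 1 * \1_(B `&` U) x) :>
        (plane -> R).
      apply/funext => x; have [Ux|nU] := pselect (U x); last first.
        by rewrite !indic_notin ?mulr0 ?addr0// => -[].
      have [Bx|nB] := pselect (B x).
        rewrite (indic_notin (_ : ~ ((A `\` B) `&` U) x)); last by case=> -[].
        by rewrite !indic_in ?mulN1r ?subrr//; split => //; exact: BA.
      rewrite [X in _ * X]indic_notin; last by case.
      rewrite mulr0 addr0; have [Ax|nA] := pselect (A x); first by rewrite !indic_in.
      by rewrite !indic_notin => // -[] // -[].
    by apply: apxD => //; exact: apxZ.
  + move=> F ndF HF; have mF : measurable (\bigcup_i F i).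
      by apply: bigcup_measurable => i _; exact: (HF i).1.
    split=> //; apply: (@apx_cvg (fun n => \1_(F n `&` U)) _ (\1_U)).
    * by move=> n; exact: (HF n).2.
    * by apply/measurable_indicP; exact: measurableI.
    * exact: ig_indic_sub.
    * move=> n x; rewrite /sq !indicE !in_setI.
      by case: (x \in U); case: (x \in \bigcup_i F i); case: (x \in F n) => /=;
          rewrite ?subrr ?subr0 ?sub0r ?sqrrN ?expr1n ?expr0n ?ler01.
    * move=> x; have [[i _ Fx]|nF] := pselect ((\bigcup_i F i) x).
        apply: (@cvg_trans _ ((fun _ : nat => \1_(\bigcup_i F i `&` U) x : R) @ \oo));
            last exact: cvg_cst.
        apply: near_eq_cvg; near=> n; rewrite !indicE !in_setI.
        rewrite (mem_set (_ : (\bigcup_i F i) x)); last by exists i.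
        rewrite (mem_set (_ : F n x))//.
        have /ndF : (i <= n)%N by near: n; exact: nbhs_infty_ge.
        by move=> /subsetPset; exact.
      have -> : (fun n => \1_(F n `&` U) x) = (fun _ : nat => \1_(\bigcup_i F i `&` U) x) :>
          (nat -> R).
        apply/funext => n; rewrite !indicE !in_setI (memNset nF) memNset//.
        by move=> Fx; apply: nF; exists n.
      exact: cvg_cst.
- by move=> W oW; split; [exact: open_measurable2 | exact: apx_open].
Unshelve. all: by end_near. Qed.

Lemma apx_nonneg f : measurable_fun setT f -> (forall x, 0 <= f x) -> ig2 (fun x => f x ^+ 2) ->
  (forall x, ~ U x -> f x = 0) -> apx f.
Proof.
move=> mf f0 If fU.
have mf' : measurable_fun setT (EFin \o f) by exact/measurable_EFinP.
pose S := nnsfun_approx measurableT mf'.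
pose s (n : nat) : plane -> R := S n.
have s_cvg x : s n x @[n --> \oo] --> f x.
  have := @cvg_nnsfun_approx _ _ _ _ measurableT _ mf' (fun x _ => f0 x) x I.
  by move=> /fine_cvgP[].
have s_le n x : s n x <= f x.
  rewrite -(cvg_lim _ (s_cvg x))//.
  apply: (@nondecreasing_cvgn_le _ (fun n => s n x)); last first.
    by apply/cvg_ex; exists (f x); exact: s_cvg.
  by move=> a b ab; have /lefP := nd_nnsfun_approx measurableT mf' ab; exact.
have s0 n x : 0 <= s n x by exact: fun_ge0.
apply: (@apx_cvg s _ (fun x => f x ^+ 2)) => //; last first.
  move=> n x; rewrite /sq; have := s_le n x; have := s0 n x.
  by move: (s n x) (f x) => a b; nra.
move=> n.
(* The simple function is the sum of its values times indicators of level sets. Cutting these with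
   [U] changes nothing, since off [U] it lies between 0 and [f] = 0. *)
have E x : s n x = \sum_(i < size (finmap.enum_fset (fset_set (range (S n)))))
   (finmap.enum_fset (fset_set (range (S n))))`_i *
   \1_(S n @^-1` [set (finmap.enum_fset (fset_set (range (S n))))`_i] `&` U) x.
  have [Ux|nU] := pselect (U x).
    rewrite /s fimfunEord; apply: eq_bigr => i _; congr (_ * _).
    by rewrite !indicE in_setI (mem_set Ux) andbT.
  rewrite big1; last by move=> i _; rewrite indicE in_setI (memNset nU) andbF mulr0.
  by apply/eqP; rewrite eq_le s0 andbT; rewrite -[leRHS](fU _ nU) s_le.
rewrite (funext E).
apply: apx_sum => i; apply: apxZ; apply: apx_measurable.
by rewrite -[X in measurable X]setTI; exact: measurable_funP.
Qed.

Lemma apx_L2 f : measurable_fun setT f -> ig2 (fun x => f x ^+ 2) ->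
  (forall x, ~ U x -> f x = 0) -> apx f.
Proof.
move=> mf If fU.
pose p x : R := Num.max (f x) 0; pose q x : R := Num.max (- f x) 0.
have -> : f = (fun x => p x + - 1 * q x).
  apply/funext => x; rewrite /p /q mulN1r; case: (leP (f x) 0); case: (leP (- f x) 0) => *; lra.
have P (g : plane -> R) : measurable_fun setT g -> (forall x, g x ^+ 2 = f x ^+ 2) ->
    (forall x, ~ U x -> g x = 0) -> apx (fun x => Num.max (g x) 0).
  move=> mg gf gU; have mp : measurable_fun setT (fun x => Num.max (g x) 0).
    by apply: measurable_maxr => //; exact: measurable_cst.
  apply: apx_nonneg => //.
  - by move=> x; rewrite le_max lexx orbT.
  - apply: ig_le If; first exact: (measurable_funX 2 mp).
    move=> x; rewrite ger0_norm ?sqr_ge0// -gf; have [h|_] := leP 0 (g x); first by [].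
    by rewrite expr0n sqr_ge0.
  - by move=> x /gU ->; rewrite maxxx.
apply: apxD; first exact: P.
apply: apxZ; apply: P.
- exact: measurable_funN.
- by move=> x; rewrite sqrrN.
- by move=> x /fU ->; rewrite oppr0.
Qed.

Lemma test_dense f (e : R) : measurable_fun setT f -> ig2 (fun x => f x ^+ 2) ->
  (forall x, ~ U x -> f x = 0) -> 0 < e ->
  exists2 phi, test_fun U phi &
    ig2 (fun x => (f x - phi x) ^+ 2) /\ ii2 (fun x => (f x - phi x) ^+ 2) < e.
Proof. by move=> mf If fU e0; have [_] := apx_L2 mf If fU; exact. Qed.

End Density.

End PlaneIntegrals.

(** * Mollification *)

Section MeanValue.
Variable R : realType.
Local Notation plane := (R * R)%type.
Implicit Types (f g : plane -> R) (x y p : plane).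

Lemma mvt_line (f f' : R -> R) (a b : R) : (forall t : R, is_derive t 1 f (f' t)) ->
  exists c, `|c - a| <= `|b - a| /\ f b - f a = f' c * (b - a).
Proof.
move=> df.
have cf : continuous f.
  move=> t; apply: differentiable_continuous; apply/derivable1_diffP.
  exact: is_derive_derivable (df t).
have [ab|ba|->] := ltgtP a b.
- have [|c] := @MVT R f f' a b ab (fun t _ => df t); first exact: continuous_subspaceT.
  rewrite in_itv /= => /andP[ac cb] E; exists c; split=> //.
  by rewrite !ger0_norm; lra.
- have [|c] := @MVT R f f' b a ba (fun t _ => df t); first exact: continuous_subspaceT.
  rewrite in_itv /= => /andP[ac cb] E; exists c; split.
    by rewrite !ler0_norm; lra.
  by rewrite -(opprB a b) mulrN -E opprB.
- by exists b; rewrite !subrr normr0 mulr0.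
Qed.

(** The path runs along two sides of a rectangle, so that only partial derivatives occur. *)
Lemma mvt_plane f f0 f1 x y : (forall z, is_derive z (basis R 0) f (f0 z)) ->
  (forall z, is_derive z (basis R 1) f (f1 z)) ->
  exists c d, [/\ `|c - x.1| <= `|y.1 - x.1|, `|d - x.2| <= `|y.2 - x.2| &
   f y - f x = f0 (c, y.2) * (y.1 - x.1) + f1 (x.1, d) * (y.2 - x.2)].
Proof.
move=> df0 df1.
have [c [hc Ec]] := @mvt_line (fun t => f (t, y.2)) (fun t => f0 (t, y.2)) x.1 y.1
  (fun t => @is_derive_slice0 R f (t, y.2) _ (df0 (t, y.2))).
have [d [hd Ed]] := @mvt_line (fun t => f (x.1, t)) (fun t => f1 (x.1, t)) x.2 y.2
  (fun t => @is_derive_slice1 R f (x.1, t) _ (df1 (x.1, t))).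
exists c, d; split => //; rewrite -Ec -Ed.
by case: x y {hc Ec hd Ed} => [x1 x2] [y1 y2] /=; rewrite addrA subrK.
Qed.

Lemma lipschitz_plane f (M : R) : smooth f -> (forall i z, `|pd i f z| <= M) ->
  forall x y, `|f y - f x| <= M * (`|y.1 - x.1| + `|y.2 - x.2|).
Proof.
move=> sf fM x y.
have [c [d [_ _ ->]]] := @mvt_plane f _ _ x y (fun z => smooth_is_derive sf z 0)
    (fun z => smooth_is_derive sf z 1).
by apply: le_trans (ler_normD _ _) _; rewrite !normrM mulrDr lerD// ler_wpM2r.
Qed.

End MeanValue.

Section Convolution.
Variable R : realType.
Local Notation plane := (R * R)%type.
Local Notation mu := (@leb2 R).
Local Notation ig2 := (ig (@leb2 R)).
Local Notation ii2 := (ii (@leb2 R)).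
Implicit Types (f g h k v w : plane -> R) (x y p : plane).

(** These serve both as mollifying kernels and as test functions on the whole plane, against which
    zero extensions are differentiated. *)
Definition kern k := smooth k /\ exists2 M : R, 0 < M & forall x, ~ box 0 M x -> k x = 0.

Lemma kern_pd k i : kern k -> kern (pd i k).
Proof.
move=> [sk [M M0 k0]]; split; first exact: smooth_pd.
exists M => //; apply: (derive_out_box (smooth_is_derive sk ^~ i) k0).
exact: smooth_cont (smooth_pd i sk).
Qed.

Lemma kern_bounded k : kern k -> exists2 M : R, 0 < M & forall x, `|k x| <= M.
Proof. by move=> [sk [M _ k0]]; exact: continuous_box_bounded (smooth_cont sk) k0. Qed.

Lemma is_derive_refl k x y i a : is_derive (x - y) (basis R i) k a ->
  is_derive y (basis R i) (fun z => k (x - z)) (- a).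
Proof.
move=> dk; apply: is_derive_line0.
have -> : (fun s : R => k (x - (s *: basis R i + y))) =
          (fun s : R => (fun t : R => k (t *: basis R i + (x - y))) (-1 * s + 0)).
  by apply/funext => s; rewrite addr0 mulN1r scaleNr opprD addrCA.
rewrite -(mulN1r a); apply: (@is_derive_comp_affine R (fun t => k (t *: basis R i + (x - y)))).
by rewrite mulr0 addr0; apply: is_derive_line; rewrite scale0r add0r.
Qed.

Lemma smooth_refl k x : smooth k -> smooth (fun y => k (x - y)).
Proof.
move=> sk; apply/smoothP => n; elim: n k sk => [|n IH] k sk.
  split=> // y; apply: (@continuous_comp _ _ _ (fun y => x - y) k); last exact: smooth_cont.
  by apply: cvgB; [exact: cvg_cst | exact: cvg_id].
split=> [y|i].
  apply: (@continuous_comp _ _ _ (fun y => x - y) k); last exact: smooth_cont.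
  by apply: cvgB; [exact: cvg_cst | exact: cvg_id].
exists (fun y => - pd i k (x - y)).
  by move=> y; apply: is_derive_refl; exact: smooth_is_derive.
apply: (IH (fun y => - pd i k y)); apply: smoothN; exact: smooth_pd.
Qed.

Lemma pd_refl k x i : smooth k -> pd i (fun y => k (x - y)) = (fun y => - pd i k (x - y)).
Proof.
move=> sk; apply/funext => y; apply: is_deriveE; apply: is_derive_refl.
exact: smooth_is_derive.
Qed.

Lemma pds_refl k x s : smooth k ->
  pds s (fun y => k (x - y)) = (fun y => (-1) ^+ size s * pds s k (x - y)).
Proof.
move=> sk; elim: s => [|i s IH] /=.
  by apply/funext => y; rewrite expr0 mul1r.
rewrite IH pdZ; last by apply: smooth_refl; exact: smooth_pds.
rewrite pd_refl; last exact: smooth_pds.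
by apply/funext => y; rewrite exprS mulN1r mulNr mulrN.
Qed.

Definition conv k v x : R := ii2 (fun y => v y * k (x - y)).

Lemma ig_conv k v x : kern k -> ig2 v -> ig2 (fun y => v y * k (x - y)).
Proof.
move=> kk Iv; have [M M0 kM] := kern_bounded kk.
apply: (ig_mulb (M := M)) => //; apply: continuous_measurable2.
by apply: smooth_cont; apply: smooth_refl; case: kk.
Qed.

(** Differentiation under the integral sign along a line through [x], dominated by |v| times a bound
    on the derivative of the kernel. *)
Lemma is_derive_conv k v x i : kern k -> ig2 v ->
  is_derive x (basis R i) (conv k v) (conv (pd i k) v x).
Proof.
move=> kk Iv; have [M M0 kM] := kern_bounded (kern_pd i kk); have sk := kk.1.
apply: is_derive_line0.
pose F (s : R) (y : plane) := v y * k (s *: basis R i + x - y).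
have dF (s : R) y : is_derive s 1 (F ^~ y) (v y * pd i k (s *: basis R i + x - y)).
  apply: is_derive_scale.
  have -> : (fun s : R => k (s *: basis R i + x - y)) = (fun s : R => k (s *: basis R i + (x - y))).
    by apply/funext => t; rewrite addrA.
  by apply: is_derive_line; rewrite addrA; exact: smooth_is_derive.
have I0 : `](-1 : R), 1[%classic 0 by rewrite /= in_itv /= ltrN10 ltr01.
have IF s : `](-1 : R), 1[%classic s -> mu.-integrable setT (EFin \o F s).
  by move=> _; exact: ig_conv.
have DF s y : `](-1 : R), 1[%classic s -> (setT : set plane) y -> derivable (F ^~ y) s 1.
  by move=> _ _; exact: is_derive_derivable (dF s y).
have GF s y : `](-1 : R), 1[%classic s -> (setT : set plane) y ->
    `|partial1of2 F s y| <= M * `|v y|.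
  move=> _ _; rewrite partial1of2E (is_deriveE (dF s y)) normrM mulrC.
  by rewrite ler_wpM2r.
have G0 y : 0 <= M * `|v y| by rewrite mulr_ge0// ltW.
have IG : mu.-integrable setT (EFin \o (fun y => M * `|v y|)) by exact: igZ (ig_abs Iv).
have D := derivable_under_integral measurableT I0 IF DF G0 IG GF.
have E := differentiation_under_integral measurableT I0 IF DF G0 IG GF.
have -> : conv (pd i k) v x = \int[mu]_y partial1of2 F 0 y.
  apply: eq_Rintegral => y _; rewrite partial1of2E (is_deriveE (dF 0 y)).
  by rewrite scale0r add0r.
by rewrite -E derive1E; apply: DeriveDef.
Qed.

(** The convolution is even Lipschitz: its constant is that of the kernel times the L^1 norm of
    [v]. *)
Lemma continuous_conv k v : kern k -> ig2 v -> continuous (conv k v).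
Proof.
move=> kk Iv x; have sk := kk.1.
have [M0 M00 h0] := kern_bounded (kern_pd 0 kk); have [M1 M10 h1] := kern_bounded (kern_pd 1 kk).
pose M := M0 + M1; pose C := ii2 (fun y => `|v y|).
have C0 : 0 <= C by apply: ii_ge0.
have kL := @lipschitz_plane R k M sk.
have {}kL y z : `|k z - k y| <= M * (`|z.1 - y.1| + `|z.2 - y.2|).
  apply: kL => i u; case: (ord2P i) => ->.
    by apply: le_trans (h0 u) _; rewrite /M lerDl ltW.
  by apply: le_trans (h1 u) _; rewrite /M lerDr ltW.
have H y : `|conv k v y - conv k v x| <= C * (M * (`|y.1 - x.1| + `|y.2 - x.2|)).
  rewrite /conv -iiB; try exact: ig_conv.
  have I1 : ig2 (fun z => v z * k (y - z) - v z * k (x - z)) by apply: igB; exact: ig_conv.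
  apply: le_trans (ii_abs I1) _.
  rewrite mulrC -iiZ; last exact: ig_abs.
  apply: ii_le; [exact: ig_abs | exact: igZ (ig_abs Iv) | move=> z].
  rewrite -mulrBr normrM mulrC ler_wpM2r//.
  apply: le_trans (kL _ _) _ => /=.
  by rewrite !opprB !addrA !(addrAC _ (- _) z.1) !(addrAC _ (- _) z.2) !addrK.
apply/cvgrPdist_le => e e0.
have d0 : 0 < e / (C * M + 1) / 2.
  by rewrite !divr_gt0// ltr_wpDl// mulr_ge0// /M addr_ge0// ltW.
near=> y; rewrite distrC; apply: le_trans (H y) _.
have [b1 b2] : box x (e / (C * M + 1) / 2) y by near: y; exact: nbhs_box.
have CM : 0 <= C * M by rewrite mulr_ge0// /M addr_ge0// ltW.
rewrite mulrA; have s : `|y.1 - x.1| + `|y.2 - x.2| <= e / (C * M + 1) by lra.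
apply: le_trans (ler_wpM2l CM s) _.
rewrite mulrA ler_pdivrMr ?ltr_wpDl//; nra.
Unshelve. all: by end_near. Qed.

Lemma smooth_conv k v : kern k -> ig2 v -> smooth (conv k v).
Proof.
move=> kk Iv; apply/smoothP => n; elim: n k kk => [|n IH] k kk.
  by split=> //; exact: continuous_conv.
split=> [|i]; first exact: continuous_conv.
exists (conv (pd i k) v); first by move=> x; exact: is_derive_conv.
by apply: IH; exact: kern_pd.
Qed.

Lemma pds_conv k v s : kern k -> ig2 v -> pds s (conv k v) = conv (pds s k) v.
Proof.
move=> kk Iv; have kks t : kern (pds t k) by elim: t => [//|i t]; exact: kern_pd.
elim: s => [//|i s IH] /=; rewrite IH; apply/funext => x; apply: is_deriveE.
exact: is_derive_conv.
Qed.

Lemma conv_eq0 k v x : (forall y, v y != 0 -> k (x - y) = 0) -> conv k v x = 0.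
Proof.
move=> H; rewrite /conv -[RHS](@ii0 _ _ R mu); congr ii; apply/funext => y.
by have [->|/H ->] := eqVneq (v y) 0; rewrite ?mul0r ?mulr0.
Qed.

End Convolution.

Section Mollifier.
Variable R : realType.
Local Notation plane := (R * R)%type.
Local Notation mu := (@leb2 R).
Local Notation ig2 := (ig (@leb2 R)).
Local Notation ii2 := (ii (@leb2 R)).
Implicit Types (f g h k v w : plane -> R) (x y p c : plane).

Definition mol1 (c t s : R) : R := t^-1 * dstep (t^-1 * s + - c).

(** The support lies in t (c + [0,1]^2), so that convolution displaces supports by t (c + [0,1]^2).
    With [c] pointing inwards this moves the support of a function on omega away from the
    boundary. *)
Definition mol (c : plane) (t : R) x : R := mol1 c.1 t x.1 * mol1 c.2 t x.2.

Lemma smooth1_mol1 (c t : R) : smooth1 (mol1 c t).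
Proof. by move=> n; apply: Cn1M; [exact: Cn1_cst | apply: Cn1_affine; exact: smooth1_dstep]. Qed.

Lemma mol1_ge0 (c t s : R) : 0 < t -> 0 <= mol1 c t s.
Proof. by move=> t0; rewrite mulr_ge0 ?dstep_ge0// invr_ge0 ltW. Qed.

Lemma mol1_out (c t s : R) : 0 < t -> ~ (t * c <= s <= t * (c + 1)) -> mol1 c t s = 0.
Proof.
move=> t0 h; have E : t^-1 * s = s / t by rewrite mulrC.
rewrite /mol1; have [h1|h1] := leP (t * c) s; last first.
  rewrite dstep_le0 ?mulr0// E subr_le0 ler_pdivrMr// mulrC; exact: ltW.
have [h2|h2] := leP s (t * (c + 1)); first by case: h; rewrite h1.
rewrite dstep_ge1 ?mulr0// E lerBrDr addrC ler_pdivlMr// mulrC; exact: ltW.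
Qed.

Lemma mol1_FTC (c t u : R) : 0 < t -> (\int[lebesgue_measure]_s (mol1 c t (u - s))%:E = 1)%E.
Proof.
move=> t0; pose F (s : R) := - step (- t^-1 * s + (t^-1 * u - c)).
have dF (s : R) : is_derive s 1 F (mol1 c t (u - s)).
  have := is_deriveN (is_derive_comp_affine (is_derive_step (- t^-1 * s + (t^-1 * u - c)))).
  move=> H; apply: (is_derive_eq H); rewrite mulNr opprK /mol1; congr (_ * dstep _).
  by rewrite mulNr mulrBr; ring.
have cf : continuous (fun s => mol1 c t (u - s)).
  move=> s; apply: (@continuous_comp _ _ _ (fun s => u - s) (mol1 c t)).
    by apply: cvgB; [exact: cvg_cst | exact: cvg_id].
  exact: (smooth1_cont (smooth1_mol1 c t)).
have ab : u - t * (c + 1) < u - t * c by rewrite ltrD2l ltrN2 ltr_pM2l// ltrDl.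
have out s : s \notin `[u - t * (c + 1), u - t * c] -> mol1 c t (u - s) = 0.
  move=> h; apply: mol1_out => // /andP[h1 h2]; move/negP: h; apply.
  by rewrite in_itv /=; apply/andP; split; lra.
rewrite (FTC_line ab dF cf out) /F; congr EFin.
have t0' : t != 0 by rewrite gt_eqF.
have -> : - t^-1 * (u - t * c) + (t^-1 * u - c) = 0 by field.
have -> : - t^-1 * (u - t * (c + 1)) + (t^-1 * u - c) = 1 by field.
by rewrite step0// step1// oppr0 sub0r opprK.
Qed.

Lemma mol1_FTC' (c t u : R) : 0 < t -> (\int[lebesgue_measure]_s (mol1 c t (s - u))%:E = 1)%E.
Proof.
move=> t0; pose F (s : R) := step (t^-1 * s + (- t^-1 * u - c)).
have dF (s : R) : is_derive s 1 F (mol1 c t (s - u)).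
  have := is_derive_comp_affine (is_derive_step (t^-1 * s + (- t^-1 * u - c))).
  move=> H; apply: (is_derive_eq H); rewrite /mol1; congr (_ * dstep _).
  by ring.
have cf : continuous (fun s => mol1 c t (s - u)).
  move=> s; apply: (@continuous_comp _ _ _ (fun s => s - u) (mol1 c t)).
    by apply: cvgB; [exact: cvg_id | exact: cvg_cst].
  exact: (smooth1_cont (smooth1_mol1 c t)).
have ab : u + t * c < u + t * (c + 1) by rewrite ltrD2l ltr_pM2l// ltrDl.
have out s : s \notin `[u + t * c, u + t * (c + 1)] -> mol1 c t (s - u) = 0.
  move=> h; apply: mol1_out => // /andP[h1 h2]; move/negP: h; apply.
  by rewrite in_itv /=; apply/andP; split; lra.
rewrite (FTC_line ab dF cf out) /F; congr EFin.
have t0' : t != 0 by rewrite gt_eqF.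
have -> : t^-1 * (u + t * c) + (- t^-1 * u - c) = 0 by field.
have -> : t^-1 * (u + t * (c + 1)) + (- t^-1 * u - c) = 1 by field.
by rewrite (step0 (lexx 0)) (step1 (lexx 1)) subr0.
Qed.

Lemma mol_ge0 c (t : R) x : 0 < t -> 0 <= mol c t x.
Proof. by move=> t0; rewrite mulr_ge0 ?mol1_ge0. Qed.

Lemma mol_out c (t : R) x : 0 < t -> mol c t x != 0 ->
  (t * c.1 <= x.1 <= t * (c.1 + 1)) /\ (t * c.2 <= x.2 <= t * (c.2 + 1)).
Proof.
move=> t0 h; split; apply/negPn/negP => n; move/eqP: h; apply; rewrite /mol.
  by rewrite mol1_out ?mul0r//; exact/negP.
by rewrite [X in _ * X]mol1_out ?mulr0//; exact/negP.
Qed.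

Lemma kern_mol c (t : R) : 0 < t -> kern (mol c t).
Proof.
move=> t0; split; first by apply: smooth_tensor; exact: smooth1_mol1.
pose M : R := t * (`|c.1| + `|c.2| + 1).
have M0 : 0 < M by rewrite mulr_gt0// ltr_wpDl// addr_ge0.
exists M => // x nb; apply/eqP; apply: contra_notT nb => /(mol_out t0).
have B (a b s : R) : t * a <= s <= t * (a + 1) -> `|s| <= t * (`|a| + `|b| + 1).
  move=> /andP[h1 h2]; rewrite ler_norml; apply/andP; split.
    by apply: le_trans h1; rewrite -mulrN ler_pM2l//; have := ler_norm (- a); rewrite normrN;
        have := normr_ge0 b; lra.
  by apply: le_trans h2 _; rewrite ler_pM2l//; have := ler_norm a; have := normr_ge0 b; lra.
move=> [h1 h2]; split => /=; rewrite subr0; first exact: B.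
by rewrite /M (addrC `|c.1|); exact: B.
Qed.

Lemma mol_int c (t : R) x : 0 < t -> ii2 (fun y => mol c t (x - y)) = 1.
Proof.
move=> t0; have kk := kern_mol c t0.
have sk := smooth_refl x kk.1.
have I : ig2 (fun y => mol c t (x - y)).
  have [_ [M M0 k0]] := kk.
  apply: (@ig_continuous_box R _ x M); first exact: smooth_cont.
  move=> y nb; apply: k0 => -[/= h1 h2]; apply: nb; split => /=; rewrite distrC; move: h1 h2;
      by rewrite !subr0.
apply: EFin_inj; rewrite iiE//.
rewrite -[LHS](integral12_prod_meas1 I).
transitivity (\int[lebesgue_measure]_s (mol1 c.1 t (x.1 - s))%:E)%E; last exact: mol1_FTC.
apply: eq_integral => s _; rewrite /fubini_F /= /mol /=.
under eq_integral do rewrite EFinM.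
rewrite ge0_integralZl//=.
- by rewrite mol1_FTC// mule1.
- apply/measurable_EFinP; apply: continuous_measurable_fun => r.
  apply: (@continuous_comp _ _ _ (fun r => x.2 - r) (mol1 c.2 t)).
    by apply: cvgB; [exact: cvg_cst | exact: cvg_id].
  exact: (smooth1_cont (smooth1_mol1 c.2 t)).
- by move=> r _; rewrite lee_fin mol1_ge0.
- by rewrite lee_fin mol1_ge0.
Qed.

Lemma mol_int' c (t : R) y : 0 < t -> (\int[mu]_x (mol c t (x - y))%:E = 1)%E.
Proof.
move=> t0; have mm (a b u : R) : measurable_fun setT (fun r : R => mol1 a b (r - u)).
  apply: continuous_measurable_fun => r.
  apply: (@continuous_comp _ _ _ (fun r => r - u) (mol1 a b)).
    by apply: cvgB; [exact: cvg_id | exact: cvg_cst].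
  exact: (smooth1_cont (smooth1_mol1 a b)).
rewrite [LHS]fubini_tonelli1.
- transitivity (\int[lebesgue_measure]_s (mol1 c.1 t (s - y.1))%:E)%E; last exact: mol1_FTC'.
  apply: eq_integral => s _; rewrite /fubini_F /= /mol /=.
  under eq_integral do rewrite EFinM.
  rewrite ge0_integralZl//=.
  + by rewrite mol1_FTC'// mule1.
  + by apply/measurable_EFinP; exact: mm.
  + by move=> r _; rewrite lee_fin mol1_ge0.
  + by rewrite lee_fin mol1_ge0.
- apply/measurable_EFinP; apply: continuous_measurable2 => x.
  apply: (@continuous_comp _ _ _ (fun x => x - y) (mol c t)).
    by apply: cvgB; [exact: cvg_id | exact: cvg_cst].
  by apply: smooth_cont; case: (kern_mol c t0).
- by move=> x; rewrite lee_fin mol_ge0.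
Qed.

End Mollifier.

Section Mollification.
Variable R : realType.
Local Notation plane := (R * R)%type.
Local Notation mu := (@leb2 R).
Local Notation ig2 := (ig (@leb2 R)).
Local Notation ii2 := (ii (@leb2 R)).
Implicit Types (f g h k v w : plane -> R) (x y p c : plane).

Lemma leb2_sigma_finite : sigma_finite setT mu.
Proof.
exists (fun n => box 0 n%:R).
  apply/seteqP; split=> // x _.
  have [n hn] : exists n : nat, `|x.1| + `|x.2| < n%:R.
    by exists (Num.bound (`|x.1| + `|x.2|)); apply: archi_boundP; rewrite addr_ge0.
  exists n => //; have h1 := normr_ge0 x.1; have h2 := normr_ge0 x.2.
  by split => /=; rewrite subr0; lra.
by move=> n; split; [exact: measurable_box | exact: leb2_box].
Qed.

Definition leb2_measure : {measure set _ -> \bar R} := (@leb2 R).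

(** The plane measure bundled with its sigma-finiteness, for Tonelli's theorem on the product of two
    planes. *)
Definition leb2_sf : SigmaFiniteMeasure.type _ R :=
  HB.pack_for (SigmaFiniteMeasure.type _ R) (Measure.sort leb2_measure)
    (Measure_isSigmaFinite.Build _ _ _ (Measure.sort leb2_measure) leb2_sigma_finite).

(** Replaces the Cauchy-Schwarz inequality without square roots: the weight [l] is chosen afterwards
    to balance the two terms. *)
Lemma amgm (l a b : R) : 0 < l -> a * b <= l * a ^+ 2 + l^-1 * b ^+ 2.
Proof.
move=> l0; rewrite -subr_ge0.
have -> : l * a ^+ 2 + l^-1 * b ^+ 2 - a * b = l * ((a - l^-1 * b / 2) ^+ 2) + 3 / 4 * l^-1 * b ^+
    2.
  by field; rewrite gt_eqF.
have q : 0 <= 3 / 4 :> R by lra.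
by rewrite addr_ge0// mulr_ge0 ?sqr_ge0 ?mulr_ge0 ?invr_ge0 ?(ltW l0).
Qed.

Lemma convB k v w x : kern k -> ig2 v -> ig2 w ->
  conv k (fun y => v y - w y) x = conv k v x - conv k w x.
Proof.
move=> kk Iv Iw; rewrite /conv -iiB; try exact: ig_conv.
by congr ii; apply/funext => y; rewrite mulrBl.
Qed.

Section Kernel.
Variables (c : plane) (t : R).
Hypothesis t0 : 0 < t.
Let k := mol c t.
Let kk : kern k := kern_mol c t0.

Let k0 x : 0 <= k x.
Proof. exact: mol_ge0. Qed.

Lemma measurable_conv v : ig2 v -> measurable_fun setT (conv k v).
Proof. by move=> Iv; apply: continuous_measurable2; exact: continuous_conv. Qed.

(** Tonelli's theorem, the kernel having mass 1 in its first variable as well. *)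
Lemma conv_nonneg g : ig2 g -> (forall x, 0 <= g x) ->
  ig2 (conv k g) /\ ii2 (conv k g) = ii2 g.
Proof.
move=> Ig g0.
pose m2 := leb2_sf.
pose F (z : plane * plane) : \bar R := (g z.2 * k (z.1 - z.2))%:E.
have mF : measurable_fun setT F.
  apply/measurable_EFinP; apply: measurable_funM.
    by apply: (measurableT_comp (ig_meas Ig)); exact: measurable_snd.
  have m1 (a b : R) : measurable_fun setT (mol1 a b).
    apply: continuous_measurable_fun; exact: (smooth1_cont (smooth1_mol1 a b)).
  by apply: measurable_funM; apply: (measurableT_comp (m1 _ _)); apply: measurable_funB;
    do ?[apply: measurable_fst | apply: measurable_snd | apply: measurableT_comp].
have F0 z : (0 <= F z)%E by rewrite lee_fin mulr_ge0// mol_ge0.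
have cE x : (conv k g x)%:E = (\int[m2]_y F (x, y))%E by rewrite iiE//; exact: ig_conv.
have E : (\int[mu]_x (conv k g x)%:E = (ii2 g)%:E)%E.
  transitivity (\int[m2]_x \int[m2]_y F (x, y))%E; first by apply: eq_integral => x _; rewrite cE.
  rewrite (@fubini_tonelli _ _ _ _ R m2 m2 F mF F0) iiE//; apply: eq_integral => y _.
  rewrite /F /=; under eq_integral do rewrite EFinM.
  rewrite ge0_integralZl ?lee_fin//.
  - by rewrite mol_int'// mule1.
  - apply/measurable_EFinP; apply: (@continuous_measurable2 R (fun x => k (x - y))) => x.
    apply: (@continuous_comp _ _ _ (fun x => x - y) k).
      by apply: cvgB; [exact: cvg_id | exact: cvg_cst].
    by apply: smooth_cont; case: kk.
  - by move=> x _; rewrite lee_fin mol_ge0.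
have I : ig2 (conv k g).
  apply/integrableP; split; first by apply/measurable_EFinP; exact: measurable_conv.
  rewrite (_ : (fun x => _) = (fun x => (conv k g x)%:E)); first by rewrite E ltry.
  apply/funext => x /=; rewrite ger0_norm//; apply: ii_ge0 => y.
  by rewrite mulr_ge0// mol_ge0.
by split=> //; apply: EFin_inj; rewrite iiE.
Qed.

Lemma conv_abs_le v x : ig2 v -> `|conv k v x| <= conv k (fun y => `|v y|) x.
Proof.
move=> Iv; apply: le_trans (ii_abs (ig_conv x kk Iv)) _.
apply: ii_le; [exact: ig_abs (ig_conv x kk Iv) | exact: ig_conv (ig_abs Iv) |].
by move=> y; rewrite normrM (ger0_norm (k0 _)).
Qed.

Lemma ig_conv_fun v : ig2 v -> ig2 (conv k v).
Proof.
move=> Iv; have [I _] := conv_nonneg (ig_abs Iv) (fun x => normr_ge0 _).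
by apply: (@ig_le _ _ R mu _ _ (measurable_conv Iv) _ I) => x; exact: conv_abs_le.
Qed.

Lemma conv_L1 v : ig2 v -> ii2 (fun x => `|conv k v x|) <= ii2 (fun x => `|v x|).
Proof.
move=> Iv; have [I <-] := conv_nonneg (ig_abs Iv) (fun x => normr_ge0 _).
apply: ii_le => //; first exact: ig_abs (ig_conv_fun Iv).
by move=> x; exact: conv_abs_le.
Qed.

(** [amgm] for h(x) and w(y), integrated against the kernel. The bound does not depend on [t], which
    is what the limit in [t] requires. *)
Lemma conv_bilinear h w (l : R) : 0 < l -> measurable_fun setT h -> ig2 (fun x => h x ^+ 2) ->
  ig2 w -> ig2 (fun x => w x ^+ 2) ->
  ig2 (fun x => h x * conv k w x) /\
  `|ii2 (fun x => h x * conv k w x)| <=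
    l * ii2 (fun x => h x ^+ 2) + l^-1 * ii2 (fun x => w x ^+ 2).
Proof.
move=> l0 mh Ih Iw Iw2; have li0 : 0 < l^-1 by rewrite invr_gt0.
have [Ic Ec] := conv_nonneg Iw2 (fun x => sqr_ge0 _).
have mhc : measurable_fun setT (fun x => h x * conv k w x).
  by apply: measurable_funM => //; exact: measurable_conv.
have I2 : ig2 (fun x => l * h x ^+ 2 + l^-1 * conv k (fun y => w y ^+ 2) x).
  by apply: igD; exact: igZ.
have le x : `|h x * conv k w x| <= l * h x ^+ 2 + l^-1 * conv k (fun y => w y ^+ 2) x.
  have Ik : ig2 (fun y => k (x - y)).
    have [_ [M M0 kM]] := kk.
    apply: (@ig_continuous_box R _ x M); first by apply: smooth_cont; apply: smooth_refl; case: kk.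
    move=> y nb; apply: (kM (x - y)) => -[/= h1 h2]; apply: nb; split => /=; rewrite distrC;
        move: h1 h2; by rewrite !subr0.
  (* The unit mass of the kernel turns the term that does not depend on [y] into an integral over
     [y]. *)
  have -> : l * h x ^+ 2 = ii2 (fun y => l * h x ^+ 2 * k (x - y)).
    by rewrite iiZ// mol_int// mulr1.
  rewrite /conv -iiZ; last exact: ig_conv.
  rewrite -iiZ; last exact: ig_conv.
  rewrite -iiD; [|exact: igZ|by apply: igZ; exact: ig_conv].
  apply: le_trans (ii_abs (igZ _ (ig_conv x kk Iw))) _.
  apply: ii_le.
  - exact: ig_abs (igZ _ (ig_conv x kk Iw)).
  - by apply: igD; [exact: igZ | apply: igZ; exact: ig_conv].
  move=> y; rewrite normrM (normrM (w y)) (ger0_norm (k0 _)).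
  rewrite mulrA mulrA -mulrDl ler_wpM2r//.
  rewrite -[h x ^+ 2](real_normK (num_real _)) -[w y ^+ 2](real_normK (num_real _)).
  move: (`|h x|) (`|w y|) => a b; exact: amgm.
split; first exact: (@ig_le _ _ R mu _ _ mhc le I2).
have I := @ig_le _ _ R mu _ _ mhc le I2.
apply: le_trans (ii_abs I) _; apply: le_trans (ii_le (ig_abs I) I2 le) _.
by rewrite iiD ?iiZ ?Ec//; exact: igZ.
Qed.

Lemma conv_near v x (e : R) : ig2 v ->
  (forall y, mol c t (x - y) != 0 -> `|v y - v x| <= e) -> `|conv k v x - v x| <= e.
Proof.
move=> Iv H.
have Ik : ig2 (fun y => k (x - y)).
  have [_ [M M0 kM]] := kk.
  apply: (@ig_continuous_box R _ x M); first by apply: smooth_cont; apply: smooth_refl; case: kk.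
  move=> y nb; apply: (kM (x - y)) => -[/= h1 h2]; apply: nb; split => /=; rewrite distrC;
      move: h1 h2; by rewrite !subr0.
have E1 : v x = ii2 (fun y => v x * k (x - y)) by rewrite iiZ// mol_int// mulr1.
have -> : e = ii2 (fun y => e * k (x - y)) by rewrite iiZ// mol_int// mulr1.
rewrite {1}E1 -iiB; [|exact: ig_conv|exact: igZ].
have I : ig2 (fun y => v y * k (x - y) - v x * k (x - y)).
  by apply: igB; [exact: ig_conv|exact: igZ].
apply: le_trans (ii_abs I) _; apply: ii_le; [exact: ig_abs|exact: igZ|move=> y].
rewrite -mulrBl normrM (ger0_norm (k0 _)).
have [E0|/H] := eqVneq (k (x - y)) 0; first by rewrite E0 !mulr0.
by move=> h; rewrite ler_wpM2r// k0.
Qed.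

End Kernel.

Definition reach c : R := `|c.1| + `|c.2| + 1.

Lemma reach_gt0 c : 0 < reach c.
Proof. by rewrite ltr_wpDl// addr_ge0. Qed.

Lemma mol_reach c (t : R) x y : 0 < t -> mol c t (x - y) != 0 -> box x (t * reach c) y.
Proof.
move=> t0 /(mol_out t0) /= [/andP[h1 h2] /andP[h3 h4]].
have l1 := ler_norm c.1; have l2 := ler_norm c.2.
have l3 := ler_norm (- c.1); have l4 := ler_norm (- c.2).
rewrite !normrN in l3 l4; have n1 := normr_ge0 c.1; have n2 := normr_ge0 c.2.
by split; rewrite ler_norml /reach; apply/andP; split; nra.
Qed.

Lemma unif_cont v M : continuous v -> (forall x, ~ box 0 M x -> v x = 0) ->
  forall e : R, 0 < e -> exists2 r : R, 0 < r & forall x y, box x r y -> `|v y - v x| <= e.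
Proof.
move=> cv v0 e e0.
(* Enlarged by 1: for [r] < 1, a pair with one point off this box has both points where [v]
   vanishes. *)
pose K : set plane := box 0 (M + 1).
pose P (r : R) (x : plane) := forall y, box x r y -> `|v y - v x| <= e.
have cK : near_covering K by apply/compact_near_coveringP; exact: compact_box.
have /cK : forall x, K x -> \forall x' \near x & r \near (0 : R)^'+, P r x'.
  move=> x _; have e2 : 0 < e / 2 by rewrite divr_gt0.
  have /nbhs_boxP[r r0 rV] : nbhs x [set y | `|v x - v y| <= e / 2].
    by have /cvgrPdist_le /(_ _ e2) := cv x.
  have r2 : 0 < r / 2 by rewrite divr_gt0.
  exists (box x (r / 2), [set s : R | 0 < s < r / 2]).
    split; first exact: nbhs_box.
    near=> s; apply/andP; split; near: s; [exact: nbhs_right_gt | exact: nbhs_right_lt].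
  move=> [x' s] [/= [b1 b2] /andP[s0 sr]] y [d1 d2].
  have bx' : box x r x' by split; lra.
  have by' : box x r y.
    split.
      by have := ler_normD (y.1 - x'.1) (x'.1 - x.1); rewrite addrA subrK; lra.
    by have := ler_normD (y.2 - x'.2) (x'.2 - x.2); rewrite addrA subrK; lra.
  have := ler_normD (v y - v x) (v x - v x'); rewrite addrA subrK.
  have /= := rV _ bx'; have /= := rV _ by'; rewrite (distrC (v x) (v y)); lra.
move=> H.
have : \forall r \near (0 : R)^'+, [/\ 0 < r, r < 1 & K `<=` P r].
  near=> r; split; near: r; [exact: nbhs_right_gt | exact: nbhs_right_lt | exact: H].
move=> /filter_ex[r [r0 r1 KP]]; exists r => // x y bxy.
have [Kx|nK] := pselect (K x); first exact: KP.
rewrite !v0 ?subrr ?normr0 ?ltW//.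
  by move=> [h1 h2]; apply: nK; split => /=; lra.
case: bxy => b1 b2 [/= h1 h2]; apply: nK; rewrite !subr0 in h1 h2; split => /=; rewrite subr0.
  by have := ler_normB y.1 (y.1 - x.1); rewrite opprB addrC subrK; lra.
by have := ler_normB y.2 (y.2 - x.2); rewrite opprB addrC subrK; lra.
Unshelve. all: by end_near. Qed.

Lemma conv_unif c v M : continuous v -> (forall x, ~ box 0 M x -> v x = 0) ->
  forall e : R, 0 < e -> exists2 t0 : R, 0 < t0 & forall t x, 0 < t -> t <= t0 ->
      `|conv (mol c t) v x - v x| <= e.
Proof.
move=> cv v0 e e0; have [r r0 H] := unif_cont cv v0 e0.
have rc := reach_gt0 c.
exists (r / reach c); first by rewrite divr_gt0.
move=> t x t0 tr; apply: conv_near => //; first exact: ig_continuous_box v0.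
move=> y /(mol_reach t0) [b1 b2]; apply: H.
rewrite ler_pdivlMr// in tr.
by split; [apply: le_trans b1 _|apply: le_trans b2 _].
Qed.

(** Split [w] into a test function and an L^2-small remainder. On the former the mollification
    converges uniformly; the latter is controlled for all [t] at once by [conv_bilinear]. *)
Lemma conv_weak c U M0 h w : open U -> U `<=` box 0 M0 ->
  measurable_fun setT h -> ig2 h -> ig2 (fun x => h x ^+ 2) ->
  measurable_fun setT w -> ig2 w -> ig2 (fun x => w x ^+ 2) -> (forall x, ~ U x -> w x = 0) ->
  forall e : R, 0 < e -> exists2 t0 : R, 0 < t0 & forall t, 0 < t -> t <= t0 ->
    `|ii2 (fun x => h x * conv (mol c t) w x) - ii2 (fun x => h x * w x)| <= e.
Proof.
move=> oU UM mh Ih Ih2 mw Iw Iw2 wU e e0.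
pose H := ii2 (fun x => h x ^+ 2) + 1; pose H1 := ii2 (fun x => `|h x|) + 1.
have H0 : 0 < H by rewrite ltr_wpDl//; apply: ii_ge0 => x; exact: sqr_ge0.
have H10 : 0 < H1 by rewrite ltr_wpDl//; exact: ii_ge0.
(* With this weight the [h] term of [amgm] is at most e/6, and a remainder of squared norm below l
   e/6 contributes another e/6. *)
pose l := e / 6 / H; have l0 : 0 < l by rewrite !divr_gt0.
have [phi tphi [Id le]] := test_dense oU UM mw Iw2 wU
    (mulr_gt0 l0 (divr_gt0 e0 (ltr0n _ 6) : 0 < e / 6)).
have [M M1 phi0] := test_out_box tphi.
have cphi : continuous phi by apply: smooth_cont; case: tphi.
have Iphi : ig2 phi by exact: ig_continuous_box phi0.
pose d x := w x - phi x; have Id1 : ig2 d by exact: igB.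
have [s s0 Hs] := conv_unif c cphi phi0 (divr_gt0 (divr_gt0 e0 (ltr0n _ 3)) H10 : 0 < e / 3 / H1).
exists s => // t t0 ts.
have kt := kern_mol c t0.
have [J1 B1] := conv_bilinear c t0 l0 mh Ih2 Id1 Id.
have mphi : measurable_fun setT phi by exact: continuous_measurable2.
have md : measurable_fun setT d by exact: measurable_funB.
have J3 : ig2 (fun x => h x * d x) by exact: ig_mul.
have mp : measurable_fun setT (fun x => conv (mol c t) phi x - phi x).
  by apply: measurable_funB => //; exact: measurable_conv.
have J2 : ig2 (fun x => h x * (conv (mol c t) phi x - phi x)).
  by apply: (ig_mulb Ih mp) => x; exact: Hs.
have B3 : `|ii2 (fun x => h x * d x)| <= l * ii2 (fun x => h x ^+ 2) +
    l^-1 * ii2 (fun x => d x ^+ 2).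
  apply: le_trans (ii_abs J3) _; rewrite -!iiZ// -iiD; try exact: igZ.
  apply: ii_le; [exact: ig_abs | by apply: igD; exact: igZ | move=> x].
  rewrite normrM -[h x ^+ 2](real_normK (num_real _)) -[d x ^+ 2](real_normK (num_real _)).
  move: (`|h x|) (`|d x|) => a b; exact: amgm.
have B2 : `|ii2 (fun x => h x * (conv (mol c t) phi x - phi x))| <= e / 3.
  apply: le_trans (ii_abs J2) _.
  apply: (@le_trans _ _ (ii2 (fun x => e / 3 / H1 * `|h x|))).
    apply: ii_le; [exact: ig_abs | exact: igZ (ig_abs Ih) | move=> x].
    by rewrite normrM mulrC ler_wpM2r// Hs.
  rewrite iiZ; last exact: ig_abs.
  rewrite mulrAC ler_pdivrMr// ler_wpM2l//; first by rewrite divr_ge0// ltW.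
  by rewrite /H1 lerDl.
have E : ii2 (fun x => h x * conv (mol c t) w x) - ii2 (fun x => h x * w x) =
  ii2 (fun x => h x * conv (mol c t) d x) + ii2 (fun x => h x * (conv (mol c t) phi x - phi x))
  - ii2 (fun x => h x * d x).
  have J0 : ig2 (fun x => h x * w x) by exact: ig_mul.
  have J4 : ig2 (fun x => h x * conv (mol c t) w x).
    by have [] := conv_bilinear c t0 l0 mh Ih2 Iw Iw2.
  rewrite -iiB// -iiD// -iiB//; last exact: igD.
  congr ii; apply/funext => x; rewrite /d convB//; ring.
have X : l * ii2 (fun x => h x ^+ 2) <= e / 6.
  by rewrite /l mulrAC ler_pdivrMr// ler_wpM2l ?divr_ge0 ?(ltW e0)// /H lerDl.
have Y : l^-1 * ii2 (fun x => d x ^+ 2) <= e / 6.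
  by rewrite mulrC ler_pdivrMr// mulrC; exact: ltW.
have E3 : e / 3 = e / 6 + e / 6 by field.
have B1' := le_trans B1 (lerD X Y); have B3' := le_trans B3 (lerD X Y).
rewrite E (_ : e = e / 3 + e / 3 + e / 3); last by field.
apply: le_trans (ler_normB _ _) _; apply: lerD; last by rewrite E3.
by apply: le_trans (ler_normD _ _) _; apply: lerD => //; rewrite E3.
Qed.

End Mollification.

(** * Extension by zero of weak derivatives *)

Section Truncation.
Variable R : realType.
Implicit Types (r s : R) (n : nat).

Let b : R -> R := bump 0 1.

Definition dbump : R -> R := derive1 (bump 0 1).

Lemma is_derive_bump s : is_derive s 1 b (dbump s).
Proof.
have [b' bb' _] := smooth1_bump (0 : R) 1 1; rewrite /dbump derive1E (is_deriveE (bb' s)).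
exact: bb'.
Qed.

Lemma continuous_dbump : continuous dbump.
Proof.
have [b' bb' sb'] := smooth1_derive (smooth1_bump (0 : R) 1).
suff -> : dbump = b' by exact: smooth1_cont.
by apply/funext => s; rewrite /dbump derive1E (is_deriveE (bb' s)).
Qed.

(** The derivative of r (1 - b r): it vanishes for |r| < 1 and equals 1 for |r| > 2. *)
Definition Psi r : R := 1 - b r - r * dbump r.

Lemma dbump_lt1 r : `|r| < 1 -> dbump r = 0.
Proof.
move=> r1; rewrite /dbump derive1E.
apply: is_deriveE; apply: (@near_eq_is_derive _ _ _ (fun _ : R => 1 : R)).
near=> s; rewrite bump1//subr0 ltW//; near: s.
have : nbhs r [set s : R | `|s| < 1].
  have cn : {for r, continuous (fun s : R => `|s|)} by exact: norm_continuous.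
  by have := cn _ (lt_nbhsl r1).
by [].
Unshelve. all: by end_near. Qed.

Lemma dbump_gt2 r : 2 < `|r| -> dbump r = 0.
Proof.
move=> r1; rewrite /dbump derive1E.
apply: is_deriveE; apply: (@near_eq_is_derive _ _ _ (fun _ : R => 0 : R)).
near=> s; rewrite bump0// mulr1 subr0 ltW//; near: s.
have : nbhs r [set s : R | 2 < `|s|].
  have cn : {for r, continuous (fun s : R => `|s|)} by exact: norm_continuous.
  by have := cn _ (lt_nbhsr r1).
by [].
Unshelve. all: by end_near. Qed.

Lemma Psi_lt1 r : `|r| < 1 -> Psi r = 0.
Proof. by move=> r1; rewrite /Psi dbump_lt1// mulr0 subr0 /b bump1 ?subr0 ?subrr// ltW. Qed.

Lemma Psi_gt2 r : 2 < `|r| -> Psi r = 1.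
Proof. by move=> r2; rewrite /Psi dbump_gt2// mulr0 subr0 /b bump0 ?subr0 ?mulr1// ltW. Qed.

Lemma continuous_Psi : continuous Psi.
Proof.
move=> r; apply: cvgB.
  by apply: cvgB; [exact: cvg_cst | exact: (smooth1_cont (smooth1_bump (0 : R) 1))].
by apply: cvgM; [exact: cvg_id | exact: continuous_dbump].
Qed.

Lemma Psi_bounded : exists2 C : R, 0 < C & forall r, `|Psi r| <= C.
Proof.
have /compact_bounded : compact [set Psi r | r in `[(-2 : R), 2]%classic].
  by apply: continuous_compact; [apply: continuous_subspaceT;
      exact: continuous_Psi | exact: segment_compact].
case/pinfty_ex_gt0 => M M0 H; exists (M + 1); first by rewrite addr_gt0.
move=> r; have [r2|r2] := leP `|r| 2; last first.
  by rewrite Psi_gt2// normr1; lra.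
suff : `|Psi r| <= M by lra.
by apply: H; exists r => //=; rewrite in_itv /= -ler_norml.
Qed.

(* A smooth truncation at height 1/(n+1): if v is continuous and vanishes off omega, then
   Phi n (v) has compact support in omega. *)
Definition Phi n s : R := s * (1 - b (n.+1%:R * s)).

Definition dPhi n s : R := Psi (n.+1%:R * s).

Lemma is_derive_Phi n s : is_derive s 1 (Phi n) (dPhi n s).
Proof.
have h : is_derive s 1 (fun r => b (n.+1%:R * r + 0)) (n.+1%:R * dbump (n.+1%:R * s + 0)).
  by apply: is_derive_comp_affine; exact: is_derive_bump.
have E : (fun r => b (n.+1%:R * r + 0)) = (fun r => b (n.+1%:R * r)).
  by apply/funext => r; rewrite addr0.
rewrite E addr0 in h.
have := is_derive_mul (@is_derive_id _ _ s (1 : R)) (is_derive_sub (is_derive_const s 1 1) h).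
by move=> H; apply: (is_derive_eq H); rewrite /dPhi /Psi; ring.
Qed.

Lemma continuous_Phi n : continuous (Phi n).
Proof.
move=> s; apply: differentiable_continuous; apply/derivable1_diffP.
exact: is_derive_derivable (is_derive_Phi n s).
Qed.

Lemma continuous_dPhi n : continuous (dPhi n).
Proof.
move=> s; apply: (@continuous_comp _ _ _ (fun s => n.+1%:R * s) Psi); last exact: continuous_Psi.
by apply: cvgM; [exact: cvg_cst | exact: cvg_id].
Qed.

Lemma Phi_near n s : `|Phi n s - s| <= 2 / n.+1%:R.
Proof.
have n0 : 0 < n.+1%:R :> R by rewrite ltr0n.
have -> : Phi n s - s = - (s * b (n.+1%:R * s)) by rewrite /Phi; ring.
rewrite normrN normrM; have b0 := bump_ge0 0 1 (n.+1%:R * s); have b1 := bump_le1 0 1 (n.+1%:R * s).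
have [h|h] := leP `|s| (2 / n.+1%:R).
  apply: le_trans h; rewrite -[leRHS]mulr1 ler_wpM2l//.
  by rewrite ger0_norm.
rewrite /b bump0 ?normr0 ?mulr0 ?divr_ge0// subr0 mulr1 normrM ger0_norm// mulrC.
by rewrite -ler_pdivrMr// ltW.
Qed.

Lemma dPhi_small n s : `|s| < n.+1%:R^-1 -> dPhi n s = 0.
Proof.
move=> h; have n0 : 0 < n.+1%:R :> R by rewrite ltr0n.
by apply: Psi_lt1; rewrite normrM ger0_norm// mulrC -ltr_pdivlMr// mul1r.
Qed.

Lemma dPhi_cvg s : dPhi n s @[n --> \oo] --> ((s != 0)%:R : R).
Proof.
have [->|s0] := eqVneq s 0.
  have -> : (fun n => dPhi n 0) = (fun=> 0).
    by apply/funext => n; rewrite dPhi_small// normr0 invr_gt0 ltr0n.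
  exact: cvg_cst.
apply: (@cvg_trans _ ((fun _ : nat => true%:R : R) @ \oo)); last exact: cvg_cst.
apply: near_eq_cvg; near=> n; rewrite /dPhi Psi_gt2//.
have n0 : 0 < n.+1%:R :> R by rewrite ltr0n.
rewrite normrM ger0_norm// -ltr_pdivrMr ?normr_gt0//.
near: n; exists (Num.bound (2 / `|s|)) => // n /= hn.
apply: lt_le_trans (archi_boundP _) _; first by rewrite divr_ge0.
by rewrite ler_nat leqW.
Unshelve. all: by end_near. Qed.

(** The constant is uniform in [n], because [dPhi n] is [Psi] after a rescaling of the variable. *)
Lemma Phi_lipschitz : exists2 C : R, 0 < C & forall n r s, `|Phi n r - Phi n s| <= C * `|r - s|.
Proof.
have [C C0 HC] := Psi_bounded; exists C => // n r s.
have [c [_ ->]] := mvt_line s r (is_derive_Phi n).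
by rewrite normrM; apply: ler_wpM2r; [exact: normr_ge0 | exact: HC].
Qed.

Lemma subr_sub1 (p q : R) : p - 1 - (q - 1) = p - q.
Proof. by ring. Qed.

Lemma mulrAC_subl (p q r s : R) : p * s * r - q * r * s = (p - q) * r * s.
Proof. by ring. Qed.

Lemma norm_gap (p q e : R) : 0 < e -> e <= `|p| -> `|p - q| <= e / 2 -> ~ `|q| <= e / 4.
Proof. by move=> e0 ep pq q4; have := ler_normD (p - q) q; rewrite subrK; lra. Qed.

End Truncation.

Section ZeroExtension.
Variable R : realType.
Local Notation plane := (R * R)%type.
Local Notation mu := (@leb2 R).
Local Notation ig2 := (ig (@leb2 R)).
Local Notation ii2 := (ii (@leb2 R)).
Implicit Types (f g h k v w F G phi : plane -> R) (x y p c : plane).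
Variables (omega : set plane) (M0 : R).
Hypotheses (oo : open omega) (oM : omega `<=` box 0 M0).

Definition L2z F := [/\ measurable_fun setT F, ig2 (fun x => F x ^+ 2) & forall x, ~ omega x ->
    F x = 0].

Definition wd s F G := forall phi, test_fun omega phi ->
  ii2 (fun x => F x * pds s phi x) = (-1) ^+ size s * ii2 (fun x => G x * phi x).

(** Kernels need not vanish near the boundary of omega, so this says that the zero extension of [F]
    has the zero extension of [G] as weak derivative on the plane, with no boundary term. *)
Definition Wd s F G := forall phi, kern phi ->
  ii2 (fun x => F x * pds s phi x) = (-1) ^+ size s * ii2 (fun x => G x * phi x).

Lemma ig_L2z F : L2z F -> ig2 F.
Proof.
move=> [mF IF F0]; have mo := open_measurable2 oo.
have I1 : ig2 (fun x => F x ^+ 2 + \1_omega x).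
  by apply: igD => //; exact: (ig_indic_sub oM).
apply: (@ig_le _ _ R mu _ _ mF _ I1) => x; have [ox|nx] := pselect (omega x).
  rewrite (indic_in ox) -(real_normK (num_real (F x))).
  by have := sqr_ge0 (`|F x| - 1); have := normr_ge0 (F x); nra.
by rewrite F0// normr0 addr_ge0 ?sqr_ge0// indicE ler0n.
Qed.

Lemma L2z_mulb F h (C : R) : L2z F -> measurable_fun setT h -> (forall x, `|h x| <= C) ->
  L2z (fun x => F x * h x).
Proof.
move=> [mF IF F0] mh hC; have m : measurable_fun setT (fun x => F x * h x) by
    exact: measurable_funM.
split=> //; last by move=> x /F0 ->; rewrite mul0r.
have I := igZ (C ^+ 2) IF.
apply: (@ig_le _ _ R mu _ _ _ _ I); first exact: (measurable_funX 2 m).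
move=> x; rewrite normrX normrM exprMn mulrC -[F x ^+ 2](real_normK (num_real _)).
by rewrite ler_wpM2r ?sqr_ge0// lerXn2r ?nnegrE// (le_trans _ (hC x)).
Qed.

Lemma L2zD F G : L2z F -> L2z G -> L2z (fun x => F x + G x).
Proof.
move=> [mF IF F0] [mG IG G0]; have m : measurable_fun setT (fun x => F x + G x) by
    exact: measurable_funD.
split=> //; last by move=> x nx; rewrite F0// G0// addr0.
have I : ig2 (fun x => 2 * F x ^+ 2 + 2 * G x ^+ 2) by apply: igD; exact: igZ.
apply: (@ig_le _ _ R mu _ _ _ _ I); first exact: (measurable_funX 2 m).
by move=> x; rewrite ger0_norm ?sqr_ge0//; have := sqr_ge0 (F x - G x); nra.
Qed.

Lemma L2zZ (k : R) F : L2z F -> L2z (fun x => k * F x).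
Proof.
move=> LF; rewrite (_ : (fun x => _) = (fun x => F x * (fun=> k) x)).
  by apply: (L2z_mulb (C := `|k|) LF); first exact: measurable_cst.
by apply/funext => x; rewrite mulrC.
Qed.

Lemma L2z_continuous v : continuous v -> (forall x, ~ omega x -> v x = 0) -> L2z v.
Proof.
move=> cv v0; split => //; first exact: continuous_measurable2.
apply: (@ig_continuous_box R _ 0 M0).
  have -> : (fun x => v x ^+ 2) = (fun x => v x * v x) by apply/funext => x; rewrite expr2.
  by move=> x; apply: cvgM; exact: cv.
by move=> x nb; rewrite v0 ?expr0n// => /oM.
Qed.

Lemma kern_meas phi : kern phi -> measurable_fun setT phi.
Proof. by move=> [sp _]; apply: continuous_measurable2; exact: smooth_cont. Qed.

Lemma ig_kern phi : kern phi -> ig2 phi.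
Proof. by move=> [sp [M _ p0]]; exact: ig_continuous_box (smooth_cont sp) p0. Qed.

Lemma ig_mul_kern F phi : ig2 F -> kern phi -> ig2 (fun x => F x * phi x).
Proof.
move=> IF kp; have [C _ pC] := kern_bounded kp.
exact: (ig_mulb IF (kern_meas kp) pC).
Qed.

Lemma kern_pds phi s : kern phi -> kern (pds s phi).
Proof. by move=> kp; elim: s => [//|i s IH]; exact: kern_pd. Qed.

(** [G] is replaced by a test function close to it in L^2, and the remainder is estimated by
    [amgm]. *)
Lemma orthogonal_L2 F G : L2z F -> L2z G ->
  (forall phi, test_fun omega phi -> ii2 (fun x => F x * phi x) = 0) ->
  ii2 (fun x => F x * G x) = 0.
Proof.
move=> [mF IF F0] [mG IG G0] H; apply/eqP; rewrite -normr_eq0 eq_le normr_ge0 andbT.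
apply/ler_addgt0Pl => e e0; rewrite addr0.
pose A := ii2 (fun x => F x ^+ 2) + 1.
have A0 : 0 < A by rewrite ltr_wpDl//; apply: ii_ge0 => x; exact: sqr_ge0.
pose l := e / 2 / A; have l0 : 0 < l by rewrite !divr_gt0.
have [phi tp [Id le]] := test_dense oo oM mG IG G0
    (mulr_gt0 l0 (divr_gt0 e0 (ltr0n _ 2) : 0 < e / 2)).
have mp : measurable_fun setT phi by exact: test_meas tp.
have md : measurable_fun setT (fun x => G x - phi x) by exact: measurable_funB.
have J1 : ig2 (fun x => F x * G x) by exact: ig_mul.
have J : ig2 (fun x => F x * (G x - phi x)) by exact: (@ig_mul _ _ R mu _ _ mF md IF Id).
have J2 : ig2 (fun x => F x * phi x).
  have -> : (fun x => F x * phi x) = (fun x => F x * G x - F x * (G x - phi x)).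
    by apply/funext => x; ring.
  exact: igB.
have -> : ii2 (fun x => F x * G x) = ii2 (fun x => F x * (G x - phi x)).
  rewrite -[RHS]addr0 -(H phi tp) -iiD//; congr ii; apply/funext => x; ring.
apply: le_trans (ii_abs J) _.
have I2 : ig2 (fun x => l * F x ^+ 2 + l^-1 * (G x - phi x) ^+ 2) by apply: igD; exact: igZ.
apply: le_trans (ii_le (ig_abs J) I2 _) _.
  move=> x; rewrite normrM -[F x ^+ 2](real_normK (num_real _))
      -[(G x - phi x) ^+ 2](real_normK (num_real _)).
  exact: amgm.
rewrite iiD ?iiZ//; try exact: igZ.
have X : l * ii2 (fun x => F x ^+ 2) <= e / 2.
  by rewrite /l mulrAC ler_pdivrMr// ler_wpM2l ?divr_ge0 ?(ltW e0)// /A lerDl.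
have Y : l^-1 * ii2 (fun x => (G x - phi x) ^+ 2) <= e / 2.
  by rewrite mulrC ler_pdivrMr// mulrC; exact: ltW.
by rewrite [leRHS]splitr lerD.
Qed.

Lemma test_kern phi : test_fun omega phi -> kern phi.
Proof. by move=> tp; split; [case: tp | exact: test_out_box tp]. Qed.

Section OneDerivative.
Variables (v G : plane -> R) (j : 'I_2).
Hypotheses (cv : continuous v) (v0 : forall x, ~ omega x -> v x = 0) (LG : L2z G)
  (vG : wd [:: j] v G).

Let Iv : ig2 v.
Proof. exact: ig_L2z (L2z_continuous cv v0). Qed.

Let vbox x : ~ box 0 M0 x -> v x = 0.
Proof. by move=> nb; apply: v0 => /oM. Qed.

(** As a function of y, the kernel at x - y is a test function in omega when its support around [x]
    lies there. *)
Lemma conv_weak_deriv (t : R) x : 0 < t -> (forall y, box x (t * reach (0 : plane)) y -> omega y) ->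
  conv (pd j (mol 0 t)) v x = conv (mol 0 t) G x.
Proof.
move=> t0 H; have kk := kern_mol (0 : plane) t0.
have tpsi : test_fun omega (fun y => mol 0 t (x - y)).
  split; first by apply: smooth_refl; case: kk.
  exists (box x (t * reach (0 : plane))); split => //; first exact: compact_box.
  move=> y nb; apply/eqP; apply: contra_notT nb; exact: mol_reach.
have := vG tpsi; rewrite /= expr1 mulN1r pd_refl; last by case: kk.
rewrite (_ : (fun y => v y * - pd j (mol 0 t) (x - y)) =
    (fun y => - (v y * pd j (mol 0 t) (x - y)))); last first.
  by apply/funext => y; rewrite mulrN.
by rewrite iiN; [move/oppr_inj | apply: ig_conv => //; exact: kern_pd].
Qed.

(** With v_t a mollification of [v], Phi n (v_t) phi is differentiable with compact support, so the
    integral of its derivative is 0. Where dPhi n (v_t) is not 0, v_t is bounded away from 0; hence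
    [v] does not vanish near that point, which is then well inside omega, and the derivative of v_t
    is the mollification of [G]. Then [t] tends to 0. *)
Lemma truncated_parts n phi : kern phi ->
  ii2 (fun x => Phi n (v x) * pd j phi x) = - ii2 (fun x => dPhi n (v x) * phi x * G x).
Proof.
move=> kp; have [C C0 HC] := Psi_bounded R; have [C' C'0 HL] := Phi_lipschitz R.
have sp := kp.1; have kdp := kern_pd j kp; have [B B0 pB] := kern_bounded kp.
have [mG IG2 G0] := LG; have IG := ig_L2z LG.
have cPhi := @continuous_Phi R n.
have cdv : continuous (fun x => dPhi n (v x)).
  by move=> x; apply: (@continuous_comp _ _ _ v (dPhi n)); [exact: cv | exact: continuous_dPhi].
have cPv : continuous (fun x => Phi n (v x)).
  by move=> x; apply: (@continuous_comp _ _ _ v (Phi n)); [exact: cv | exact: cPhi].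
pose h x := dPhi n (v x) * phi x.
have ch : continuous h by move=> x; apply: cvgM; [exact: cdv | exact: smooth_cont].
have [_ [Mp Mp0 p0]] := kp.
have hbox x : ~ box 0 Mp x -> h x = 0 by move=> /p0; rewrite /h => ->; rewrite mulr0.
have mh : measurable_fun setT h by exact: continuous_measurable2.
have Ih : ig2 h by exact: ig_continuous_box hbox.
have Ih2 : ig2 (fun x => h x ^+ 2).
  apply: (@ig_continuous_box R _ 0 Mp); last by move=> x /hbox ->; rewrite expr0n.
  have -> : (fun x => h x ^+ 2) = (fun x => h x * h x) by apply/funext => x; rewrite expr2.
  by move=> x; apply: cvgM; exact: ch.
pose X := ii2 (fun x => Phi n (v x) * pd j phi x); pose Y := ii2 (fun x => h x * G x).
suff : X + Y = 0 by rewrite -/X => /eqP; rewrite addr_eq0 => /eqP.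
apply/eqP; rewrite -normr_eq0 eq_le normr_ge0 andbT; apply/ler_addgt0Pl => e e0; rewrite addr0.
have e3 : 0 < e / 3 by rewrite divr_gt0.
have [t1 t10 T1] := conv_weak (0 : plane) oo oM mh Ih Ih2 mG IG IG2 G0 e3.
pose N1 := ii2 (fun x => `|pd j phi x|) + 1.
have N10 : 0 < N1 by rewrite ltr_wpDl//; exact: ii_ge0.
pose N2 := B * ii2 (fun x => `|G x|) + 1.
have N20 : 0 < N2.
  by rewrite ltr_wpDl// mulr_ge0 ?(ltW B0)//; exact: ii_ge0.
have [t2 t20 T2] := conv_unif (0 : plane) cv vbox (divr_gt0 (divr_gt0 e3 C'0) N10).
have n0 : 0 < n.+1%:R^-1 :> R by rewrite invr_gt0 ltr0n.
have [t3 t30 T3] := conv_unif (0 : plane) cv vbox (divr_gt0 n0 (ltr0n _ 2) : 0 < n.+1%:R^-1 / 2).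
have [r r0 Hr] := unif_cont cv vbox (divr_gt0 n0 (ltr0n _ 4) : 0 < n.+1%:R^-1 / 4).
(* dPhi n is uniformly continuous, being constant outside a compact set *)
have [d d0 Hd] : exists2 d : R, 0 < d & forall a b : R, `|a - b| <= d ->
    `|dPhi n a - dPhi n b| <= e / 3 / N2.
  (* The line is embedded into the plane by a cut-off in the second coordinate, so that [unif_cont]
     for functions of compact support applies. *)
  have cq : continuous (fun x : plane => (dPhi n x.1 - 1) * bump2 0 1 (0, x.2)).
    move=> x; apply: cvgM.
      apply: cvgB; last exact: cvg_cst.
      by apply: (@continuous_comp _ _ _ fst (dPhi n)); [exact: cvg_fst | exact: continuous_dPhi].
    rewrite /bump2 /=; apply: cvgM; first exact: cvg_cst.
    apply: (@continuous_comp _ _ _ snd (bump 0 1)); first exact: cvg_snd.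
    exact: (smooth1_cont (smooth1_bump (0 : R) 1)).
  have qbox x : ~ box (0 : plane) 2 x -> (dPhi n x.1 - 1) * bump2 0 1 (0, x.2) = 0.
    move=> nb; have [h1|h1] := leP `|x.1| 2.
      have h2 : 2 < `|x.2|.
        by rewrite ltNge; apply/negP => h2; apply: nb; split => /=; rewrite subr0.
      rewrite [X in _ * X](_ : _ = 0) ?mulr0// /bump2 /= [X in _ * X]bump0 ?mulr0// mulr1 subr0.
      exact: ltW.
    rewrite /dPhi Psi_gt2 ?subrr ?mul0r// normrM ger0_norm//.
    apply: lt_le_trans h1 _; rewrite ler_peMl//.
    by rewrite ler1n.
  have [d d0 Hd] := unif_cont cq qbox (divr_gt0 e3 N20).
  exists d => // a b ab.
  have := Hd (b, 0) (a, 0); rewrite /= /bump2 /= (_ : bump 0 1 0 = 1 :> R); last first.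
    by rewrite bump1// subrr normr0.
  rewrite !mulr1 subr_sub1.
  by apply; split => //=; rewrite subrr normr0 ltW.
have [t4 t40 T4] := conv_unif (0 : plane) cv vbox d0.
have rc : 0 < reach (0 : plane) by exact: reach_gt0.
(* The bounds ensure, in this order: convergence of the pairing with [G]; the error in [Phi n]; v_t
   within half the threshold 1/(n+1) of [v]; the error in [dPhi n]; kernel support within the
   distance [r] over which [v] varies by at most a quarter of the threshold. *)
pose t := Num.min (Num.min t1 t2) (Num.min (Num.min t3 t4) (r / reach (0 : plane))).
have t0 : 0 < t by rewrite !lt_min t10 t20 t30 t40 divr_gt0.
have tt1 : t <= t1 by rewrite !ge_min lexx.
have tt2 : t <= t2 by rewrite !ge_min lexx orbT.
have tt3 : t <= t3 by rewrite !ge_min lexx !orbT.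
have tt4 : t <= t4 by rewrite !ge_min lexx !orbT.
have ttr : t * reach (0 : plane) <= r by rewrite -ler_pdivlMr// !ge_min lexx !orbT.
have kk := kern_mol (0 : plane) t0.
pose vt := conv (mol 0 t) v.
have svt : smooth vt by exact: smooth_conv.
have cvt := smooth_cont svt.
have dvt x : is_derive x (basis R j) vt (conv (pd j (mol 0 t)) v x) by exact: is_derive_conv.
have IcG : ig2 (conv (mol 0 t) G) by exact: ig_conv_fun.
have cdvt : continuous (fun x => dPhi n (vt x)).
  by move=> x; apply: (@continuous_comp _ _ _ vt (dPhi n)); [exact: cvt | exact: continuous_dPhi].
have cPvt : continuous (fun x => Phi n (vt x)).
  by move=> x; apply: (@continuous_comp _ _ _ vt (Phi n)); [exact: cvt | exact: cPhi].
(* If |v_t| >= 1/(n+1) at [x], then |v(x)| exceeds a quarter of 1/(n+1). A point off omega within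
   the reach of the kernel, where [v] = 0, would contradict the choice of [r]. *)
have key x : dPhi n (vt x) * conv (pd j (mol 0 t)) v x = dPhi n (vt x) * conv (mol 0 t) G x.
  have [hx|hx] := ltP `|vt x| n.+1%:R^-1; first by rewrite dPhi_small// !mul0r.
  congr (_ * _); apply: conv_weak_deriv => // y [b1 b2].
  have bxy : box x r y by split; [apply: le_trans b1 _|apply: le_trans b2 _].
  apply: contrapT => ny; have := Hr x y bxy; rewrite (v0 ny) sub0r normrN.
  exact: (norm_gap n0 hx (T3 t x t0 tt3)).
have parts : ii2 (fun x => dPhi n (vt x) * conv (mol 0 t) G x * phi x + Phi n (vt x) * pd j phi x)
    = 0.
  apply: (@ii_derive_eq0 R (fun x => Phi n (vt x) * phi x) _ j Mp).
  - move=> x; rewrite -key.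
    have dP : is_derive x (basis R j) (fun y => Phi n (vt y))
        (dPhi n (vt x) * conv (pd j (mol 0 t)) v x).
      apply: is_derive_line0.
      apply: (@is_derive1_comp _ (Phi n) (fun s : R => vt (s *: basis R j + x))).
        by rewrite scale0r add0r; exact: is_derive_Phi.
      by apply: is_derive_line; rewrite scale0r add0r.
    exact: (is_derive_mul dP (smooth_is_derive sp x j)).
  - move=> x; apply: cvgD; apply: cvgM.
    + by apply: cvgM; [exact: cdvt | apply: continuous_conv].
    + exact: smooth_cont.
    + exact: cPvt.
    + exact: smooth_cont (smooth_pd j sp) _.
  - by move=> x /p0 ->; rewrite mulr0.
have mdvt : measurable_fun setT (fun x => dPhi n (vt x)) by exact: continuous_measurable2.
have J1 : ig2 (fun x => dPhi n (vt x) * conv (mol 0 t) G x * phi x).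
  apply: ig_mul_kern => //.
  have -> : (fun x => dPhi n (vt x) * conv (mol 0 t) G x) =
      (fun x => conv (mol 0 t) G x * dPhi n (vt x)).
    by apply/funext => x; rewrite mulrC.
  by apply: (ig_mulb (M := C) IcG mdvt) => x; exact: HC.
have boxdp := derive_out_box (smooth_is_derive sp ^~ j) p0 (smooth_cont (smooth_pd j sp)).
have J2 : ig2 (fun x => Phi n (vt x) * pd j phi x).
  apply: (@ig_continuous_box R _ 0 Mp).
    by move=> x; apply: cvgM; [exact: cPvt | exact: smooth_cont (smooth_pd j sp) _].
  by move=> x /boxdp ->; rewrite mulr0.
have J3 : ig2 (fun x => Phi n (v x) * pd j phi x).
  apply: (@ig_continuous_box R _ 0 Mp).
    by move=> x; apply: cvgM; [exact: cPv | exact: smooth_cont (smooth_pd j sp) _].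
  by move=> x /boxdp ->; rewrite mulr0.
rewrite (iiD J1 J2) in parts.
have J4 : ig2 (fun x => h x * conv (mol 0 t) G x).
  by have [] := conv_bilinear (0 : plane) t0 ltr01 mh Ih2 IG IG2.
have A1 : `|X - ii2 (fun x => Phi n (vt x) * pd j phi x)| <= e / 3.
  rewrite /X -iiB//; apply: le_trans (ii_abs (igB J3 J2)) _.
  apply: (@le_trans _ _ (ii2 (fun x => e / 3 / N1 * `|pd j phi x|))).
    apply: ii_le; [exact: ig_abs (igB J3 J2) | exact: igZ (ig_abs (ig_kern kdp)) | move=> x].
    rewrite -mulrBl normrM ler_wpM2r//; apply: le_trans (HL n _ _) _.
    rewrite distrC mulrC -ler_pdivlMr// mulrAC.
    exact: T2.
  rewrite iiZ; last exact: ig_abs (ig_kern kdp).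
  rewrite mulrAC ler_pdivrMr// ler_wpM2l//; first exact: ltW.
  by rewrite /N1 lerDl.
have A2 : `|ii2 (fun x => h x * conv (mol 0 t) G x) - Y| <= e / 3 by exact: T1.
have A3 : `|ii2 (fun x => dPhi n (vt x) * conv (mol 0 t) G x * phi x) - ii2
    (fun x => h x * conv (mol 0 t) G x)| <= e / 3.
  rewrite -iiB//; apply: le_trans (ii_abs (igB J1 J4)) _.
  apply: (@le_trans _ _ (ii2 (fun x => e / 3 / N2 * B * `|conv (mol 0 t) G x|))).
    apply: ii_le; [exact: ig_abs (igB J1 J4) | exact: igZ (ig_abs IcG) | move=> x].
    rewrite /h mulrAC_subl.
    rewrite !normrM ler_wpM2r// ler_pM//; apply: Hd.
    exact: T4.
  rewrite iiZ; last exact: ig_abs.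
  have := conv_L1 (0 : plane) t0 IG; move=> cL.
  set Q := ii2 _ in cL *.
  rewrite (_ : e / 3 / N2 * B * Q = e / 3 * (B * Q) / N2); last by ring.
  rewrite ler_pdivrMr// ler_wpM2l//; first exact: ltW.
  rewrite /N2; apply: (@le_trans _ _ (B * ii2 (fun x => `|G x|))); last by rewrite lerDl.
  by rewrite ler_wpM2l// ltW.
have -> : X + Y = (X - ii2 (fun x => Phi n (vt x) * pd j phi x))
   - (ii2 (fun x => dPhi n (vt x) * conv (mol 0 t) G x * phi x) - ii2
       (fun x => h x * conv (mol 0 t) G x))
   - (ii2 (fun x => h x * conv (mol 0 t) G x) - Y).
  have E := parts; move: E.
  move: (ii2 (fun x => dPhi n (vt x) * conv (mol 0 t) G x * phi x))
      (ii2 (fun x => Phi n (vt x) * pd j phi x)) (ii2 (fun x => h x * conv (mol 0 t) G x)).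
  by move=> a b q ab; rewrite (_ : b = - a); [ring | move/eqP: ab; rewrite addrC addr_eq0 => /eqP].
rewrite (_ : e = e / 3 + e / 3 + e / 3); last by field.
apply: le_trans (ler_normB _ _) _; apply: lerD => //.
by apply: le_trans (ler_normB _ _) _; exact: lerD.
Qed.

(* Where v = 0 the function G vanishes almost everywhere as well, so the truncations Phi n (v),
   which have compact support in omega, give the formula in the limit. *)
Lemma zero_extension : Wd [:: j] v G.
Proof.
have [C C0 HC] := Psi_bounded R; have [mG IG2 G0] := LG; have IG := ig_L2z LG.
pose G1 x := G x * (v x != 0)%:R.
have mv := continuous_measurable2 cv.
have mnz : measurable_fun setT (fun x => (v x != 0)%:R : R).
  apply: (measurable_fun_cvg (h := fun n x => dPhi n (v x))) => [n|x _]; last exact: dPhi_cvg.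
  apply: continuous_measurable2 => x.
  by apply: (@continuous_comp _ _ _ v (dPhi n)); [exact: cv | exact: continuous_dPhi].
have LG1 : L2z G1.
  by apply: (L2z_mulb (C := 1) LG mnz) => x; rewrite ger0_norm ?ler0n// lern1 leq_b1.
have step1 phi : kern phi -> ii2 (fun x => v x * pd j phi x) = - ii2 (fun x => G1 x * phi x).
  move=> kp; have [_ [Mp Mp0 p0]] := kp; have sp := kp.1; have [B B0 pB] := kern_bounded kp.
  have cPhi n := @continuous_Phi R n.
  have kdp := kern_pd j kp.
  pose F n x := Phi n (v x) * pd j phi x.
  pose H n x := dPhi n (v x) * phi x * G x.
  have cF n : continuous (F n).
    move=> x; apply: cvgM; last exact: smooth_cont kdp.1 _.
    by apply: (@continuous_comp _ _ _ v (Phi n)); [exact: cv | exact: cPhi].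
  have [IX CX] : ig2 (fun x => v x * pd j phi x) /\
      (ii2 (F n) @[n --> \oo] --> ii2 (fun x => v x * pd j phi x)).
    apply: (@ii_cvg _ _ R mu F _ (fun x => (`|v x| + 2) * `|pd j phi x|)).
    - by move=> n; exact: continuous_measurable2.
    - rewrite (_ : (fun x => _) = (fun x => `|v x * pd j phi x| + 2 * `|pd j phi x|)).
        by apply: igD; [apply: ig_abs; exact: ig_mul_kern | apply: igZ;
            exact: ig_abs (ig_kern kdp)].
      by apply/funext => x; rewrite normrM; ring.
    - move=> n x; rewrite /F normrM ler_wpM2r//.
      rewrite -[Phi n (v x)](subrK (v x)); apply: le_trans (ler_normD _ _) _.
      rewrite addrC lerD2l; apply: le_trans (Phi_near _ _) _.
      by rewrite ler_pdivrMr ?ltr0n// ler_peMr// ler1n.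
    - move=> x; apply: cvgM; last exact: cvg_cst.
      apply/cvgrPdist_le => e e0; near=> n; rewrite distrC; apply: le_trans (Phi_near n _) _.
      rewrite ler_pdivrMr ?ltr0n// mulrC -ler_pdivrMr//.
      near: n; exists (Num.bound (2 / e)) => // n /= hn.
      apply: ltW; apply: lt_le_trans (archi_boundP _) _; first by rewrite divr_ge0// ltW.
      by rewrite ler_nat leqW.
  have [IY CY] : ig2 (fun x => (v x != 0)%:R * phi x * G x) /\
      (ii2 (H n) @[n --> \oo] --> ii2 (fun x => (v x != 0)%:R * phi x * G x)).
    apply: (@ii_cvg _ _ R mu H _ (fun x => C * B * `|G x|)).
    - move=> n; apply: measurable_funM => //; apply: measurable_funM; last exact: kern_meas.
      apply: continuous_measurable2 => x.
      by apply: (@continuous_comp _ _ _ v (dPhi n)); [exact: cv | exact: continuous_dPhi].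
    - exact: igZ (ig_abs IG).
    - by move=> n x; rewrite /H !normrM ler_wpM2r// ler_pM// HC.
    - by move=> x; apply: cvgM; [apply: cvgM; [exact: dPhi_cvg | exact: cvg_cst] | exact: cvg_cst].
  have CN : ii2 (F n) @[n --> \oo] --> - ii2 (fun x => (v x != 0)%:R * phi x * G x).
    rewrite (_ : (fun n => ii2 (F n)) = (fun n => - ii2 (H n))); first exact: cvgN.
    by apply/funext => n; exact: truncated_parts.
  rewrite (_ : (fun x => G1 x * phi x) = (fun x => (v x != 0)%:R * phi x * G x)); last first.
    by apply/funext => x; rewrite /G1; ring.
  by rewrite -(cvg_lim _ CX)// -(cvg_lim _ CN).
move=> phi kp; rewrite /= expr1 mulN1r step1//; congr (- _).
(* Both functions are weak derivatives of [v] in omega, so their difference is orthogonal to test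
   functions in omega, and by density to the restriction of [phi]. *)
pose D x := G x + - 1 * G1 x.
have LD : L2z D by exact: L2zD LG (L2zZ (-1) LG1).
have Dorth psi : test_fun omega psi -> ii2 (fun x => D x * psi x) = 0.
  move=> tp; have kpsi := test_kern tp.
  have E := vG tp; rewrite /= expr1 mulN1r step1// in E.
  rewrite (_ : (fun x => D x * psi x) = (fun x => G x * psi x - G1 x * psi x)); last first.
    by apply/funext => x; rewrite /D; ring.
  rewrite iiB; [|exact: ig_mul_kern|apply: ig_mul_kern => //; exact: ig_L2z].
  by move/oppr_inj: E => ->; rewrite subrr.
have Lp : L2z (fun x => \1_omega x * phi x).
  have [B B0 pB] := kern_bounded kp.
  apply: (L2z_mulb (C := B) _ (kern_meas kp) pB).
  have mo := open_measurable2 oo; split; first exact/measurable_indicP.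
    rewrite (_ : (fun x => _) = \1_omega); first exact: (ig_indic_sub oM).
    by apply/funext => x; rewrite indicE; case: (_ \in _); rewrite ?expr1n ?expr0n.
  by move=> x nx; rewrite indic_notin.
have := orthogonal_L2 LD Lp Dorth.
rewrite (_ : (fun x => D x * (\1_omega x * phi x)) = (fun x => G x * phi x - G1 x * phi x));
    last first.
  apply/funext => x; have [ox|nx] := pselect (omega x); first by rewrite (indic_in ox) /D; ring.
  by rewrite /D /G1 G0// (indic_notin nx); ring.
rewrite iiB; [|exact: ig_mul_kern|apply: ig_mul_kern => //; exact: ig_L2z].
by move=> /eqP; rewrite subr_eq0 => /eqP.
Unshelve. all: by end_near. Qed.

End OneDerivative.

End ZeroExtension.

(** * Boundary charts *)

Section Boundary.
Variable R : realType.
Local Notation plane := (R * R)%type.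
Implicit Types (f g u rho : plane -> R) (x y p q : plane) (i j : 'I_2).
Variable omega : set plane.
Hypothesis oo : open omega.

Lemma bdry_notin p : bdry omega p -> ~ omega p.
Proof. by move=> [_ ni] op; apply: ni; exact: open_nbhs_nbhs. Qed.

Lemma closure_cases p : closure omega p -> omega p \/ bdry omega p.
Proof.
move=> cp; have [op|np] := pselect (omega p); [by left|right; split => //].
by move=> /interior_subset.
Qed.

Lemma closure_in p : omega p -> closure omega p.
Proof. exact: subset_closure. Qed.

Lemma zext_in f p : omega p -> (f \_ omega) p = f p.
Proof. by move=> op; rewrite patchE mem_set. Qed.

Lemma zext_out f p : ~ omega p -> (f \_ omega) p = 0.
Proof. by move=> np; rewrite patchE memNset. Qed.

Lemma C0bar_near f p (e : R) : C0bar omega f -> closure omega p -> 0 < e ->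
  exists2 r : R, 0 < r & forall y, box p r y -> closure omega y -> `|f y - f p| <= e.
Proof.
move=> /subspace_continuousP cf cp e0.
have /cvgrPdist_le /(_ e e0) := cf p cp.
move=> /nbhs_boxP[r r0 H]; exists r => // y by_ cy.
by have := H y by_ cy; rewrite /= distrC.
Qed.

Lemma C0barP f : (forall p (e : R), closure omega p -> 0 < e ->
  exists2 r : R, 0 < r & forall y, box p r y -> closure omega y -> `|f y - f p| <= e) ->
      C0bar omega f.
Proof.
move=> H; apply/subspace_continuousP => p cp; apply/cvgrPdist_le => e e0.
have [r r0 Hr] := H p e cp e0; apply: filterS (nbhs_box p r0) => y by_ cy.
by rewrite distrC; exact: Hr.
Qed.

Lemma continuous_zext f : C0bar omega f -> (forall p, bdry omega p -> f p = 0) ->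
  continuous (f \_ omega).
Proof.
move=> cf f0 p; apply/cvgrPdist_le => e e0.
have [cp|ncp] := pselect (closure omega p); last first.
  have oC : open (~` closure omega) by apply: closed_openC; exact: closed_closure.
  have np : ~ omega p by move=> /closure_in.
  apply: filterS (open_nbhs_nbhs (conj oC ncp : open_nbhs p (~` closure omega))) => y ncy.
  by rewrite !zext_out ?subrr ?normr0 ?ltW// => /closure_in.
have E : (f \_ omega) p = f p.
  case: (closure_cases cp) => [op|bp]; first exact: zext_in.
  by rewrite zext_out ?f0//; exact: bdry_notin.
have [r r0 Hr] := C0bar_near cf cp e0; rewrite E.
case: (closure_cases cp) => [op|bp].
  apply: filterS2 (nbhs_box p r0) (open_nbhs_nbhs (conj oo op)) => y by_ oy.
  by rewrite zext_in// distrC; apply: Hr => //; exact: closure_in.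
apply: filterS (nbhs_box p r0) => y by_.
have [oy|ny] := pselect (omega y).
  by rewrite zext_in// distrC; apply: Hr => //; exact: closure_in.
by rewrite zext_out// f0// subrr normr0 ltW.
Qed.

Lemma cont_box f p (e : R) : continuous f -> 0 < e ->
  exists2 r : R, 0 < r & forall y, box p r y -> `|f y - f p| <= e.
Proof.
move=> cf e0; have /cvgrPdist_le /(_ e e0) := cf p.
by move=> /nbhs_boxP[r r0 H]; exists r => // y by_; rewrite distrC; exact: H.
Qed.

Lemma box_le p (r s : R) : r <= s -> box p r `<=` box p s.
Proof. by move=> rs x [h1 h2]; split; [apply: le_trans h1 _|apply: le_trans h2 _]. Qed.

Lemma closure_box p (r : R) : closure omega p -> 0 < r -> exists2 y, box p r y & omega y.
Proof. by move=> cp r0; have [y [oy by_]] := cp _ (nbhs_box p r0); exists y. Qed.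

(** A negative value of [rho] would put [p] in omega, and a positive one would keep omega away from
    [p]. *)
Lemma chart_box p rho : bdry omega p -> bdry_chart omega p rho ->
  rho p = 0 /\ exists2 r : R, 0 < r & forall y, box p r y -> (omega y <-> rho y < 0).
Proof.
move=> bp [srho _ /nbhs_boxP[r r0 H]]; split; last by exists r.
have cr := smooth_cont srho; apply/eqP; rewrite eq_le; apply/andP; split; last first.
  have bpp : box p r p by split; rewrite subrr normr0 ltW.
  by rewrite leNgt; apply/negP => /(H p bpp).2; exact: bdry_notin.
rewrite leNgt; apply/negP => rp0.
have [s s0 Hs] := cont_box p cr (divr_gt0 rp0 (ltr0n _ 2) : 0 < rho p / 2).
have m0 : 0 < Num.min r s by rewrite lt_min r0.
have [y by_ oy] := closure_box bp.1 m0.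
have /(H y _).1 : omega y by [].
have h1 : Num.min r s <= r by rewrite ge_min lexx.
have h2 : Num.min r s <= s by rewrite ge_min lexx orbT.
move=> /(_ (box_le h1 by_)); have := Hs y (box_le h2 by_).
by rewrite ler_norml => /andP[]; lra.
Qed.

Lemma rho_closure p rho (r : R) y : (forall y, box p r y -> (omega y <-> rho y < 0)) ->
  smooth rho -> 0 < r -> closure omega y -> box p (r / 2) y -> rho y <= 0.
Proof.
move=> H srho r0 cy by_; rewrite leNgt; apply/negP => rp0.
have cr := smooth_cont srho.
have [s s0 Hs] := cont_box y cr (divr_gt0 rp0 (ltr0n _ 2) : 0 < rho y / 2).
have m0 : 0 < Num.min (r / 2) s by rewrite lt_min s0 divr_gt0.
have [z [bz1 bz2] oz] := closure_box cy m0.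
have h1 : Num.min (r / 2) s <= r / 2 by rewrite ge_min lexx.
have h2 : Num.min (r / 2) s <= s by rewrite ge_min lexx orbT.
have bpz : box p r z.
  case: by_ => b1 b2; split.
    by have := ler_normD (z.1 - y.1) (y.1 - p.1); rewrite addrA subrK; lra.
  by have := ler_normD (z.2 - y.2) (y.2 - p.2); rewrite addrA subrK; lra.
have := (H z bpz).1 oz; have := Hs z (conj (le_trans bz1 h2) (le_trans bz2 h2)).
by rewrite ler_norml => /andP[]; lra.
Qed.

(* Averages over y + t (c + [0,1]^2), y near p, only see points of omega.  At a boundary point,
   c is a large multiple of an inner direction. *)
Definition pullable p := exists (r t0 : R) (c : plane), [/\ 0 < r, 0 < t0 &
  forall y (d : plane) (t : R), closure omega y -> box p r y -> 0 < t -> t <= t0 ->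
    0 <= d.1 <= 1 -> 0 <= d.2 <= 1 -> omega (y + t *: (c + d))].

Lemma pullable_in p : omega p -> pullable p.
Proof.
move=> op; have [r r0 H] := nbhs_boxP (open_nbhs_nbhs (conj oo op)).
exists (r / 2), (r / 2), 0; split; rewrite ?divr_gt0//.
move=> y d t _ [b1 b2] t0 tr /andP[d1 d1'] /andP[d2 d2']; apply: H; rewrite add0r.
have E1 : (y + t *: d).1 - p.1 = (y.1 - p.1) + t * d.1 by rewrite /= /GRing.scale/=; ring.
have E2 : (y + t *: d).2 - p.2 = (y.2 - p.2) + t * d.2 by rewrite /= /GRing.scale/=; ring.
split; rewrite ?E1 ?E2; apply: le_trans (ler_normD _ _) _;
    rewrite [`|t * _|]ger0_norm ?mulr_ge0 ?(ltW t0)//; nra.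
Qed.

Lemma norm_le_sub (x y e b : R) : `|x - y| <= e -> `|y| <= b -> `|x| <= e + b.
Proof. by move=> h1 h2; have := ler_normD (x - y) y; rewrite subrK; lra. Qed.

Lemma half_le_sum (x y a : R) : 0 <= y -> 0 < a -> a / 2 + x <= x + y + a.
Proof. by move=> y0 a0; lra. Qed.

Lemma half_le_sum' (x y a : R) : 0 <= x -> 0 < a -> a / 2 + y <= x + y + a.
Proof. by move=> y0 a0; lra. Qed.

Lemma neg_of_sub (x z : R) : x <= 0 -> z - x < 0 -> z < 0.
Proof. by move=> h1 h2; lra. Qed.

Lemma half_bounds (x a : R) : `|x - a| <= a / 2 -> a / 2 <= x /\ x <= 2 * a.
Proof. by rewrite ler_norml => /andP[h1 h2]; split; lra. Qed.

(** K a/2 = 2a + b + 1 exceeds the sum of the largest contributions of the two perturbations, 2a and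
    b. *)
Lemma pull_estimate (a b rj ri K di dj : R) : 0 < a -> a / 2 <= ri -> ri <= 2 * a -> `|rj| <= b ->
  `|di| <= 1 -> `|dj| <= 1 -> K = (2 * a + b + 1) / (a / 2) -> (- K + di) * ri + dj * rj < 0.
Proof.
move=> a0 h1 h2; rewrite !ler_norml => /andP[h3 h4] /andP[d0 d1] /andP[e0 e1] EK.
have EK' : K * (a / 2) = 2 * a + b + 1 by rewrite EK divfK// gt_eqF// divr_gt0.
have b0 : 0 <= b by lra.
have K0 : 0 <= K by rewrite EK !divr_ge0//; lra.
have k1 : K * (a / 2) <= K * ri by rewrite ler_wpM2l.
have k2 : di * ri <= 2 * a by nra.
have k3 : dj * rj <= b by nra.
lra.
Qed.

(** Along c + d the defining function decreases, at all points near [p], and it is at most 0 on the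
    closure of omega; [mvt_plane] then makes it negative at the displaced point. *)
Lemma pullable_bdry p : smooth_bdry omega -> bdry omega p -> pullable p.
Proof.
move=> sb bp; have [rho ch] := sb p bp; have [rp [r r0 Hr]] := chart_box bp ch.
have [srho [i ai] _] := ch.
pose a : R := `|pd i rho p|; have a0 : 0 < a by rewrite normr_gt0.
pose b : R := `|pd 0 rho p| + `|pd 1 rho p| + a.
have [r1 r10 H1] := cont_box p (smooth_cont (smooth_pd 0 srho))
    (divr_gt0 a0 (ltr0n _ 2) : 0 < a / 2).
have [r2 r20 H2] := cont_box p (smooth_cont (smooth_pd 1 srho))
    (divr_gt0 a0 (ltr0n _ 2) : 0 < a / 2).
pose K : R := (2 * a + b + 1) / (a / 2).
have b0 : 0 <= b by exact: (addr_ge0 (addr_ge0 (normr_ge0 _) (normr_ge0 _)) (ltW a0)).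
have K0 : 0 <= K by rewrite !divr_ge0 ?ler0n ?(ltW a0)//; lra.
pose s : R := Num.min r (Num.min r1 r2) / 2.
have m0 : 0 < Num.min r (Num.min r1 r2) by rewrite !lt_min r0 r10.
have s0 : 0 < s by rewrite divr_gt0.
have sr : 2 * s <= r by rewrite /s mulrC divfK// ge_min lexx.
have sr1 : 2 * s <= r1 by rewrite /s mulrC divfK// !ge_min lexx orbT.
have sr2 : 2 * s <= r2 by rewrite /s mulrC divfK// !ge_min lexx !orbT.
pose sg : R := Num.sg (pd i rho p).
have sg1 : `|sg| = 1 by rewrite normr_sg ai.
have sga : sg * pd i rho p = a by rewrite /a normrEsg.
(* The direction opposite to the nonzero partial derivative of [rho], so long that adding a vector
   of the unit square cannot reverse the sign of the increment of [rho]. *)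
pose c : plane := if i == 0 then (- (K * sg), 0) else (0, - (K * sg)).
exists s, (s / (K + 1)), c; split => //; first by rewrite divr_gt0// ltr_wpDl.
move=> y d t cy by_ t0 ts d1 d2.
have tK : t * (K + 1) <= s by rewrite -ler_pdivlMr// ltr_wpDl.
have N (e1 dd : R) : `|e1| <= K -> 0 <= dd <= 1 -> `|t * (e1 + dd)| <= s.
  move=> he /andP[hd hd']; rewrite normrM ger0_norm ?(ltW t0)//; apply: le_trans tK.
  rewrite ler_wpM2l ?(ltW t0)//; apply: le_trans (ler_normD _ _) _.
  by rewrite lerD// ger0_norm.
have Kn : `|- (K * sg)| <= K by rewrite normrN normrM sg1 mulr1 ger0_norm.
have c1 : `|c.1| <= K by rewrite /c; case: (i == 0) => //=; rewrite normr0.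
have c2 : `|c.2| <= K by rewrite /c; case: (i == 0) => //=; rewrite normr0.
have [by1 by2] := by_.
have E1 : (y + t *: (c + d)).1 = y.1 + t * (c.1 + d.1) by [].
have E2 : (y + t *: (c + d)).2 = y.2 + t * (c.2 + d.2) by [].
have bs : box p (2 * s) (y + t *: (c + d)).
  split; rewrite ?E1 ?E2.
    by rewrite addrAC; apply: le_trans (ler_normD _ _) _; have := N _ _ c1 d1; lra.
  by rewrite addrAC; apply: le_trans (ler_normD _ _) _; have := N _ _ c2 d2; lra.
apply/(Hr _ (box_le sr bs)).
have ry : rho y <= 0.
  apply: (rho_closure Hr srho r0 cy); apply: box_le by_.
  by rewrite ler_pdivlMr// mulrC.
have [e [e' [he he' E]]] := mvt_plane y (y + t *: (c + d)) (fun z => smooth_is_derive srho z 0)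
    (fun z => smooth_is_derive srho z 1).
rewrite E1 E2 !(addrC _ (- _)) !addKr in he he' E.
have {}he : `|e - y.1| <= s by rewrite addrC; exact: le_trans he (N _ _ c1 d1).
have {}he' : `|e' - y.2| <= s by rewrite addrC; exact: le_trans he' (N _ _ c2 d2).
have be : box p (2 * s) (e, y.2 + t * (c.2 + d.2)).
  split => /=; last by have := bs.2; rewrite E2.
  by have := ler_normD (e - y.1) (y.1 - p.1); rewrite addrA subrK; lra.
have be' : box p (2 * s) (y.1, e').
  split => /=; first lra.
  by have := ler_normD (e' - y.2) (y.2 - p.2); rewrite addrA subrK; lra.
have G0 := H1 _ (box_le sr1 be); have G1 := H2 _ (box_le sr2 be').
have a1 : `|pd 0 rho (e, y.2 + t * (c.2 + d.2))| <= b.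
  apply: le_trans (norm_le_sub G0 (lexx _)) _.
  exact: half_le_sum (normr_ge0 _) a0.
have a2 : `|pd 1 rho (y.1, e')| <= b.
  apply: le_trans (norm_le_sub G1 (lexx _)) _.
  exact: half_le_sum' (normr_ge0 _) a0.
have sgn (z : R) : `|z - pd i rho p| <= a / 2 -> a / 2 <= sg * z /\ sg * z <= 2 * a.
  move=> h; have : `|sg * z - a| <= a / 2.
    have -> : sg * z - a = sg * (z - pd i rho p) by rewrite mulrBr sga.
    by rewrite normrM sg1 mul1r.
  exact: half_bounds.
have sg2 : sg * sg = 1 by rewrite -expr2 -(real_normK (num_real sg)) sg1 expr1n.
apply: (neg_of_sub ry); rewrite addrC E (_ : _ + _ =
    t * ((c.1 + d.1) * pd 0 rho (e, y.2 + t * (c.2 + d.2)) + (c.2 + d.2) * pd 1 rho (y.1, e')));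
    last by ring.
rewrite pmulr_rlt0//.
have D1 : `|d.1| <= 1 by move: d1 => /andP[? ?]; rewrite ger0_norm.
have D2 : `|d.2| <= 1 by move: d2 => /andP[? ?]; rewrite ger0_norm.
have flip (z dd : R) : (- (K * sg) + dd) * z = (- K + sg * dd) * (sg * z).
  rewrite (_ : (- K + sg * dd) * (sg * z) = (- (K * sg) + sg * sg * dd) * z); last by ring.
  by rewrite sg2 mul1r.
have sd (dd : R) : `|dd| <= 1 -> `|sg * dd| <= 1 by rewrite normrM sg1 mul1r.
move: G0 G1 a1 a2; move: (pd 0 rho _) (pd 1 rho (_, e')) => D0 D1' G0 G1 a1 a2.
rewrite /c; case: (ord2P i) => ei; rewrite ei /= in sga sgn *.
  have [h1 h2] := sgn _ G0; rewrite flip add0r.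
  exact: (pull_estimate a0 h1 h2 a2 (sd _ D1) D2 (erefl K)).
have [h1 h2] := sgn _ G1; rewrite flip add0r addrC.
exact: (pull_estimate a0 h1 h2 a1 (sd _ D2) D1 (erefl K)).
Qed.

Lemma pullable_closure p : smooth_bdry omega -> closure omega p -> pullable p.
Proof.
by move=> sb /closure_cases[|]; [exact: pullable_in | exact: pullable_bdry].
Qed.

Lemma sum2 (F : 'I_2 -> R) : \sum_k F k = F 0 + F 1.
Proof.
rewrite !big_ord_recl big_ord0 addr0; congr (_ + F _).
exact: val_inj.
Qed.

Section Tangent.
Variables (p : plane) (i : 'I_2) (sg : R).
Hypothesis sg1 : `|sg| = 1.

Definition other : 'I_2 := if i == 0 then 1 else 0.

(** Coordinates centred at [p]: [t] runs along the [i]-th axis, oriented by [sg] so that the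
    defining function increases with [t], and [s] along the other axis. *)
Definition axes (s t : R) : plane := (sg * t) *: basis R i + (s *: basis R other + p).

Let sg2 : sg * sg = 1.
Proof. by rewrite -expr2 -(real_normK (num_real sg)) sg1 expr1n. Qed.

Lemma axes_coord s t : if i == 0 then axes s t = (sg * t + p.1, s + p.2)
  else axes s t = (s + p.1, sg * t + p.2).
Proof.
rewrite /axes /other; case: (ord2P i) => -> /=; case: p => p1 p2;
  by apply/pair_equal_spec; split; rewrite /= /GRing.scale/=; ring.
Qed.

Lemma axes00 : axes 0 0 = p.
Proof. by rewrite /axes mulr0 !scale0r !add0r. Qed.

Lemma axes_box s t s' t' (r : R) : `|s' - s| <= r -> `|t' - t| <= r ->
    box (axes s t) r (axes s' t').
Proof.
move=> hs ht; have := axes_coord s t; have := axes_coord s' t'.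
have sgt : `|sg * t' - sg * t| <= r by rewrite -mulrBr normrM sg1 mul1r.
by case: (i == 0) => -> ->; split => /=; rewrite opprD addrACA subrr addr0.
Qed.

Lemma axes_boxp s t (r : R) : `|s| <= r -> `|t| <= r -> box p r (axes s t).
Proof. by move=> hs ht; rewrite -{1}axes00; apply: axes_box; rewrite subr0. Qed.

Lemma is_derive_axes_t f s t (a : R) : is_derive (axes s t) (basis R i) f a ->
  is_derive t 1 (fun t : R => f (axes s t)) (sg * a).
Proof.
move=> h; have := @is_derive_comp_affine R (fun t : R => f
    (t *: basis R i + (s *: basis R other + p))) a sg 0 t.
rewrite (_ : (fun y : R => f ((sg * y + 0) *: basis R i + (s *: basis R other + p))) =
    (fun t : R => f (axes s t))); last by apply/funext => y; rewrite addr0.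
by apply; apply: is_derive_line; rewrite addr0.
Qed.

Lemma is_derive_axes_s f s t (a : R) : is_derive (axes s t) (basis R other) f a ->
  is_derive s 1 (fun s => f (axes s t)) a.
Proof.
rewrite /axes addrCA => h; have := is_derive_line h.
by rewrite (_ : (fun s => _) = (fun s => f ((sg * t) *: basis R i + (s *: basis R other + p))))//;
  apply/funext => y; rewrite addrCA.
Qed.

Lemma closure_segment s (a b : R) : a < b -> (forall t, a <= t < b -> omega (axes s t)) ->
  closure omega (axes s b).
Proof.
move=> ab H B /nbhs_boxP[r r0 rB].
have m0 : 0 < Num.min r (b - a) by rewrite lt_min r0 subr_gt0.
have mr : Num.min r (b - a) <= r by rewrite ge_min lexx.
have mb : Num.min r (b - a) <= b - a by rewrite ge_min lexx orbT.
exists (axes s (b - Num.min r (b - a))); split.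
  by apply: H; apply/andP; split; lra.
apply: rB; apply: axes_box; first by rewrite subrr normr0 ltW.
by rewrite addrAC subrr sub0r normrN ger0_norm// ltW.
Qed.

Lemma C0bar_segment f s (a b : R) : C0bar omega f ->
  (forall t, a <= t <= b -> closure omega (axes s t)) ->
  {within `[a, b], continuous (fun t => f (axes s t))}.
Proof.
move=> cf H; apply/subspace_continuousP => t; rewrite /= in_itv /= => tab.
apply/cvgrPdist_le => e e0; have [r r0 Hr] := C0bar_near cf (H t tab) e0.
apply: filterS (nbhsx_ballx t r r0 : nbhs t _) => v; rewrite -ball_normE /= => ur uab.
rewrite distrC; apply: Hr; last by apply: H; move: uab; rewrite in_itv.
by apply: axes_box; [rewrite subrr normr0 ltW|rewrite distrC ltW].
Qed.

End Tangent.

(** (al, be) stands for the gradient of the function, (a, b) for that of the defining function; the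
    [x]'s and [y]'s are their values at mean points. If these coincided with the values at [p], the
    two equations would be sg al t + be s = 0 and sg a t + b s = 0, and eliminating [t] would give a
    be = b al. The deviations, each at most [e], are carried through this elimination. *)
Lemma tangent_algebra (a b al be x1 x2 x3 y1 y2 s t K e sg : R) : 0 < s -> 0 <= K -> 0 <= e ->
  `|sg| = 1 -> `|t| <= K * s -> `|x1 - al| <= e -> `|x2 - be| <= e -> `|x3 - al| <= e ->
  `|y1 - a| <= e -> `|y2 - b| <= e ->
  sg * x1 * (t + K * s) + x2 * s - sg * x3 * (K * s) = 0 -> sg * y1 * t + y2 * s = 0 ->
  `|a * be - b * al| <= e * (`|a| * (3 * K + 1) + `|al| * (K + 1)).
Proof.
move=> s0 K0 e0 sg1 tK h1 h2 h3 h4 h5 E1 E2; rewrite -(ler_pM2l s0).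
have -> : s * `|a * be - b * al| = `|s * (a * be - b * al)| by rewrite normrM (ger0_norm (ltW s0)).
have -> : s * (a * be - b * al) = al * (sg * (y1 - a) * t + (y2 - b) * s)
   - a * (sg * (x1 - al) * (t + K * s) + (x2 - be) * s - sg * (x3 - al) * (K * s)).
  have -> : sg * (x1 - al) * (t + K * s) + (x2 - be) * s - sg * (x3 - al) * (K * s) =
    (sg * x1 * (t + K * s) + x2 * s - sg * x3 * (K * s)) - (sg * al * t + be * s) by ring.
  have -> : sg * (y1 - a) * t + (y2 - b) * s = (sg * y1 * t + y2 * s) - (sg * a * t + b * s)
      by ring.
  by rewrite E1 E2; ring.
have Ks : 0 <= K * s by rewrite mulr_ge0// ltW.
have P (x y c : R) : `|x| <= e -> `|y| <= c -> `|sg * x * y| <= e * c.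
  by move=> hx hy; rewrite !normrM sg1 mul1r ler_pM.
have Q (x : R) : `|x| <= e -> `|x * s| <= e * s.
  by move=> hx; rewrite normrM (ger0_norm (ltW s0)) ler_wpM2r// ltW.
have tK2 : `|t + K * s| <= K * s + K * s.
  by apply: le_trans (ler_normD _ _) _; rewrite lerD// ger0_norm.
have A1 : `|sg * (y1 - a) * t + (y2 - b) * s| <= e * (K * s) + e * s.
  by apply: le_trans (ler_normD _ _) _; apply: lerD; [exact: P | exact: Q].
have A2 : `|sg * (x1 - al) * (t + K * s) + (x2 - be) * s - sg * (x3 - al) * (K * s)| <=
    e * (K * s + K * s) + e * s + e * (K * s).
  apply: le_trans (ler_normB _ _) _; apply: lerD; last by apply: P => //; rewrite ger0_norm.
  by apply: le_trans (ler_normD _ _) _; apply: lerD; [exact: P | exact: Q].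
apply: le_trans (ler_normB _ _) _; rewrite !(normrM al) !(normrM a).
apply: le_trans (lerD (ler_wpM2l (normr_ge0 _) A1) (ler_wpM2l (normr_ge0 _) A2)) _.
by rewrite le_eqVlt; apply/orP; left; apply/eqP; ring.
Qed.

Lemma is_derive_cont (f : R -> R) (t d : R) : is_derive t 1 f d -> {for t, continuous f}.
Proof.
by move=> h; apply: differentiable_continuous; apply/derivable1_diffP; exact: is_derive_derivable h.
Qed.

Lemma eq_le_half (z e : R) : e <= z / 2 -> z / 2 <= z - e.
Proof. by move=> h; lra. Qed.

Section FlatCoordinates.
Variables (p : plane) (i : 'I_2) (rho : plane -> R) (sg a b e m s K : R).
Hypotheses (srho : smooth rho) (rp : rho p = 0) (sg1 : `|sg| = 1) (a0 : 0 < sg * a)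
  (eA : e <= (sg * a) / 2) (s0 : 0 < s) (K0 : 0 < K)
  (KA : K * (sg * a) = 2 * (`|b| + sg * a) + sg * a) (Tm : K * s <= m) (sm : s <= m).
Hypothesis H1 : forall y, box p m y -> `|pd i rho y - a| <= e.
Hypothesis H2 : forall y, box p m y -> `|pd (other i) rho y - b| <= e.

Local Notation P := (axes p i sg).
Local Notation T := (K * s).
Let T0 : 0 < T. Proof. by rewrite mulr_gt0. Qed.

Lemma axes_in s' t : `|s'| <= s -> `|t| <= T -> box p m (P s' t).
Proof. by move=> h1 h2; apply: axes_boxp => //; [exact: le_trans sm|exact: le_trans Tm]. Qed.

Lemma axes_mvt_t s' t t' : t < t' -> exists2 c : R, t < c < t' &
  rho (P s' t') - rho (P s' t) = sg * pd i rho (P s' c) * (t' - t).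
Proof.
move=> tt.
have D (c : R) := is_derive_axes_t (smooth_is_derive srho (P s' c) i).
have [c] := MVT tt (fun c _ => D c) (continuous_subspaceT (fun c => is_derive_cont (D c))).
by rewrite in_itv; exists c.
Qed.

Lemma axes_mvt_s t s' s'' : s' < s'' -> exists2 c : R, s' < c < s'' &
  rho (P s'' t) - rho (P s' t) = pd (other i) rho (P c t) * (s'' - s').
Proof.
move=> tt.
have D (c : R) := is_derive_axes_s (smooth_is_derive srho (P c t) (other i)).
have [c] := MVT tt (fun c _ => D c) (continuous_subspaceT (fun c => is_derive_cont (D c))).
by rewrite in_itv; exists c.
Qed.

Lemma axes_slope y : box p m y -> sg * a / 2 <= sg * pd i rho y.
Proof.
move=> /H1 h; have : `|sg * pd i rho y - sg * a| <= e by rewrite -mulrBr normrM sg1 mul1r.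
rewrite ler_norml => /andP[h1 _]; apply: le_trans (eq_le_half eA) _.
by move: h1; rewrite lerBrDl addrC.
Qed.

Lemma axes_incr s' t t' : `|s'| <= s -> - T <= t -> t < t' -> t' <= T ->
  rho (P s' t) + (t' - t) * (sg * a / 2) <= rho (P s' t').
Proof.
move=> hs h1 h2 h3; have [c /andP[c1 c2] E] := axes_mvt_t s' h2.
have cT : `|c| <= T by rewrite ler_norml (le_trans h1 (ltW c1)) (le_trans (ltW c2) h3).
rewrite -lerBrDl E mulrC ler_wpM2r ?subr_ge0 ?(ltW h2)//.
exact: axes_slope (axes_in hs cT).
Qed.

Lemma axes_side s' : 0 <= s' <= s -> `|rho (P s' 0)| <= s * (`|b| + sg * a).
Proof.
move=> /andP[]; rewrite le_eqVlt => /orP[/eqP <- _|h1 h2].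
  by rewrite axes00 rp normr0 mulr_ge0 ?addr_ge0 ?(ltW s0) ?(ltW a0).
have [c /andP[c1 c2]] := axes_mvt_s 0 h1; rewrite axes00 rp !subr0 => ->.
have cs : `|c| <= s by rewrite ger0_norm ?(ltW c1)// (le_trans (ltW c2)).
have h := H2 (axes_in cs (_ : `|0| <= T)); rewrite normr0 in h.
have h3 := norm_le_sub (h (ltW T0)) (lexx _).
rewrite normrM (ger0_norm (ltW h1)) mulrC; apply: ler_pM => //; first exact: ltW.
apply: le_trans h3 _; rewrite addrC lerD2l; apply: le_trans eA _.
by rewrite ler_pdivrMr// ler_peMr ?(ltW a0)// ler1n.
Qed.

(** This is what [K] is made for: over the height K s, at slope at least sg a/2, the defining
    function changes by more than its largest modulus on the segment t = 0. It is therefore negative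
    at depth K s and positive at that height. *)
Lemma T_large : s * (`|b| + sg * a) < T * (sg * a / 2).
Proof.
rewrite (_ : K * s * (sg * a / 2) = s * (K * (sg * a) / 2)); last by ring.
by rewrite ltr_pM2l// KA ltr_pdivlMr// [X in X < _]mulrC ltrDl.
Qed.

Lemma axes_low s' : 0 <= s' <= s -> rho (P s' (- T)) < 0.
Proof.
move=> hs; have /andP[h1 h2] := hs; have as' : `|s'| <= s by rewrite ger0_norm.
have T1 : - T < 0 by rewrite oppr_lt0.
have := axes_incr as' (lexx _) T1 (ltW T0); have := axes_side hs; have := T_large.
rewrite sub0r opprK ler_norml; move: (T * _) (s * _) (rho _) (rho _) => ? ? ? ? ? /andP[]; lra.
Qed.

Lemma axes_high : 0 < rho (P s T).
Proof.
have as' : `|s| <= s by rewrite ger0_norm// ltW.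
have T1 : - T <= 0 by rewrite oppr_le0 ltW.
have ss : 0 <= s <= s by rewrite lexx ltW.
have := axes_incr as' T1 T0 (lexx _); have := axes_side ss; have := T_large.
rewrite subr0 ler_norml; move: (T * _) (s * _) (rho _) (rho _) => ? ? ? ? ? /andP[]; lra.
Qed.

Lemma axes_cross : exists2 t : R, - T < t < T & rho (P s t) = 0.
Proof.
have cR : {within `[(- T), T], continuous (fun t : R => rho (P s t))}.
  apply: continuous_subspaceT => t.
  exact: is_derive_cont (is_derive_axes_t (smooth_is_derive srho (P s t) i)).
have v1 : rho (P s (- T)) < 0 by apply: axes_low; rewrite lexx ltW.
have v2 := axes_high.
have TT : - T <= T by rewrite ge0_cp// ltW.
have [|c] := @IVT R (fun t : R => rho (P s t)) (- T) T 0 TT cR.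
  by rewrite ge_min le_max (ltW v1) (ltW v2) orbT.
rewrite in_itv /= => /andP[c1 c2] E; exists c => //; rewrite !lt_neqAle c1 c2 !andbT.
by apply/andP; split; apply/eqP => h; [move: v1; rewrite h E ltxx|move: v2; rewrite -h E ltxx].
Qed.

Lemma axes_below s' t t' : `|s'| <= s -> - T <= t -> t < t' -> t' <= T -> rho (P s' t') = 0 ->
  rho (P s' t) < 0.
Proof.
move=> h1 h2 h3 h4 E; have := axes_incr h1 h2 h3 h4; rewrite E => h.
have h5 : 0 < (t' - t) * (sg * a / 2) by rewrite mulr_gt0 ?subr_gt0 ?divr_gt0.
by move: h h5; move: (_ * _) (rho _) => ? ?; lra.
Qed.

End FlatCoordinates.

(* u vanishes at both ends of the path that leaves the boundary point axes s ts along the i-th axis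
   into omega, crosses at depth K s, and comes back to p; the mean value theorem on its three legs
   bounds the tangential derivative of u. *)
Lemma tangential_estimate u rho p i (gi gj : plane -> R) (sg a b e m s K : R) : C0bar omega u ->
  (forall q, bdry omega q -> u q = 0) -> bdry omega p ->
  C0bar omega gi -> (forall y, omega y -> is_derive y (basis R i) u (gi y)) ->
  (forall y, omega y -> is_derive y (basis R (other i)) u (gj y)) ->
  smooth rho -> rho p = 0 -> `|sg| = 1 -> 0 < sg * a -> e <= (sg * a) / 2 -> 0 < s -> 0 < K ->
  0 <= e -> K * (sg * a) = 2 * (`|b| + sg * a) + sg * a -> K * s <= m -> s <= m ->
  (forall y, box p m y -> omega y <-> rho y < 0) ->
  (forall y, box p m y -> `|pd i rho y - a| <= e) ->
  (forall y, box p m y -> `|pd (other i) rho y - b| <= e) ->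
  (forall y, box p m y -> closure omega y -> `|gi y - gi p| <= e) ->
  (forall y, box p m y -> closure omega y -> `|gj y - gj p| <= e) ->
  `|a * gj p - b * gi p| <= e * (`|a| * (3 * K + 1) + `|gi p| * (K + 1)).
Proof.
move=> cu u0 bp cgi dgi dgj srho rp sg1 a0 eA s0 K0 e0 KA Tm sm Hr H1 H2 H3 H4.
have T0 : 0 < K * s by rewrite mulr_gt0.
have NT0 : - (K * s) < 0 by rewrite oppr_lt0.
have NT : `|- (K * s)| <= K * s by rewrite normrN ger0_norm// ltW.
have T00 : `|0 : R| <= K * s by rewrite normr0 ltW.
have s00 : `|0 : R| <= s by rewrite normr0 ltW.
have ss : `|s| <= s by rewrite ger0_norm// ltW.
have bP := axes_in p i sg1 Tm sm.
have [t /andP[t1 t2] rt] := axes_cross srho rp sg1 a0 eA s0 K0 KA Tm sm H1 H2.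
have tT : `|t| <= K * s by rewrite ler_norml !ltW.
have below (s' t0 : R) : `|s'| <= s -> - (K * s) < t0 <= K * s -> rho (axes p i sg s' t0) = 0 ->
    forall v : R, - (K * s) <= v < t0 -> omega (axes p i sg s' v).
  move=> h1 /andP[h2 h3] E v /andP[v1 v2]; apply/Hr.
    by apply: bP => //; rewrite ler_norml v1 ltW// (lt_le_trans v2).
  have := axes_below srho sg1 a0 eA Tm sm H1 h1 v1 v2 h3 E. by [].
have bq (s' t0 : R) : `|s'| <= s -> - (K * s) < t0 <= K * s -> rho (axes p i sg s' t0) = 0 ->
    bdry omega (axes p i sg s' t0).
  move=> h1 h2 E; have /andP[h3 h4] := h2; have B := below _ _ h1 h2 E.
  have := closure_segment sg1 h3 B => /closure_cases[|//] /Hr.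
  have t0T : `|t0| <= K * s by rewrite ler_norml ltW.
  by move=> /(_ (bP _ _ h1 t0T)); rewrite E ltxx.
(* A leg along the [i]-th axis from depth K s up to the boundary, where [u] vanishes. *)
have line (s' t0 : R) : `|s'| <= s -> - (K * s) < t0 <= K * s -> rho (axes p i sg s' t0) = 0 ->
    exists2 x : R, `|x - gi p| <= e & u (axes p i sg s' (- (K * s))) = - (sg * x * (t0 + K * s)).
  move=> h1 h2 E; have /andP[h3 h4] := h2; have B := below _ _ h1 h2 E.
  have c1 : {within `[- (K * s), t0], continuous (fun v : R => u (axes p i sg s' v))}.
    apply: (C0bar_segment sg1 cu) => v /andP[v1].
    rewrite le_eqVlt => /orP[/eqP ->|v2]; first exact: (bq _ _ h1 h2 E).1.
    by apply: closure_in; apply: B; rewrite v1.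
  have D (v : R) : v \in `](- (K * s)), t0[ -> is_derive v 1 (fun v : R => u (axes p i sg s' v))
      (sg * gi (axes p i sg s' v)).
    rewrite in_itv /= => /andP[v1 v2]; apply: is_derive_axes_t; apply: dgi.
    by apply: B; rewrite v2 ltW.
  have [v] := MVT h3 D c1; rewrite in_itv /= => /andP[v1 v2] Ev.
  have vT : `|v| <= K * s by rewrite ler_norml !ltW// (lt_le_trans v2).
  exists (gi (axes p i sg s' v)).
    by apply: H3; [exact: bP|apply: closure_in; apply: B; rewrite v2 ltW].
  by rewrite u0 ?sub0r ?opprK in Ev; [rewrite -Ev opprK|exact: bq].
have tt : - (K * s) < t <= K * s by rewrite t1 ltW.
have zz : - (K * s) < 0 <= K * s by rewrite NT0 ltW.
have [x1 hx1 Ex1] := line s t ss tt rt.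
have [x3 hx3 Ex3] : exists2 x : R, `|x - gi p| <= e & u (axes p i sg 0 (- (K * s))) =
    - (sg * x * (0 + K * s)).
  by apply: line => //; rewrite axes00.
have low (s' : R) : 0 <= s' <= s -> omega (axes p i sg s' (- (K * s))).
  move=> h; have /andP[h1 h2] := h; apply/Hr.
    by apply: bP => //; rewrite ger0_norm.
  exact: axes_low srho rp sg1 a0 eA s0 K0 KA Tm sm H1 H2 _ h.
have D2 (v : R) : 0 <= v <= s -> is_derive v 1 (fun v : R => u (axes p i sg v (- (K * s))))
    (gj (axes p i sg v (- (K * s)))).
  by move=> h; apply: is_derive_axes_s; apply: dgj; exact: low.
have [x2 hx2 Ex2] : exists2 x : R, `|x - gj p| <= e &
    u (axes p i sg s (- (K * s))) - u (axes p i sg 0 (- (K * s))) = x * s.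
  have [||v] := @MVT R (fun v : R => u (axes p i sg v (- (K * s))))
      (fun v : R => gj (axes p i sg v (- (K * s)))) 0 s s0.
  - by move=> v; rewrite in_itv /= => /andP[v1 v2]; apply: D2; rewrite !ltW.
  - apply: derivable_within_continuous => v; rewrite in_itv /= => hv.
    exact: is_derive_derivable (D2 v hv).
  rewrite in_itv /= subr0 => /andP[v1 v2] Ev; exists (gj (axes p i sg v (- (K * s)))) => //.
  apply: H4; last by apply: closure_in; apply: low; rewrite !ltW.
  by apply: bP => //; rewrite ger0_norm ltW.
have [y2 hy2 Ey2] : exists2 x : R, `|x - b| <= e & rho (axes p i sg s 0) = x * s.
  have [v /andP[v1 v2]] := axes_mvt_s p i sg srho 0 s0.
  rewrite axes00 rp !subr0 => E; exists (pd (other i) rho (axes p i sg v 0)) => //.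
  by apply: H2; apply: bP => //; rewrite ger0_norm ltW.
have [y1 hy1 Ey1] : exists2 x : R, `|x - a| <= e & rho (axes p i sg s 0) = - (sg * x * t).
  have [lt0|gt0|t0] := ltgtP t 0.
  - have [v /andP[v1 v2] E] := axes_mvt_t p i sg srho s lt0.
    exists (pd i rho (axes p i sg s v)); last by move: E; rewrite rt sub0r subr0 mulrN.
    apply: H1; apply: bP => //; rewrite ler_norml (le_trans (ltW t1) (ltW v1)).
    by rewrite (le_trans (ltW v2) (ltW T0)).
  - have [v /andP[v1 v2] E] := axes_mvt_t p i sg srho s gt0.
    exists (pd i rho (axes p i sg s v)); last by rewrite rt sub0r subr0 in E; rewrite -E opprK.
    apply: H1; apply: bP => //; rewrite ler_norml (le_trans (ltW NT0) (ltW v1)).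
    by rewrite (le_trans (ltW v2) (ltW t2)).
  (* Here the crossing point is the point at height 0 itself: both sides are 0 whatever the
     slope. *)
  - by exists a; [rewrite subrr normr0|rewrite t0 mulr0 oppr0 -[in LHS]t0 rt].
apply: (tangent_algebra (sg := sg) (t := t) s0 (ltW K0) e0 sg1 tT hx1 hx2 hx3 hy1 hy2).
  by rewrite -Ex2 Ex1 Ex3 add0r; ring.
by rewrite -Ey2 Ey1; ring.
Qed.

(** The gradients of [u] and of the defining function are parallel, that is, the tangential
    derivative of [u] vanishes. [K] depends on the gradient of [rho] at [p] only, so the bound of
    [tangential_estimate] tends to 0 with [e]. *)
Lemma tangential_eq u rho p i (gi gj : plane -> R) : C0bar omega u ->
    (forall q, bdry omega q -> u q = 0) ->
  bdry omega p -> bdry_chart omega p rho -> pd i rho p != 0 ->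
  C0bar omega gi -> (forall y, omega y -> is_derive y (basis R i) u (gi y)) ->
  C0bar omega gj -> (forall y, omega y -> is_derive y (basis R (other i)) u (gj y)) ->
  pd i rho p * gj p = pd (other i) rho p * gi p.
Proof.
move=> cu u0 bp ch ai cgi dgi cgj dgj.
have [rp [r r0 Hr]] := chart_box bp ch; have [srho _ _] := ch.
pose sg : R := Num.sg (pd i rho p).
have sg1 : `|sg| = 1 by rewrite normr_sg ai.
pose a : R := pd i rho p; pose b : R := pd (other i) rho p.
have A0 : 0 < sg * a by rewrite -normrEsg normr_gt0.
pose K : R := 2 * (`|b| + sg * a) / (sg * a) + 1.
have K0 : 0 < K.
  by rewrite ltr_wpDl// divr_ge0 ?(ltW A0)// mulr_ge0// addr_ge0// ltW.
have KA : K * (sg * a) = 2 * (`|b| + sg * a) + sg * a by rewrite mulrDl mul1r divfK// gt_eqF.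
suff main (e : R) : 0 < e -> e <= sg * a / 2 ->
    `|a * gj p - b * gi p| <= e * (`|a| * (3 * K + 1) + `|gi p| * (K + 1)).
  apply/eqP; rewrite -subr_eq0 -normr_le0.
  set C : R := `|a| * (3 * K + 1) + `|gi p| * (K + 1) in main.
  have C0 : 0 < C.
    apply: ltr_pwDl; first by rewrite mulr_gt0 ?normr_gt0// ltr_wpDl// mulr_ge0// ltW.
    by rewrite mulr_ge0// addr_ge0// ltW.
  apply/ler_addgt0Pl => d d0; rewrite addr0.
  have e0 : 0 < Num.min (sg * a / 2) (d / C) by rewrite lt_min !divr_gt0.
  apply: le_trans (main _ e0 _) _; first by rewrite ge_min lexx.
  by rewrite -ler_pdivlMr// ge_min lexx orbT.
move=> e0 eA.
have [r1 r10 H1] := cont_box p (smooth_cont (smooth_pd i srho)) e0.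
have [r2 r20 H2] := cont_box p (smooth_cont (smooth_pd (other i) srho)) e0.
have [r3 r30 H3] := C0bar_near cgi bp.1 e0.
have [r4 r40 H4] := C0bar_near cgj bp.1 e0.
pose m : R := Num.min r (Num.min (Num.min r1 r2) (Num.min r3 r4)).
have m0 : 0 < m by rewrite !lt_min r0 r10 r20 r30 r40.
have mr : m <= r by rewrite ge_min lexx.
have mr1 : m <= r1 by rewrite !ge_min lexx !orbT.
have mr2 : m <= r2 by rewrite !ge_min lexx !orbT.
have mr3 : m <= r3 by rewrite !ge_min lexx !orbT.
have mr4 : m <= r4 by rewrite !ge_min lexx !orbT.
have K1 : 0 < K + 1 by rewrite addr_gt0.
have s0 : 0 < m / (K + 1) by rewrite divr_gt0.
have sK : K * (m / (K + 1)) + m / (K + 1) = m.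
  by rewrite -{2}[m / (K + 1)]mul1r -mulrDl mulrC divfK// gt_eqF.
apply: (tangential_estimate (rho := rho) (sg := sg) (m := m) (s := m / (K + 1)) cu u0 bp cgi dgi
    dgj) => //.
- exact: ltW.
- by rewrite -[X in _ <= X]sK lerDl ltW.
- by rewrite -[X in _ <= X]sK lerDr mulr_ge0// ltW.
- by move=> y /(box_le mr) /Hr.
- by move=> y /(box_le mr1) /H1.
- by move=> y /(box_le mr2) /H2.
- by move=> y /(box_le mr3) /H3.
- by move=> y /(box_le mr4) /H4.
Qed.

Lemma within_near_subset p : within omega (nbhs p) --> within (closure omega) (nbhs p).
Proof.
move=> S h; have {}h : \forall y \near nbhs p, closure omega y -> S y by exact: h.
suff : \forall y \near nbhs p, omega y -> S y by [].
by apply: filterS h => y h oy; apply: h; exact: closure_in.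
Qed.

(** The continuous extensions of the partial derivatives identify the limit that defines the normal
    derivative; limits along omega are unique since [p] is in its closure. *)
Lemma dnormal0_bdry u p rho (g : 'I_2 -> plane -> R) : dnormal0 omega u -> bdry omega p ->
    bdry_chart omega p rho ->
  (forall k, C0bar omega (g k)) -> (forall k y, omega y -> pd k u y = g k y) ->
  pd 0 rho p * g 0 p + pd 1 rho p * g 1 p = 0.
Proof.
move=> dn bp ch cg dg.
pose N : R := Num.sqrt (\sum_j pd j rho p ^+ 2).
have N0 : 0 < N.
  rewrite sqrtr_gt0 sum2 lt_neqAle addr_ge0 ?sqr_ge0// andbT eq_sym paddr_eq0 ?sqr_ge0//.
  rewrite !sqrf_eq0; apply/negP => /andP[/eqP e0 /eqP e1].
  by have [_ [k +] _] := ch; case: (ord2P k) => ->; rewrite ?e0 ?e1 eqxx.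
have F : ProperFilter (within omega (nbhs p)).
  split; last exact: within_filter.
  by move=> h; have [y [oy ny]] := bp.1 _ h; exact: ny.
have on : outer_normal omega p (fun k => pd k rho p / N) by exists rho.
have := dn p _ bp on.
have G k : g k y @[y --> within omega (nbhs p)] --> g k p.
  have /subspace_continuousP /(_ p bp.1) := cg k.
  apply: cvg_trans; apply: cvg_app.
  have W := @within_near_subset p; exact W.
have : (\sum_i (pd i rho p / N) * pd i u y) @[y --> within omega (nbhs p)] -->
    \sum_i (pd i rho p / N) * g i p.
  rewrite sum2.
  have C := cvgD (cvgM (cvg_cst (pd 0 rho p / N)) (G 0)) (cvgM (cvg_cst (pd 1 rho p / N)) (G 1)).
  have FF := @filter_filter _ _ F; have {}C := C FF FF FF FF FF.
  apply: cvg_trans C; apply: near_eq_cvg.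
  by rewrite near_withinE; near=> y => oy; rewrite sum2 !dg.
move=> c1 c2.
have E : \sum_i pd i rho p / N * g i p = 0.
  exact: (@cvg_unique _ (@Rhausdorff R) _ (fmap_proper_filter _ F) _ _ c1 c2).
suff : (pd 0 rho p * g 0 p + pd 1 rho p * g 1 p) / N = 0.
  by move=> /eqP; rewrite mulf_eq0 invr_eq0 (gt_eqF N0) orbF => /eqP.
by rewrite -E sum2; ring.
Unshelve. all: by end_near. Qed.

(** The boundary gradient solves two linear equations, normal and tangential, whose determinant is
    up to sign the squared norm of the gradient of the defining function. *)
Lemma gradient_bdry u (g : 'I_2 -> plane -> R) p : smooth_bdry omega -> C0bar omega u ->
    (forall q, bdry omega q -> u q = 0) ->
  dnormal0 omega u -> (forall k, C0bar omega (g k)) ->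
  (forall k y, omega y -> is_derive y (basis R k) u (g k y)) ->
  bdry omega p -> forall k, g k p = 0.
Proof.
move=> sb cu u0 dn cg dg bp; have [rho ch] := sb p bp.
have [_ [i ai] _] := ch.
have N : pd 0 rho p * g 0 p + pd 1 rho p * g 1 p = 0.
  by apply: (dnormal0_bdry dn bp ch cg) => k y oy; exact: is_deriveE (dg k y oy).
have T := tangential_eq cu u0 bp ch ai (cg i) (dg i) (cg (other i)) (dg (other i)).
have alg (al be x y : R) : al != 0 -> al * x + be * y = 0 -> al * y = be * x -> x = 0 /\ y = 0.
  move=> al0 E1 E2.
  have x0 : x = 0.
    have : (al ^+ 2 + be ^+ 2) * x = 0.
      rewrite (_ : _ * x = al * (al * x + be * y) - be * (al * y - be * x)); last by ring.
      by rewrite E1 E2 subrr !mulr0 subrr.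
    move=> /eqP; rewrite mulf_eq0 => /orP[/eqP h|/eqP //].
    by move: h => /eqP; rewrite paddr_eq0 ?sqr_ge0// !sqrf_eq0 (negPf al0).
  split=> //; move: E2; rewrite x0 mulr0 => /eqP; rewrite mulf_eq0 (negPf al0) => /eqP.
  exact.
move: T N ai; rewrite /other; case: (ord2P i) => -> /=.
  by move=> T N ai k; have [h1 h2] := alg _ _ _ _ ai N T; case: (ord2P k) => ->.
by rewrite addrC => T N ai k; have [h1 h2] := alg _ _ _ _ ai N T; case: (ord2P k) => ->.
Qed.

End Boundary.

(** * Green's formula for functions with vanishing Cauchy data *)

Section CompactInduction.
Variable R : realType.
Local Notation plane := (R * R)%type.

(** The sets whose complement in [K] satisfies [P] form a filter. If [P K] failed, this filter would
    be proper and cluster at a point of [K], contradicting the local hypothesis there. *)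
Lemma compact_induction (K : set plane) (P : set plane -> Prop) : P set0 ->
  (forall A B, A `<=` B -> P B -> P A) -> (forall A B, P A -> P B -> P (A `|` B)) ->
  (forall p, K p -> exists2 r : R, 0 < r & P (box p r)) -> compact K -> P K.
Proof.
move=> P0 Ps PU loc cK; apply: contrapT => nPK.
pose F : set_system plane := [set A | P (K `\` A)].
have FF : Filter F.
  split.
  - by rewrite /F /= setDT.
  - move=> A B FA FB; rewrite /F /=; apply: Ps (PU _ _ FA FB) => x [Kx nAB].
    by have [Ax|nA] := pselect (A x); [right|left]; split => // Bx; exact: nAB.
  - by move=> A B AB; apply: Ps => x [Kx nB]; split => // /AB.
have PF : ProperFilter F by apply: Build_ProperFilter_ex => A FA; apply: contrapT => nA;
  apply: nPK; apply: Ps FA => x Kx; split => // Ax; apply: nA; exists x.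
have [|p [Kp clp]] := cK F PF; first by rewrite /F /= setDv.
have [r r0 Pr] := loc p Kp.
have Fc : F (~` box p r) by apply: Ps Pr => x [_ nn]; exact: contrapT.
by have [x [nb bx]] := clp _ _ Fc (nbhs_box p r0).
Qed.

Lemma compact_closure (omega : set plane) (M : R) : omega `<=` box 0 M -> compact (closure omega).
Proof.
move=> oM; apply: (@subclosed_compact _ _ (box 0 M)); [exact: closed_closure|exact: compact_box|].
have cb : closed (box (0 : plane) M) by apply: compact_closed;
    [exact: norm_hausdorff|exact: compact_box].
by rewrite [X in _ `<=` X](closure_id _).1//; exact: closure_subset.
Qed.

End CompactInduction.

Section DoubleSums.
Variable R : realType.
Implicit Types F G H : 'I_2 -> 'I_2 -> R.

Lemma sum22 F : \sum_i \sum_j F i j = F 0 0 + F 0 1 + (F 1 0 + F 1 1).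
Proof. by rewrite !sum2. Qed.

Lemma sum22_sub F G H (a b u : R) : (forall i j, H i j = F i j - G i j) ->
  \sum_i \sum_j H i j - (a - b) * u =
  \sum_i \sum_j F i j - a * u - (\sum_i \sum_j G i j - b * u).
Proof. by move=> E; rewrite !sum22 !E; ring. Qed.

Lemma cvg_sum22 (K : 'I_2 -> 'I_2 -> R -> R) F (B : set_system R) : ProperFilter B ->
  (forall i j, K i j t @[t --> B] --> F i j) ->
  (\sum_i \sum_j K i j t) @[t --> B] --> (\sum_i \sum_j F i j : R).
Proof.
move=> PB c; have FF := @filter_filter _ _ PB.
have C := cvgD (cvgD (c 0 0) (c 0 1)) (cvgD (c 1 0) (c 1 1)).
rewrite sum22; have -> : (fun t => \sum_i \sum_j K i j t) =
    (fun t => K 0 0 t + K 0 1 t + (K 1 0 t + K 1 1 t)).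
  by apply/funext => t; exact: sum22.
exact: C.
Qed.

Lemma leibniz_sub (a b a1 b1 a2 b2 a3 b3 r u v w t : R) :
  r * ((a - b) * u + (a1 - b1) * v + ((a2 - b2) * w + (a3 - b3) * t)) =
  r * (a * u + a1 * v + (a2 * w + a3 * t)) - r * (b * u + b1 * v + (b2 * w + b3 * t)).
Proof. by ring. Qed.

End DoubleSums.

Lemma convE (R : realType) (k v : R * R -> R) x : conv k v x =
    ii (@leb2 R) (fun y => v y * k (x - y)).
Proof. by []. Qed.

(* Unification would otherwise unfold these down to integrals and limits. *)
Opaque smooth ii conv mol bump2.

Section EnergyFunctional.
Variable R : realType.
Local Notation plane := (R * R)%type.
Local Notation mu := (@leb2 R).
Local Notation ig2 := (ig (@leb2 R)).
Local Notation ii2 := (ii (@leb2 R)).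
Implicit Types (F G H phi chi : plane -> R) (i j : 'I_2) (x y p q c : plane).

Lemma WdD s F1 F2 G1 G2 : ig2 F1 -> ig2 F2 -> ig2 G1 -> ig2 G2 ->
  Wd s F1 G1 -> Wd s F2 G2 -> Wd s (fun x => F1 x + F2 x) (fun x => G1 x + G2 x).
Proof.
move=> f1 f2 g1 g2 w1 w2 phi kp; have ks := kern_pds s kp.
have -> : (fun x => (F1 x + F2 x) * pds s phi x) =
    (fun x => F1 x * pds s phi x + F2 x * pds s phi x).
  by apply/funext => x; rewrite mulrDl.
have -> : (fun x => (G1 x + G2 x) * phi x) = (fun x => G1 x * phi x + G2 x * phi x).
  by apply/funext => x; rewrite mulrDl.
by rewrite !iiD ?w1 ?w2 ?mulrDr//; exact: ig_mul_kern.
Qed.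

Lemma Wd_trans i j F G H : Wd [:: i] F G -> Wd [:: j] G H -> Wd [:: i; j] F H.
Proof.
move=> w1 w2 phi kp; have := w1 _ (kern_pd j kp); have := w2 _ kp.
by rewrite /= !expr1 sqrrN expr1n => -> ->; rewrite mulrA mulrNN !mul1r.
Qed.

Lemma kern_mulr chi phi : smooth chi -> kern phi -> kern (fun x => chi x * phi x).
Proof.
move=> sc [sp [M M0 p0]]; split; first exact: smoothM.
by exists M => // x /p0 ->; rewrite mulr0.
Qed.

Lemma Wd_mul i F G chi : ig2 F -> ig2 G -> smooth chi -> Wd [:: i] F G ->
  Wd [:: i] (fun x => chi x * F x) (fun x => chi x * G x + pd i chi x * F x).
Proof.
move=> IF IG sc w phi kp; have := w _ (kern_mulr sc kp).
rewrite /= (pdM _ sc kp.1).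
have k1 := kern_mulr sc (kern_pd i kp); have k2 := kern_mulr (smooth_pd i sc) kp.
have k3 := kern_mulr sc kp.
have -> : (fun x => F x * (pd i chi x * phi x + chi x * pd i phi x)) =
   (fun x => F x * (pd i chi x * phi x) + F x * (chi x * pd i phi x)).
  by apply/funext => x; rewrite mulrDr.
rewrite iiD; [|exact: ig_mul_kern|exact: ig_mul_kern].
have -> : (fun x => chi x * F x * pd i phi x) = (fun x => F x * (chi x * pd i phi x)).
  by apply/funext => x; ring.
have -> : (fun x => (chi x * G x + pd i chi x * F x) * phi x) =
    (fun x => G x * (chi x * phi x) + F x * (pd i chi x * phi x)).
  by apply/funext => x; ring.
rewrite iiD; [|exact: ig_mul_kern|exact: ig_mul_kern].
by rewrite expr1 !mulN1r opprD => <-; ring.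
Qed.

Variables (omega : set plane) (M0 : R).
Hypotheses (oo : open omega) (oM : omega `<=` box 0 M0).
Local Notation L2z := (L2z omega).

(** A smooth [chi] may be unbounded on the plane, so it is multiplied by a bump equal to 1 on
    omega. *)
Lemma L2z_mulc F chi : L2z F -> smooth chi -> L2z (fun x => chi x * F x).
Proof.
move=> LF sc; pose M := `|M0| + 1; have MM : 0 < M by rewrite ltr_wpDl.
have oM' : omega `<=` box 0 M.
  by move=> x /oM; apply: box_le; rewrite /M; have := ler_norm M0; lra.
have kb : kern (fun x => chi x * bump2 0 M x).
  split; first exact: smoothM sc (smooth_bump2 _ _).
  by exists (2 * M) => [|x nb]; [rewrite mulr_gt0|rewrite bump2_0// mulr0].
have [C _ kC] := kern_bounded kb.
have -> : (fun x => chi x * F x) = (fun x => F x * (chi x * bump2 0 M x)).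
  apply/funext => x; have [ox|nx] := pselect (omega x).
    by rewrite bump2_1 ?mulr1 1?mulrC//; exact: oM'.
  by have [_ _ ->] := LF => //; rewrite mulr0 mul0r.
exact: L2z_mulb LF (kern_meas kb) kC.
Qed.

Variables (U : plane -> R) (V : 'I_2 -> plane -> R) (u2 : 'I_2 -> 'I_2 -> plane -> R).
Hypotheses (cU : continuous U) (U0 : forall x, ~ omega x -> U x = 0).
Hypotheses (cV : forall i, continuous (V i)) (V0 : forall i x, ~ omega x -> V i x = 0).
Hypotheses (Lu : forall i j, L2z (u2 i j)).
Hypotheses (WU : forall i, Wd [:: i] U (V i)) (WV : forall i j, Wd [:: j] (V i) (u2 i j)).

(* The weak derivative d_i d_j of chi u, by the Leibniz rule. *)
Definition W2 chi i j x := chi x * u2 i j x + pd j chi x * V i x +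
    (pd i chi x * V j x + pds [:: j; i] chi x * U x).

Let LU : L2z U. Proof. have := L2z_continuous oM cU U0. by []. Qed.
Let LV i : L2z (V i). Proof. have := L2z_continuous oM (@cV i) (@V0 i). by []. Qed.
Let L2zI F : L2z F -> ig2 F. Proof. exact: ig_L2z oo oM F. Qed.

Lemma L2z_W2 chi i j : smooth chi -> L2z (W2 chi i j).
Proof.
move=> sc; have s1 := smooth_pd i sc; have s2 := smooth_pd j sc; have s3 := smooth_pds [:: j; i] sc.
have A1 := L2zD (L2z_mulc (Lu i j) sc) (L2z_mulc (LV i) s2).
exact: L2zD A1 (L2zD (L2z_mulc (LV j) s1) (L2z_mulc LU s3)).
Qed.

Lemma Wd_W2 chi i j : smooth chi -> Wd [:: i; j] (fun x => chi x * U x) (W2 chi i j).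
Proof.
move=> sc; have s1 := smooth_pd i sc; have s2 := smooth_pd j sc; have s3 := smooth_pds [:: j; i] sc.
apply: (Wd_trans (Wd_mul (L2zI LU) (L2zI (LV i)) sc (WU i))).
apply: WdD.
- exact: L2zI (L2z_mulc (LV i) sc).
- exact: L2zI (L2z_mulc LU s1).
- exact: L2zI (L2zD (L2z_mulc (Lu i j) sc) (L2z_mulc (LV i) s2)).
- exact: L2zI (L2zD (L2z_mulc (LV j) s1) (L2z_mulc LU s3)).
- exact: Wd_mul (L2zI (LV i)) (L2zI (Lu i j)) sc (WV i j).
- exact: Wd_mul (L2zI LU) (L2zI (LV j)) s1 (WU j).
Qed.

Variables (h : 'I_2 -> 'I_2 -> plane -> R) (z : plane).
Hypotheses (Lh : forall i j, L2z (h i j)) (oz : omega z).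
Hypothesis hz : forall phi, test_fun omega phi ->
  \sum_i \sum_j ii2 (fun x => h i j x * pds [:: i; j] phi x) = phi z.

(* Vanishes when the equation hz holds with chi u in place of the test function phi.  It is linear
   in chi, hence can be localized with a partition of unity. *)
Definition energy chi := \sum_i \sum_j ii2 (fun x => h i j x * W2 chi i j x) - chi z * U z.

Let IhW chi i j : smooth chi -> ig2 (fun x => h i j x * W2 chi i j x).
Proof.
by move=> sc; have [mh Ih _] := Lh i j; have [mW IW _] := L2z_W2 i j sc;
    exact: (@ig_mul _ _ R mu _ _ mh mW Ih IW).
Qed.

Lemma energyB chi psi : smooth chi -> smooth psi ->
  energy (fun x => chi x - psi x) = energy chi - energy psi.
Proof.
move=> sc sp; rewrite /energy.
have E i j : ii2 (fun x => h i j x * W2 (fun x => chi x - psi x) i j x) =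
    ii2 (fun x => h i j x * W2 chi i j x) - ii2 (fun x => h i j x * W2 psi i j x).
  rewrite -iiB; [|exact: IhW|exact: IhW]; congr ii; apply/funext => x.
  have E2 : pds [:: j; i] (fun x => chi x - psi x) =
      (fun x => pds [:: j; i] chi x - pds [:: j; i] psi x).
    by rewrite /= (pdB _ sc sp) (pdB _ (smooth_pd i sc) (smooth_pd i sp)).
  by rewrite /W2 E2 !(pdB _ sc sp); exact: leibniz_sub.
exact: sum22_sub.
Qed.

(** Nothing is known of [chi] off omega, but all other factors vanish there, while on the open set
    omega all derivatives of [chi] are 0. *)
Lemma energy_vanish chi : smooth chi -> (forall x, omega x -> chi x = 0) -> energy chi = 0.
Proof.
move=> sc c0.
have P s x : omega x -> pds s chi x = 0.
  elim: s x => [|i s IH] x ox; first exact: c0.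
  rewrite /= /pd; have -> : 0 = 'D_(basis R i) (fun=> 0 : R) x by rewrite derive_cst.
  apply: near_eq_derive.
  by apply: filterS (open_nbhs_nbhs (conj oo ox)) => y /IH.
rewrite /energy c0// mul0r subr0 big1// => i _; rewrite big1// => j _.
have -> : (fun x => h i j x * W2 chi i j x) = (fun=> 0); last exact: ii0.
apply/funext => x; rewrite /W2; have [ox|nx] := pselect (omega x).
  have P1 := P [:: j] x ox; have P2 := P [:: i] x ox; rewrite /= in P1 P2.
  by rewrite c0// (P [:: j; i])// P1 P2 !mul0r !addr0 mulr0.
by rewrite U0// !V0// !mulr0 !addr0; have [_ _ ->] := Lh i j => //; rewrite mul0r.
Qed.

Section Local.
Variables (p c : plane) (r t0 : R) (chi : plane -> R).
Hypotheses (t00 : 0 < t0) (sc : smooth chi) (c0 : forall x, ~ box p r x -> chi x = 0).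
Hypothesis pull : forall y (d : plane) (t : R), closure omega y -> box p r y -> 0 < t -> t <= t0 ->
    0 <= d.1 <= 1 -> 0 <= d.2 <= 1 -> omega (y + t *: (c + d)).

Let W x := chi x * U x.

(** The support lies in the image of a compact set, part of the closure of omega times the unit
    square, under (y, d) -> y + t (c + d); [pull] places this image inside omega. *)
Lemma test_conv (t : R) : 0 < t -> t <= t0 -> test_fun omega (conv (mol c t) W).
Proof.
move=> tp tt; have kk := kern_mol c tp.
have IW : ig2 W by exact: L2zI (L2z_mulc LU sc).
split; first exact: smooth_conv.
(* Centre of the unit square, which is the box of radius 1/2 around it. *)
pose half : plane := (2^-1, 2^-1).
pose f (q : plane * plane) : plane := q.1 + t *: (c + q.2).
exists (f @` ((closure omega `&` box p r) `*` box half 2^-1)); split.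
- apply: continuous_compact.
    apply: continuous_subspaceT => q.
    apply: cvgD; first exact: cvg_fst.
    by apply: cvgZr; apply: cvgD; [exact: cvg_cst|exact: cvg_snd].
  apply: compact_setX; last exact: compact_box.
  apply: (@subclosed_compact _ _ (closure omega)); [|exact: compact_closure oM|by move=> x []].
  apply: closedI; first exact: closed_closure.
  by apply: compact_closed; [exact: norm_hausdorff|exact: compact_box].
- move=> _ [q [[cq bq] [b1 b2]] <-]; apply: pull => //.
    by move: b1; rewrite ler_norml /half /= => /andP[? ?]; apply/andP; split; lra.
  by move: b2; rewrite ler_norml /half /= => /andP[? ?]; apply/andP; split; lra.
- move=> x nx; apply: conv_eq0 => y Wy; apply/eqP; apply: contra_notT nx => my.
  have oy : omega y by apply: contrapT => ny; move: Wy; rewrite /W U0// mulr0 eqxx.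
  have by_ : box p r y by apply: contrapT => ny; move: Wy; rewrite /W c0// mul0r eqxx.
  have [m1 m2] := mol_out tp my.
  exists (y, t^-1 *: (x - y) - c); last first.
    rewrite /f /= [c + _]addrC subrK scalerA divff ?gt_eqF// scale1r.
    by rewrite addrC subrK.
  split; first by split => //=; exact: closure_in.
  have N (a b : R) : t * b <= a <= t * (b + 1) -> `|t^-1 * a - b - 2^-1| <= 2^-1.
    move=> /andP[a1 a2]; have E : a = t * (t^-1 * a) by rewrite mulrA divff ?mul1r// gt_eqF.
    rewrite E !ler_pM2l// in a1 a2; rewrite ler_norml.
    by move: (t^-1 * a) a1 a2 => w a1 a2; apply/andP; split; lra.
  by split; apply: N.
Qed.

(** The equation [hz] is tested with the mollification of chi u. Second derivatives pass onto [W2]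
    because chi u has these weak derivatives on the whole plane. As t -> 0 the pairings converge by
    [conv_weak] and the value at [z] by uniform convergence. *)
Lemma energy_local : energy chi = 0.
Proof.
have LW : L2z W by exact: L2z_mulc LU sc.
have IW : ig2 W by exact: L2zI.
have E (t : R) : 0 < t -> t <= t0 ->
   \sum_i \sum_j ii2 (fun x => h i j x * conv (mol c t) (W2 chi i j) x) = conv (mol c t) W z.
  move=> tp tt; rewrite -(hz (test_conv tp tt)); apply: eq_bigr => i _; apply: eq_bigr => j _.
  congr ii; apply/funext => x; congr (_ * _); have kk := kern_mol c tp.
  rewrite pds_conv// !convE.
  have ks : kern (fun y => mol c t (x - y)).
    split; first by apply: smooth_refl; case: kk.
    exists (`|x.1| + `|x.2| + t * reach c); first by rewrite ltr_wpDl ?addr_ge0// mulr_gt0//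
        reach_gt0.
    move=> y nb; apply/eqP; apply: contra_notT nb => /(mol_reach tp) [b1 b2].
    split; rewrite /= subr0.
      have := ler_normD (y.1 - x.1) x.1; rewrite subrK.
      by have := normr_ge0 x.2; lra.
    have := ler_normD (y.2 - x.2) x.2; rewrite subrK.
    by have := normr_ge0 x.1; lra.
  have := Wd_W2 i j sc ks; rewrite pds_refl; last by case: kk.
  by rewrite /= sqrrN expr1n !mul1r => <-; congr ii; apply/funext => y; rewrite /= mul1r.
have cW : continuous W by move=> x; apply: cvgM; [exact: smooth_cont|exact: cU].
have W0 x : ~ box 0 M0 x -> W x = 0 by move=> nb; rewrite /W U0 ?mulr0// => /oM.
have C1 : conv (mol c t) W z @[t --> 0^'+] --> W z.
  apply/cvgrPdist_le => e e0; have [s s0 Hs] := conv_unif c cW W0 e0.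
  near=> t; rewrite distrC; apply: Hs; near: t; first exact: nbhs_right_gt.
  exact: nbhs_right_le.
have C2 i j : ii2 (fun x => h i j x * conv (mol c t) (W2 chi i j) x) @[t --> 0^'+] -->
    ii2 (fun x => h i j x * W2 chi i j x).
  apply/cvgrPdist_le => e e0; have [mh Ih h0] := Lh i j; have [mW IW2 W20] := L2z_W2 i j sc.
  have [s s0 Hs] := conv_weak c oo oM mh (L2zI (Lh i j)) Ih mW (L2zI (L2z_W2 i j sc)) IW2 W20 e0.
  near=> t; rewrite distrC; apply: Hs; near: t; first exact: nbhs_right_gt.
  exact: nbhs_right_le.
pose Q (t : R) : R := \sum_i \sum_j ii2 (fun x => h i j x * conv (mol c t) (W2 chi i j) x).
have C3 : Q t @[t --> 0^'+] --> (\sum_i \sum_j ii2 (fun x => h i j x * W2 chi i j x) : R).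
  exact: cvg_sum22.
have C4 : Q t @[t --> 0^'+] --> W z.
  apply: cvg_trans C1; apply: near_eq_cvg; near=> t.
  have tp : 0 < t by near: t; exact: nbhs_right_gt.
  have tt : t <= t0 by near: t; exact: nbhs_right_le.
  by rewrite /Q (E t tp tt).
have E2 := @cvg_unique _ (@Rhausdorff R) _ (fmap_proper_filter _ (at_right_proper_filter 0)) _ _ C3
    C4.
by rewrite /energy E2 subrr.
Unshelve. all: by end_near. Qed.

End Local.

(** [P] asks for a smooth function equal to 1 on the set and annihilated by the energy after
    multiplication by any smooth factor. This factor is what makes [P] pass to unions; on the
    compact closure of omega, [P] then gives energy 0 for the constant 1. *)
Lemma energy_identity : smooth_bdry omega -> \sum_i \sum_j ii2 (fun x => h i j x * u2 i j x) = U z.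
Proof.
move=> sb.
pose P (A : set plane) := exists beta : plane -> R, [/\ smooth beta,
  forall chi, smooth chi -> energy (fun x => chi x * beta x) = 0 & forall x, A x -> beta x = 1].
have [|||p cp||beta [sbe eb b1]] := @compact_induction R (closure omega) P.
- exists (fun=> 0); split => //; first exact: smooth_cst.
  move=> chi sc; apply: energy_vanish => [|x _]; last by rewrite mulr0.
  exact: smoothM sc (smooth_cst _).
- by move=> A B AB [beta [h1 h2 h3]]; exists beta; split => // x /AB /h3.
- move=> A B [b [h1 h2 h3]] [b' [h1' h2' h3']].
  (* This is 1 - (1 - b)(1 - b'), equal to 1 wherever one of the two is. *)
  exists (fun x => b x - (b x * b' x - b' x)); split.
  + exact: smoothB h1 (smoothB (smoothM h1 h1') h1').
  + move=> chi sc.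
    have -> : (fun x => chi x * (b x - (b x * b' x - b' x))) =
      (fun x => chi x * b x - ((chi x * b x) * b' x - chi x * b' x)).
      by apply/funext => x; ring.
    have s1 := smoothM sc h1; have s2 := smoothM sc h1'; have s3 := smoothM s1 h1'.
    rewrite (energyB s1 (smoothB s3 s2)) (energyB s3 s2).
    by rewrite (h2 _ sc) (h2' _ s1) (h2' _ sc) !subr0.
  + by move=> x [/h3 ->|/h3' ->]; ring.
- have [r [t0 [c [r0 t00 pull]]]] := pullable_closure oo sb cp.
  exists (r / 2); first by rewrite divr_gt0.
  exists (bump2 p (r / 2)); split; first exact: smooth_bump2.
    move=> chi sc; have sb2 := smoothM sc (smooth_bump2 p (r / 2)).
    have := energy_local t00 sb2 _ pull; apply.
    move=> x nb; rewrite bump2_0 ?mulr0 ?divr_gt0//.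
    by rewrite (_ : 2 * (r / 2) = r)//; field.
  by move=> x; apply: bump2_1; rewrite divr_gt0.
- exact: compact_closure oM.
have s1 := smooth_cst (1 : R).
have : energy (fun x => 1 - beta x) = 0.
  apply: (energy_vanish (smoothB s1 sbe)).
  by move=> x ox; rewrite b1 ?subrr//; exact: closure_in.
have := eb _ s1; under [fun x => 1 * beta x]eq_fun do rewrite mul1r.
rewrite (energyB s1 sbe) => -> /eqP; rewrite subr0 /energy mul1r subr_eq0 => /eqP <-.
apply: eq_bigr => i _; apply: eq_bigr => j _; congr ii; apply/funext => x.
by rewrite /W2 /= !pd_cst /= !mul0r mul1r !addr0.
Qed.

End EnergyFunctional.

Transparent smooth ii conv mol bump2.

(** * Equality of mixed derivatives *)

Section Schwarz.
Variable R : realType.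
Local Notation plane := (R * R)%type.
Implicit Types (f : plane -> R) (x : plane).

(** The mean value theorem in each variable, applied to the second difference over a square of side
    [h]. *)
Lemma mixed_difference f x (h : R) : smooth f -> 0 < h ->
  exists2 y, box x h y & f (x.1 + h, x.2 + h) - f (x.1, x.2 + h) - (f (x.1 + h, x.2) - f x) =
    pd 1 (pd 0 f) y * h ^+ 2.
Proof.
move=> sf h0; have s0 := smooth_pd 0 sf.
have D (t : R) : is_derive t 1 (fun t : R => f (t, x.2 + h) - f (t, x.2))
    (pd 0 f (t, x.2 + h) - pd 0 f (t, x.2)).
  apply: is_derive_sub.
    exact: (@is_derive_slice0 R f (t, x.2 + h) _ (smooth_is_derive sf _ 0)).
  exact: (@is_derive_slice0 R f (t, x.2) _ (smooth_is_derive sf _ 0)).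
have [c [hc E]] := mvt_line x.1 (x.1 + h) D.
have D' (t : R) : is_derive t 1 (fun t : R => pd 0 f (c, t)) (pd 1 (pd 0 f) (c, t)).
  exact: (@is_derive_slice1 R (pd 0 f) (c, t) _ (smooth_is_derive s0 _ 1)).
have [d [hd E']] := mvt_line x.2 (x.2 + h) D'.
rewrite [x.1 + h]addrC [x.2 + h]addrC !addrK (ger0_norm (ltW h0)) in hc hd E E'.
exists (c, d) => //.
rewrite [x.1 + h]addrC [x.2 + h]addrC -surjective_pairing in E *.
have -> : f (h + x.1, h + x.2) - f (x.1, h + x.2) - (f (h + x.1, x.2) - f x) =
   f (h + x.1, h + x.2) - f (h + x.1, x.2) - (f (x.1, h + x.2) - f x).
  by move: (f _) (f _) (f _) (f _) => a b e g; ring.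
by rewrite E E' expr2 mulrA.
Qed.

Lemma mixed_difference' f x (h : R) : smooth f -> 0 < h ->
  exists2 y, box x h y & f (x.1 + h, x.2 + h) - f (x.1, x.2 + h) - (f (x.1 + h, x.2) - f x) =
    pd 0 (pd 1 f) y * h ^+ 2.
Proof.
move=> sf h0; have s0 := smooth_pd 1 sf.
have D (t : R) : is_derive t 1 (fun t : R => f (x.1 + h, t) - f (x.1, t))
    (pd 1 f (x.1 + h, t) - pd 1 f (x.1, t)).
  apply: is_derive_sub.
    exact: (@is_derive_slice1 R f (x.1 + h, t) _ (smooth_is_derive sf _ 1)).
  exact: (@is_derive_slice1 R f (x.1, t) _ (smooth_is_derive sf _ 1)).
have [d [hd E]] := mvt_line x.2 (x.2 + h) D.
have D' (t : R) : is_derive t 1 (fun t : R => pd 1 f (t, d)) (pd 0 (pd 1 f) (t, d)).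
  exact: (@is_derive_slice0 R (pd 1 f) (t, d) _ (smooth_is_derive s0 _ 0)).
have [c [hc E']] := mvt_line x.1 (x.1 + h) D'.
rewrite [x.1 + h]addrC [x.2 + h]addrC !addrK (ger0_norm (ltW h0)) in hc hd E E'.
exists (c, d) => //.
rewrite [x.1 + h]addrC [x.2 + h]addrC -surjective_pairing in E *.
by rewrite E E' expr2 mulrA.
Qed.

Lemma close2 (a a' b b' e : R) : `|a' - a| <= e / 2 -> `|b' - b| <= e / 2 -> a' = b' ->
    `|a - b| <= e.
Proof. by rewrite !ler_norml => /andP[? ?] /andP[? ?] ?; apply/andP; split; lra. Qed.

(** The same second difference gives both mixed derivatives at points that tend to [x]. The lemma is
    needed because integration by parts reverses the order of derivatives, which matters in the
    third row of D_3. *)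
Lemma pd_comm f : smooth f -> pd 0 (pd 1 f) = pd 1 (pd 0 f).
Proof.
move=> sf; apply/funext => x; apply/eqP; rewrite -subr_eq0 -normr_le0.
apply/ler_addgt0Pl => e e0; rewrite addr0.
have e2 : 0 < e / 2 by rewrite divr_gt0.
have [r r0 H] := cont_box x (smooth_cont (smooth_pds [:: 0; 1] sf)) e2.
have [s s0 H'] := cont_box x (smooth_cont (smooth_pds [:: 1; 0] sf)) e2.
have m0 : 0 < Num.min r s by rewrite lt_min r0.
have [y by_ E] := mixed_difference x sf m0.
have [y' by' E'] := mixed_difference' x sf m0.
have m2 : Num.min r s ^+ 2 != 0 by rewrite expf_neq0 ?gt_eqF.
have {}E : pd 0 (pd 1 f) y' = pd 1 (pd 0 f) y := mulIf m2 (etrans (esym E') E).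
have mr : Num.min r s <= r by rewrite ge_min lexx.
have ms : Num.min r s <= s by rewrite ge_min lexx orbT.
exact: (close2 (H _ (box_le mr by')) (H' _ (box_le ms by_)) E).
Qed.

End Schwarz.

(** * Functions on the domain and their zero extensions *)

Section ZeroExtensionOfL2.
Variable R : realType.
Local Notation plane := (R * R)%type.
Local Notation mu := (@leb2 R).
Local Notation ii2 := (ii (@leb2 R)).
Implicit Types (f g phi u : plane -> R) (i j : 'I_2) (x y : plane).
Variables (omega : set plane) (M0 : R).
Hypotheses (oo : open omega) (oM : omega `<=` box 0 M0).

Lemma zext_mul f g x : ((fun y => f y * g y) \_ omega) x = (f \_ omega) x * g x.
Proof.
have [ox|nx] := pselect (omega x); first by rewrite !zext_in.
by rewrite !zext_out// mul0r.
Qed.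

Lemma int_zext f : \int[mu]_(y in omega) f y = ii2 (f \_ omega).
Proof. exact: Rintegral_mkcond. Qed.

Lemma int_zext_mul f g : \int[mu]_(y in omega) (f y * g y) = ii2 (fun x => (f \_ omega) x * g x).
Proof. by rewrite int_zext; congr ii; apply/funext => x; exact: zext_mul. Qed.

Lemma L2_zext f : L2 omega f -> L2z omega (f \_ omega).
Proof.
move=> [mf If]; have mo := open_measurable2 oo.
split; [exact/(measurable_restrictT _ mo) | | exact: zext_out].
have := (@integrable_mkcond _ _ R mu omega (fun y => (f y ^+ 2)%:E) mo).1 If.
rewrite /ig (_ : (fun y => (f y ^+ 2)%:E) \_ omega = EFin \o (fun x => (f \_ omega) x ^+ 2))//.
apply/funext => x /=; rewrite !patchE; case: ifPn => // _; by rewrite expr0n.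
Qed.

Lemma L2z_L2 f : L2z omega f -> L2 omega f.
Proof.
move=> [mf If _]; have mo := open_measurable2 oo; split; first exact: measurable_funTS.
exact: integrableS If.
Qed.

Lemma weak_zext s f g : weak_deriv omega s f g <-> wd omega s (f \_ omega) (g \_ omega).
Proof.
by split=> H phi tp; have := H phi tp; rewrite !int_zext_mul.
Qed.

End ZeroExtensionOfL2.

Section EnergyPairing.
Variable R : realType.
Local Notation plane := (R * R)%type.
Local Notation ii2 := (ii (@leb2 R)).
Implicit Types (f g phi u : plane -> R) (i j : 'I_2) (x y : plane).
Variables (omega : set plane) (M0 : R).
Hypotheses (oo : open omega) (oM : omega `<=` box 0 M0).

(** The product of the extended [u] with a test function is differentiable everywhere, being zero
    near every point off omega. *)
Lemma classical_wd u g i : continuous (u \_ omega) -> continuous (g \_ omega) ->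
  (forall y, omega y -> is_derive y (basis R i) u (g y)) ->
      wd omega [:: i] (u \_ omega) (g \_ omega).
Proof.
move=> cu cg dg phi tp; have kp := test_kern tp; have [sp [K [cK Ko K0]]] := tp.
have D x : is_derive x (basis R i) (fun y => (u \_ omega) y * phi y)
    ((g \_ omega) x * phi x + (u \_ omega) x * pd i phi x).
  have [ox|nx] := pselect (omega x).
    have h := is_derive_mul (dg x ox) (smooth_is_derive sp x i).
    rewrite !zext_in//.
    have N : \near x, u x * phi x = (u \_ omega) x * phi x.
      by apply: filterS (open_nbhs_nbhs (conj oo ox)) => y oy; rewrite zext_in.
    exact: near_eq_is_derive N _.
  have cKo : open (~` K) by apply: closed_openC; apply: compact_closed => //; exact: norm_hausdorff.
  have nK : (~` K) x by move=> /Ko.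
  have N : \near x, (fun=> 0) x = (u \_ omega) x * phi x.
    by apply: filterS (open_nbhs_nbhs (conj cKo nK)) => y nKy; rewrite K0// mulr0.
  apply: near_eq_is_derive N _; rewrite !zext_out// !mul0r addr0; exact: is_derive_const.
have cD : continuous (fun x => (g \_ omega) x * phi x + (u \_ omega) x * pd i phi x).
  move=> x; apply: cvgD; apply: cvgM; [exact: cg|exact: smooth_cont sp _|exact: cu|exact:
      smooth_cont (smooth_pd i sp) _].
have B x : ~ box 0 M0 x -> (u \_ omega) x * phi x = 0 by move=> nb;
    rewrite zext_out ?mul0r// => /oM.
have := ii_derive_eq0 D cD B.
have cu0 := L2z_continuous oM cu (fun x => @zext_out R omega u x).
have cg0 := L2z_continuous oM cg (fun x => @zext_out R omega g x).
rewrite iiD; [|apply: ig_mul_kern => //; exact: ig_L2z oo oM _ cg0|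
  apply: ig_mul_kern (kern_pd i kp); exact: ig_L2z oo oM _ cu0].
by rewrite /= expr1 mulN1r addrC => /eqP; rewrite addr_eq0 => /eqP.
Qed.

Lemma C1bar_gradient u : C1bar omega u -> exists g : 'I_2 -> plane -> R,
  (forall i, C0bar omega (g i)) /\ forall i y, omega y -> is_derive y (basis R i) u (g i y).
Proof.
move=> [_ H]; have [g Hg] := choice (fun i => let: ex_intro2 g a b := (H i).2 in
  ex_intro (fun g => C0bar omega g /\ forall y, omega y -> g y = pd i u y) g (conj a b)).
exists g; split=> [i|i y oy]; first exact: (Hg i).1.
rewrite (Hg i).2//; apply: derivableP; exact: (H i).1.
Qed.

Lemma energy_pairing u (u2 h : 'I_2 -> 'I_2 -> plane -> R) z : smooth_bdry omega ->
  C1bar omega u -> (forall p, bdry omega p -> u p = 0) -> dnormal0 omega u ->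
  (forall i j, L2z omega (u2 i j)) -> (forall i j, wd omega [:: i; j] (u \_ omega) (u2 i j)) ->
  (forall i j, L2z omega (h i j)) -> omega z ->
  (forall phi, test_fun omega phi -> \sum_i \sum_j ii2 (fun x => h i j x * pds [:: i; j] phi x) =
      phi z) ->
  \sum_i \sum_j ii2 (fun x => h i j x * u2 i j x) = u z.
Proof.
move=> sb cu u0 dn Lu wu Lh oz hz.
have [g [cg dg]] := C1bar_gradient cu.
have g0 i p : bdry omega p -> g i p = 0 by move=> bp;
    exact: (gradient_bdry oo sb cu.1 u0 dn cg dg bp).
have cU := continuous_zext oo cu.1 u0.
have cV i := continuous_zext oo (cg i) (g0 i).
have W1 i : wd omega [:: i] (u \_ omega) (g i \_ omega) := classical_wd cU (cV i) (dg i).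
have LV i := L2z_continuous oM (cV i) (fun x => @zext_out R omega (g i) x).
(* A derivative of a test function is a test function, so the identity for the second derivative of
   [u] is one for the first derivative of its gradient. *)
have W2 i j : wd omega [:: j] (g i \_ omega) (u2 i j).
  move=> phi tp.
  have tj : test_fun omega (pd j phi).
    have [sp [K [cK Ko K0]]] := tp; split; first exact: smooth_pd.
    exists K; split => // y nK.
    have cKo : open (~` K) by apply: closed_openC; apply: compact_closed => //;
        exact: norm_hausdorff.
    have -> : 0 = 'D_(basis R j) (fun=> 0 : R) y by rewrite derive_cst.
    by apply: near_eq_derive; apply: filterS (open_nbhs_nbhs (conj cKo nK)) => v nKv; rewrite K0.
  have E1 := W1 i _ tj; have E2 := wu i j _ tp.
  rewrite /= !expr1 mulN1r in E1; rewrite /= sqrrN expr1n mul1r in E2.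
  by rewrite /= expr1 mulN1r -E2 E1 opprK.
have := @energy_identity R omega M0 oo oM (u \_ omega) (fun i => g i \_ omega) u2 cU
  (fun x => @zext_out R omega u x) cV (fun i x => @zext_out R omega (g i) x) Lu
  (fun i => zero_extension oo oM cU (fun x => @zext_out R omega u x) (LV i) (W1 i))
  (fun i j => zero_extension oo oM (cV i) (fun x => @zext_out R omega (g i) x) (Lu i j) (W2 i j))
  h z Lh oz hz sb.
by rewrite zext_in.
Qed.

End EnergyPairing.

Arguments pds : simpl never.

(** * Symmetry and positivity of the plate Green function *)

Section LinearCombinations.
Variable R : realType.
Local Notation plane := (R * R)%type.
Local Notation ig2 := (ig (@leb2 R)).
Local Notation ii2 := (ii (@leb2 R)).
Implicit Types (f g phi : plane -> R) (s t : seq 'I_2).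

Lemma pds_lin (a : R) f g s : smooth f -> smooth g ->
  pds s (fun x => a * f x + g x) = (fun x => a * pds s f x + pds s g x).
Proof.
move=> sf sg; elim: s => [//|i s IH]; rewrite /pds /= -!/(pds s _) IH.
by rewrite (pdD _ (smoothZ a (smooth_pds s sf)) (smooth_pds s sg)) (pdZ _ _ (smooth_pds s sf)).
Qed.

Lemma smooth_sum n (c : 'I_n -> R) (F : 'I_n -> plane -> R) : (forall i, smooth (F i)) ->
  smooth (fun x => \sum_i c i * F i x).
Proof.
elim: n c F => [|n IH] c F sF.
  have -> : (fun x => \sum_(i < 0) c i * F i x) = (fun=> 0) by apply/funext => x; rewrite big_ord0.
  exact: smooth_cst.
have -> : (fun x => \sum_i c i * F i x) = (fun x => c ord0 * F ord0 x +
    \sum_i c (lift ord0 i) * F (lift ord0 i) x).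
  by apply/funext => x; rewrite big_ord_recl.
apply: smoothD; first exact: smoothZ (sF _).
by apply: IH => i; exact: sF.
Qed.

Lemma pds_sum n (c : 'I_n -> R) (F : 'I_n -> plane -> R) s : (forall i, smooth (F i)) ->
  pds s (fun x => \sum_i c i * F i x) = (fun x => \sum_i c i * pds s (F i) x).
Proof.
elim: n c F => [|n IH] c F sF.
  have E (G : 'I_0 -> plane -> R) : (fun x => \sum_(i < 0) c i * G i x) = (fun=> 0).
    by apply/funext => x; rewrite big_ord0.
  rewrite !E; elim: s => [//|i s IHs]; rewrite /pds /= -!/(pds s _) IHs; exact: pd_cst.
have E (G : 'I_n.+1 -> plane -> R) : (fun x => \sum_i c i * G i x) =
    (fun x => c ord0 * G ord0 x + \sum_i c (lift ord0 i) * G (lift ord0 i) x).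
  by apply/funext => x; rewrite big_ord_recl.
rewrite !E pds_lin; [|exact: sF|by apply: smooth_sum => i; exact: sF].
by rewrite IH// => i; exact: sF.
Qed.

Lemma ig_sum n (c : 'I_n -> R) (F : 'I_n -> plane -> R) : (forall i, ig2 (F i)) ->
  ig2 (fun x => \sum_i c i * F i x).
Proof.
elim: n c F => [|n IH] c F sF.
  have -> : (fun x => \sum_(i < 0) c i * F i x) = (fun=> 0) by apply/funext => x; rewrite big_ord0.
  exact: ig0.
have -> : (fun x => \sum_i c i * F i x) = (fun x => c ord0 * F ord0 x +
    \sum_i c (lift ord0 i) * F (lift ord0 i) x).
  by apply/funext => x; rewrite big_ord_recl.
by apply: igD; [exact: igZ|apply: IH].
Qed.

Lemma ii_sum n (c : 'I_n -> R) (F : 'I_n -> plane -> R) : (forall i, ig2 (F i)) ->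
  ii2 (fun x => \sum_i c i * F i x) = \sum_i c i * ii2 (F i).
Proof.
elim: n c F => [|n IH] c F sF.
  have -> : (fun x => \sum_(i < 0) c i * F i x) = (fun=> 0) by apply/funext => x; rewrite big_ord0.
  by rewrite big_ord0; exact: ii0.
have -> : (fun x => \sum_i c i * F i x) = (fun x => c ord0 * F ord0 x +
    \sum_i c (lift ord0 i) * F (lift ord0 i) x).
  by apply/funext => x; rewrite big_ord_recl.
rewrite iiD; [|exact: igZ|by apply: ig_sum].
by rewrite iiZ// IH// big_ord_recl.
Qed.

Lemma L2z0 (omega : set plane) : L2z omega (fun=> 0).
Proof.
split => //; rewrite (_ : (fun=> _) = (fun=> 0)); first exact: ig0.
by apply/funext => x; rewrite expr0n.
Qed.

Lemma L2z_sum n (omega : set plane) (c : 'I_n -> R) (F : 'I_n -> plane -> R) :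
    (forall i, L2z omega (F i)) ->
  L2z omega (fun x => \sum_i c i * F i x).
Proof.
elim: n c F => [|n IH] c F sF.
  have -> : (fun x => \sum_(i < 0) c i * F i x) = (fun=> 0) by apply/funext => x; rewrite big_ord0.
  exact: L2z0.
have -> : (fun x => \sum_i c i * F i x) = (fun x => c ord0 * F ord0 x +
    \sum_i c (lift ord0 i) * F (lift ord0 i) x).
  by apply/funext => x; rewrite big_ord_recl.
by apply: L2zD; [exact: L2zZ|apply: IH].
Qed.

Lemma test_pds (U : set plane) phi s : test_fun U phi -> test_fun U (pds s phi).
Proof.
move=> [sp [K [cK KU K0]]]; split; first exact: smooth_pds.
exists K; split => //; have cKo : open (~` K).
  by apply: closed_openC; apply: compact_closed => //; exact: norm_hausdorff.
elim: s => [//|i s IH] y nK.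
have -> : 0 = 'D_(basis R i) (fun=> 0 : R) y by rewrite derive_cst.
by apply: near_eq_derive; apply: filterS (open_nbhs_nbhs (conj cKo nK)) => v nKv; exact: IH.
Qed.

Lemma sum3 (V : nmodType) (F : 'I_3 -> V) : \sum_i F i = F 0 + F 1 + F ord_max.
Proof.
rewrite !big_ord_recl big_ord0 addr0 addrA; congr (_ + F _ + F _); exact: val_inj.
Qed.

Lemma ord3P (i : 'I_3) : [\/ i = 0, i = 1 | i = ord_max].
Proof.
case: i => [[|[|[|//]]] h]; [constructor 1|constructor 2|constructor 3]; exact: val_inj.
Qed.

Lemma pds_cat s t f : pds (s ++ t) f = pds s (pds t f).
Proof. by rewrite /pds foldr_cat. Qed.

End LinearCombinations.

Section PlateGreen.
Variable R : realType.
Local Notation plane := (R * R)%type.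
Local Notation mu := (@leb2 R).
Local Notation ig2 := (ig (@leb2 R)).
Local Notation ii2 := (ii (@leb2 R)).
Implicit Types (f g phi u : plane -> R) (i j : 'I_2) (x y z : plane) (a b : 'I_3) (C B : 'M[R]_3).

(** Row [a] of D_3 is [k3 a] times the derivative along the pair [p3 a]. In this form L_3 is a
    constant-coefficient sum over pairs of rows, with coefficients [c3], which include the factor
    1/6. *)
Definition p3 a : 'I_2 * 'I_2 := nth (0, 1) [:: (0, 0); (1, 1); (0, 1)] a.

Definition s3 a : seq 'I_2 := [:: (p3 a).1; (p3 a).2].

Definition k3 a : R := [:: (Num.sqrt 2)^-1; (Num.sqrt 2)^-1; 1]`_a.

Definition c3 C a b : R := 6^-1 * (k3 a * k3 b * C a b).

Lemma D3E u y : D3 u y = \col_a (k3 a * pds (s3 a) u y).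
Proof.
apply/colP => a; rewrite !mxE; case: (ord3P a) => -> //=.
by rewrite /k3 /= mul1r.
Qed.

Lemma D3TE (s : plane -> 'cV[R]_3) y : D3T s y = \sum_a k3 a * pds (s3 a) (entry s a) y.
Proof. by rewrite sum3 /D3T /k3 /= mul1r. Qed.

Lemma L3E C phi y : smooth phi ->
  L3 C phi y = \sum_a \sum_b c3 C a b * pds (s3 a ++ s3 b) phi y.
Proof.
move=> sp; rewrite /L3 D3TE big_distrr; apply: eq_bigr => a _ /=.
have -> : entry (fun z => C *m D3 phi z) a = (fun z => \sum_b (C a b * k3 b) * pds (s3 b) phi z).
  by apply/funext => z; rewrite /entry mxE; apply: eq_bigr => b _; rewrite D3E mxE mulrA.
rewrite (pds_sum _ _ (fun b => smooth_pds (s3 b) sp)).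
rewrite !big_distrr; apply: eq_bigr => b _ /=; rewrite !mulrA; congr (_ * _).
by rewrite /c3; ring.
Qed.

Variables (omega : set plane) (M0 : R).
Hypotheses (oo : open omega) (oM : omega `<=` box 0 M0).

Lemma sobolev2_choice u : sobolev omega 2 u -> exists u2 : 'I_2 -> 'I_2 -> plane -> R,
  (forall i j, L2z omega (u2 i j)) /\ forall i j, wd omega [:: i; j] (u \_ omega) (u2 i j).
Proof.
move=> [_ H]; have [u2 Hu] := choice (fun q : 'I_2 * 'I_2 => let: ex_intro2 g a b :=
    H [:: q.1; q.2] isT in
  ex_intro (fun g => L2 omega g /\ weak_deriv omega [:: q.1; q.2] u g) g (conj a b)).
exists (fun i j => u2 (i, j) \_ omega); split=> i j; have [h1 h2] := Hu (i, j);
    first exact: L2_zext.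
by apply: (weak_zext _ _ _ _).1.
Qed.

(** The outer pair of derivatives is moved onto [u], the inner one stays on [phi]; the two signs
    cancel. *)
Lemma weak_plate C u (u2 : 'I_2 -> 'I_2 -> plane -> R) phi : L2z omega u ->
    (forall i j, L2z omega (u2 i j)) ->
  (forall i j, wd omega [:: i; j] u (u2 i j)) -> test_fun omega phi ->
  ii2 (fun x => u x * L3 C phi x) =
  \sum_b ii2 (fun x => (\sum_a c3 C a b * u2 (p3 a).1 (p3 a).2 x) * pds (s3 b) phi x).
Proof.
move=> Lu Lu2 w tp; have sp := tp.1; have Iu := ig_L2z oo oM Lu.
have -> : (fun x => u x * L3 C phi x) = (fun x => \sum_a 1 *
    (\sum_b c3 C a b * (u x * pds (s3 a ++ s3 b) phi x))).
  apply/funext => x; rewrite L3E// big_distrr; apply: eq_bigr => a _ /=; rewrite mul1r big_distrr.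
  by apply: eq_bigr => b _ /=; rewrite mulrCA.
have k s : kern (pds s phi) := kern_pds s (test_kern tp).
rewrite ii_sum; last by move=> a; apply: ig_sum => b; exact: ig_mul_kern.
have J a : 1 * ii2 (fun x => \sum_b c3 C a b * (u x * pds (s3 a ++ s3 b) phi x)) =
    \sum_b c3 C a b * ii2 (fun x => u x * pds (s3 a ++ s3 b) phi x).
  by rewrite mul1r ii_sum// => b; exact: ig_mul_kern.
rewrite (eq_bigr _ (fun a _ => J a)).
rewrite exchange_big; apply: eq_bigr => b _ /=.
transitivity (ii2 (fun x => \sum_a c3 C a b * (u2 (p3 a).1 (p3 a).2 x * pds (s3 b) phi x)));
    last first.
  by congr ii; apply/funext => x; rewrite big_distrl; apply: eq_bigr => a _ /=; rewrite mulrA.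
rewrite ii_sum; last by move=> a; exact: ig_mul_kern (ig_L2z oo oM (Lu2 (p3 a).1 (p3 a).2))
    (k (s3 b)).
have E a : ii2 (fun x => u x * pds (s3 a ++ s3 b) phi x) =
    ii2 (fun x => u2 (p3 a).1 (p3 a).2 x * pds (s3 b) phi x).
  by have := w (p3 a).1 (p3 a).2 _ (test_pds (s3 b) tp); rewrite sqrrN expr1n mul1r.
exact: (eq_bigr _ (fun a _ => congr1 (fun r => c3 C a b * r) (E a))).
Qed.

(** Spreads three rows over the four index pairs. The mixed derivative is counted at (0, 1) only,
    with 0 at (1, 0). *)
Definition pairs (H : 'I_3 -> plane -> R) i j : plane -> R :=
  if i == 0 then (if j == 0 then H 0 else H ord_max) else (if j == 0 then (fun=> 0) else H 1).

Lemma pairs_sum H (X : 'I_2 -> 'I_2 -> plane -> R) :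
  \sum_i \sum_j ii2 (fun x => pairs H i j x * X i j x) =
  \sum_b ii2 (fun x => H b x * X (p3 b).1 (p3 b).2 x).
Proof.
rewrite sum22 sum3 /pairs /=.
have -> : ii2 (fun x => 0 * X 1 0 x) = 0.
  by rewrite (_ : (fun x => _) = (fun=> 0)) ?ii0//; apply/funext => x; rewrite mul0r.
by rewrite add0r addrAC.
Qed.

Variables (B : 'M[R]_3) (G : plane -> plane -> R).
Hypotheses (sb : smooth_bdry omega) (Bs : B^T = B) (gG : green3 B omega G).

(** [energy_pairing] for u = G(., w), with the coefficient-weighted second derivatives of G(., z) as
    [h]. *)
Lemma green_energy z w (gz gw : 'I_2 -> 'I_2 -> plane -> R) : omega z -> omega w ->
  (forall i j, L2z omega (gz i j)) -> (forall i j, wd omega [:: i; j] ((G^~ z) \_ omega) (gz i j))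
      ->
  (forall i j, L2z omega (gw i j)) -> (forall i j, wd omega [:: i; j] ((G^~ w) \_ omega) (gw i j))
      ->
  G z w = \sum_b ii2 (fun x => (\sum_a c3 B a b * gz (p3 a).1 (p3 a).2 x) * gw (p3 b).1 (p3 b).2 x).
Proof.
move=> oz ow Lz wz Lw ww; have [gz1 gz2 _ _ gz5] := gG.1 z oz.
have [gw1 _ _ [gw4 gw4'] _] := gG.1 w ow.
pose H b : plane -> R := fun x => \sum_a c3 B a b * gz (p3 a).1 (p3 a).2 x.
have LH b : L2z omega (H b) by apply: L2z_sum => a.
have Lp i j : L2z omega (pairs H i j).
  rewrite /pairs; case: (ord2P i) => ->; case: (ord2P j) => -> //=.
  exact: L2z0.
rewrite -(@energy_pairing R omega M0 oo oM (G^~ w) gw (pairs H) z sb gw1 gw4 gw4' Lw ww Lp oz).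
  by rewrite pairs_sum.
move=> phi tp; rewrite -gz5// int_zext_mul Bs (weak_plate B (L2_zext oo gz2.1) Lz wz tp).
by rewrite (pairs_sum H (fun i j => pds [:: i; j] phi)).
Qed.

Lemma ig_L2z_mul f g : L2z omega f -> L2z omega g -> ig2 (fun x => f x * g x).
Proof. by move=> [mf If _] [mg Ig _]; exact: (@ig_mul _ _ R mu _ _ mf mg If Ig). Qed.

Definition energy3 (f g : 'I_3 -> plane -> R) : R :=
    \sum_b \sum_a c3 B a b * ii2 (fun x => f a x * g b x).

Lemma energy3E (f g : 'I_3 -> plane -> R) : (forall a, L2z omega (f a)) ->
    (forall a, L2z omega (g a)) ->
  \sum_b ii2 (fun x => (\sum_a c3 B a b * f a x) * g b x) = energy3 f g.
Proof.
move=> Lf Lg; apply: eq_bigr => b _; rewrite -ii_sum; last by move=> a; exact: ig_L2z_mul.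
by congr ii; apply/funext => x; rewrite big_distrl; apply: eq_bigr => a _ /=; rewrite mulrA.
Qed.

Lemma c3_sym a b : c3 B a b = c3 B b a.
Proof. by rewrite /c3 -[in RHS]Bs mxE [k3 b * _]mulrC. Qed.

Lemma energy3_sym (f g : 'I_3 -> plane -> R) : energy3 f g = energy3 g f.
Proof.
rewrite /energy3 exchange_big; apply: eq_bigr => a _; apply: eq_bigr => b _ /=; rewrite c3_sym;
    congr (_ * _).
by congr ii; apply/funext => x; exact: mulrC.
Qed.

Lemma energy3D (f g : 'I_3 -> plane -> R) (s : R) : (forall a, L2z omega (f a)) ->
    (forall a, L2z omega (g a)) ->
  energy3 (fun a x => f a x + s * g a x) (fun a x => f a x + s * g a x) =
  energy3 f f + s * (energy3 f g + energy3 g f) + s ^+ 2 * energy3 g g.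
Proof.
move=> Lf Lg.
have F a b : ii2 (fun x => (f a x + s * g a x) * (f b x + s * g b x)) =
    ii2 (fun x => f a x * f b x) + s * (ii2 (fun x => f a x * g b x) +
        ii2 (fun x => g a x * f b x)) +
    s ^+ 2 * ii2 (fun x => g a x * g b x).
  have I1 := ig_L2z_mul (Lf a) (Lf b); have I2 := ig_L2z_mul (Lf a) (Lg b).
  have I3 := ig_L2z_mul (Lg a) (Lf b); have I4 := ig_L2z_mul (Lg a) (Lg b).
  rewrite -(iiD I2 I3) -(iiZ s (igD I2 I3)) -(iiZ (s ^+ 2) I4) -(iiD I1 (igZ s (igD I2 I3))).
  rewrite -(iiD (igD I1 (igZ s (igD I2 I3))) (igZ (s ^+ 2) I4)).
  by congr ii; apply/funext => x; move: (f a x) (g a x) (f b x) (g b x) => p q p' q'; ring.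
have D2 (P Q : 'I_3 -> 'I_3 -> R) :
    \sum_b \sum_a (P b a + Q b a) = \sum_b \sum_a P b a + \sum_b \sum_a Q b a.
  by rewrite -big_split; apply: eq_bigr => b _; rewrite big_split.
have Z2 (r : R) (P : 'I_3 -> 'I_3 -> R) : \sum_b \sum_a (r * P b a) = r * \sum_b \sum_a P b a.
  by rewrite mulr_sumr; apply: eq_bigr => b _; rewrite mulr_sumr.
rewrite /energy3 -D2 -!Z2 -!D2; apply: eq_bigr => b _; apply: eq_bigr => a _; rewrite F.
by move: (c3 B a b) (ii2 _) (ii2 _) (ii2 _) (ii2 _) => c p q q' r; ring.
Qed.

(** Pointwise, the integrand is one sixth of the quadratic form of [B] at the vector with entries
    [k3 a * f a x]. *)
Lemma energy3_ge0 (f : 'I_3 -> plane -> R) : (forall x : 'cV[R]_3, 0 <= (x^T *m B *m x) 0 0) ->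
    (forall a, L2z omega (f a)) ->
  0 <= energy3 f f.
Proof.
move=> Bp Lf; rewrite -energy3E//; pose v x : 'cV[R]_3 := \col_a (k3 a * f a x).
have J b : ig2 (fun x => (\sum_a c3 B a b * f a x) * f b x).
  by apply: ig_L2z_mul => //; exact: L2z_sum.
have E := ii_sum (fun _ : 'I_3 => 1) J.
rewrite (eq_bigr (fun b => 1 * ii2 (fun x => (\sum_a c3 B a b * f a x) * f b x)));
    last by move=> b _; rewrite mul1r.
rewrite -E; apply: ii_ge0 => x.
have -> : \sum_b 1 * ((\sum_a c3 B a b * f a x) * f b x) = 6^-1 * ((v x)^T *m B *m v x) 0 0.
  rewrite mxE big_distrr; apply: eq_bigr => b _ /=; rewrite mul1r [in RHS]mxE.
  rewrite [v x b 0]mxE [RHS]mulrA big_distrr big_distrl [RHS]big_distrl /=; apply: eq_bigr => a _.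
  by rewrite !mxE /c3; move: (k3 a) (k3 b) (f a x) (f b x) (B a b) => p q r s t; ring.
by rewrite mulr_ge0// invr_ge0.
Qed.

Lemma green_sym z w : omega z -> omega w -> G z w = G w z.
Proof.
move=> oz ow; have [_ sz _ _ _] := gG.1 z oz; have [_ sw _ _ _] := gG.1 w ow.
have [gz [Lz wz]] := sobolev2_choice sz; have [gw [Lw ww]] := sobolev2_choice sw.
rewrite (green_energy oz ow Lz wz Lw ww) (green_energy ow oz Lw ww Lz wz).
rewrite !energy3E//; exact: energy3_sym.
Qed.

Lemma green_grad_sym z i : omega z -> pd i (G^~ z) z = pd i (G z) z.
Proof.
move=> oz; apply: near_eq_derive; apply: filterS (open_nbhs_nbhs (conj oo oz)) => y oy.
exact: green_sym.
Qed.

(* If G z z = 0, the energy of G(., z) vanishes; by the Cauchy-Schwarz inequality so does its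
   energy product with a test function equal to 1 at z, but that product is 1. *)
Lemma green_pos z : (forall x : 'cV[R]_3, 0 <= (x^T *m B *m x) 0 0) -> omega z -> G z z != 0.
Proof.
move=> Bp oz; apply/eqP => G0; have [gz1 sz _ _ gz5] := gG.1 z oz.
have [gz [Lz wz]] := sobolev2_choice sz.
have [r r0 rO] := nbhs_boxP (open_nbhs_nbhs (conj oo oz)).
pose phi := bump2 z (r / 2); have r2 : 0 < r / 2 by rewrite divr_gt0.
have tp : test_fun omega phi.
  split; first exact: smooth_bump2.
  exists (box z r); split => //; first exact: compact_box.
  by move=> y nb; apply: bump2_0 => //; rewrite (_ : 2 * (r / 2) = r)//; field.
have p1 : phi z = 1 by apply: bump2_1 => //; split; rewrite subrr normr0 ltW.
pose g a : plane -> R := gz (p3 a).1 (p3 a).2; have Lg a : L2z omega (g a) by exact: Lz.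
pose q a : plane -> R := pds (s3 a) phi.
have Lq a : L2z omega (q a).
  have ta := test_pds (s3 a) tp; apply: (L2z_continuous oM); first exact: smooth_cont ta.1.
  by move=> x; exact: test_fun_out.
have Egg : energy3 g g = 0 by rewrite -energy3E// -(green_energy oz oz Lz wz Lz wz).
have Egq : energy3 g q = 1.
  by rewrite -energy3E// -(weak_plate B (L2_zext oo sz.1) Lz wz tp) -{1}Bs -int_zext_mul gz5.
(* With E the energy of [q], that of g + s q is 2 s + s^2 E, minimal at -1/E; adding 1 avoids a zero
   denominator and keeps the value negative. *)
pose s : R := - (energy3 q q + 1)^-1.
have Eq0 : 0 <= energy3 q q by exact: energy3_ge0.
have := energy3_ge0 Bp (fun a => L2zD (Lg a) (L2zZ s (Lq a))); rewrite energy3D//.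
rewrite (energy3_sym q g) Egg Egq add0r; move: (energy3 q q) @s Eq0 => E s Eq0 h.
have d0 : 0 < E + 1 by rewrite ltr_wpDl.
have : 0 <= (E + 1)^-1 * (E / (E + 1) - 2).
  by apply: le_trans h _; rewrite /s le_eqVlt; apply/orP; left; apply/eqP; field; rewrite gt_eqF.
rewrite pmulr_rge0 ?invr_gt0// subr_ge0 ler_pdivlMr// leNgt => /negP; apply; lra.
Qed.

End PlateGreen.

(** * Fields and the differential expression *)

Section Inner.
Variable R : realType.
Local Notation plane := (R * R)%type.
Local Notation mu := (@leb2 R).
Local Notation ig2 := (ig (@leb2 R)).
Local Notation ii2 := (ii (@leb2 R)).
Implicit Types (f g : plane -> R) (x y : plane).
Variables (omega : set plane) (M0 : R).
Hypotheses (oo : open omega) (oM : omega `<=` box 0 M0).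

Lemma L2_ext f g : (forall x, omega x -> f x = g x) -> L2 omega f -> L2 omega g.
Proof.
move=> fg Lf; have E : g \_ omega = f \_ omega.
  by apply/funext => x; have [ox|nx] := pselect (omega x);
      [rewrite !zext_in// fg|rewrite !zext_out].
have := L2z_L2 oo (L2_zext oo Lf); rewrite -E => -[mg Ig].
have mo := open_measurable2 oo.
split.
  move: mg; apply: eq_measurable_fun => x; rewrite inE => ox; exact: zext_in.
apply: eq_integrable Ig => // x; rewrite inE => ox; by rewrite zext_in.
Qed.

Lemma L2_of_zext f : L2z omega (f \_ omega) -> L2 omega f.
Proof. by move=> /(L2z_L2 oo); apply: L2_ext => x ox; exact: zext_in. Qed.

Lemma zextD f g : (fun y => f y + g y) \_ omega = (fun x => (f \_ omega) x + (g \_ omega) x).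
Proof.
apply/funext => x; have [ox|nx] := pselect (omega x); first by rewrite !zext_in.
by rewrite !zext_out// addr0.
Qed.

Lemma zextZ (k : R) f : (fun y => k * f y) \_ omega = (fun x => k * (f \_ omega) x).
Proof.
apply/funext => x; have [ox|nx] := pselect (omega x); first by rewrite !zext_in.
by rewrite !zext_out// mulr0.
Qed.

Lemma L2D f g : L2 omega f -> L2 omega g -> L2 omega (fun y => f y + g y).
Proof.
by move=> Lf Lg; apply: L2_of_zext; rewrite zextD; exact: L2zD (L2_zext oo Lf) (L2_zext oo Lg).
Qed.

Lemma L2Z (k : R) f : L2 omega f -> L2 omega (fun y => k * f y).
Proof. by move=> Lf; apply: L2_of_zext; rewrite zextZ; exact: L2zZ (L2_zext oo Lf). Qed.

Lemma L2_test f : test_fun omega f -> L2 omega f.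
Proof.
move=> tf; apply: L2z_L2 => //; apply: (L2z_continuous oM); first exact: smooth_cont tf.1.
by move=> x; exact: test_fun_out.
Qed.

Lemma zext_test f : test_fun omega f -> f \_ omega = f.
Proof.
move=> tf; apply/funext => x; have [ox|nx] := pselect (omega x); first by rewrite zext_in.
by rewrite zext_out// (test_fun_out tf).
Qed.

Variable n : nat.
Implicit Types (u v w : plane -> 'cV[R]_n) (i : 'I_n).

Definition L2v v := forall i, L2 omega (entry v i).

Lemma innerE u v : L2v u -> L2v v ->
  inner omega u v = \sum_i ii2 (fun x => (entry u i \_ omega) x * (entry v i \_ omega) x).
Proof.
move=> Lu Lv; rewrite /inner int_zext.
have J i : ig2 (fun x => (entry u i \_ omega) x * (entry v i \_ omega) x).
  by apply: (ig_L2z_mul (omega := omega)); exact: L2_zext.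
transitivity (ii2 (fun x => \sum_i 1 * ((entry u i \_ omega) x * (entry v i \_ omega) x)));
    last first.
  by rewrite ii_sum//; apply: eq_bigr => i _; rewrite mul1r.
congr ii; apply/funext => x; have [ox|nx] := pselect (omega x).
  by rewrite zext_in//; apply: eq_bigr => i _; rewrite mul1r !zext_in.
by rewrite zext_out// big1// => i _; rewrite !zext_out// !mulr0.
Qed.

Lemma inner_sym u v : inner omega u v = inner omega v u.
Proof.
rewrite /inner !int_zext; congr ii; congr (_ \_ omega); apply/funext => y.
by apply: eq_bigr => i _; exact: mulrC.
Qed.

Lemma L2vD u v : L2v u -> L2v v -> L2v (fun y => u y + v y).
Proof.
move=> Lu Lv i; rewrite (_ : entry _ i = (fun y => entry u i y + entry v i y)); first exact: L2D.
by apply/funext => y; rewrite /entry mxE.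
Qed.

Lemma L2vZ (k : R) u : L2v u -> L2v (fun y => k *: u y).
Proof.
move=> Lu i; rewrite (_ : entry _ i = (fun y => k * entry u i y)); first exact: L2Z.
by apply/funext => y; rewrite /entry mxE.
Qed.

Lemma innerDl u v w : L2v u -> L2v v -> L2v w ->
  inner omega (fun y => u y + v y) w = inner omega u w + inner omega v w.
Proof.
move=> Lu Lv Lw; rewrite (innerE (L2vD Lu Lv) Lw) !innerE// -big_split; apply: eq_bigr => i _ /=.
have Zu := L2_zext oo (Lu i); have Zv := L2_zext oo (Lv i); have Zw := L2_zext oo (Lw i).
rewrite -(iiD (ig_L2z_mul Zu Zw) (ig_L2z_mul Zv Zw)); congr ii; apply/funext => x.
rewrite (_ : entry (fun y => u y + v y) i = (fun y => entry u i y + entry v i y)).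
  by rewrite zextD mulrDl.
by apply/funext => y; rewrite /entry mxE.
Qed.

Lemma innerZl (k : R) u w : L2v u -> L2v w -> inner omega (fun y => k *: u y) w =
    k * inner omega u w.
Proof.
move=> Lu Lw; rewrite (innerE (L2vZ k Lu) Lw) innerE// mulr_sumr; apply: eq_bigr => i _ /=.
have Zu := L2_zext oo (Lu i); have Zw := L2_zext oo (Lw i).
rewrite -(iiZ k (ig_L2z_mul Zu Zw)); congr ii; apply/funext => x.
rewrite (_ : entry (fun y => k *: u y) i = (fun y => k * entry u i y));
    first by rewrite zextZ mulrA.
by apply/funext => y; rewrite /entry mxE.
Qed.

Lemma innerDr u v w : L2v u -> L2v v -> L2v w ->
  inner omega w (fun y => u y + v y) = inner omega w u + inner omega w v.
Proof. by move=> Lu Lv Lw; rewrite !(inner_sym w) innerDl. Qed.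

Lemma innerZr (k : R) u w : L2v u -> L2v w -> inner omega w (fun y => k *: u y) =
    k * inner omega w u.
Proof. by move=> Lu Lw; rewrite !(inner_sym w) innerZl. Qed.

Lemma inner_ge0 u : 0 <= inner omega u u.
Proof.
rewrite /inner int_zext; apply: ii_ge0 => x; have [ox|nx] := pselect (omega x).
  by rewrite zext_in//; apply: sumr_ge0 => i _; rewrite -expr2 sqr_ge0.
by rewrite zext_out.
Qed.

Lemma ae_imp (P Q : plane -> Prop) : (forall x, P x -> Q x) ->
  {ae mu, forall x, P x} -> {ae mu, forall x, Q x}.
Proof.
by move=> PQ [A [mA A0 PA]]; exists A; split => // x nQ; apply: PA => Px; apply: nQ; exact: PQ.
Qed.

Lemma ii_ae f g : measurable_fun setT f -> measurable_fun setT g -> {ae mu, forall x, f x = g x} ->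
  ii2 f = ii2 g.
Proof.
move=> mf mg fg; rewrite /ii /Rintegral; congr fine; apply: ae_eq_integral => //.
- exact/measurable_EFinP.
- exact/measurable_EFinP.
- by apply: ae_imp fg => x /= -> _.
Qed.

Lemma inner_ae u v w : L2v u -> L2v v -> L2v w -> {ae mu, forall y, omega y -> u y = v y} ->
  inner omega u w = inner omega v w.
Proof.
move=> Lu Lv Lw uv; rewrite !innerE//; apply: eq_bigr => i _.
have [mu_ _ _] := L2_zext oo (Lu i); have [mv _ _] := L2_zext oo (Lv i);
    have [mw _ _] := L2_zext oo (Lw i).
apply: ii_ae; [exact: measurable_funM|exact: measurable_funM|].
apply: ae_imp uv => x uvx; have [ox|nx] := pselect (omega x); last by rewrite !zext_out// !mul0r.
by rewrite !zext_in// /entry uvx.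
Qed.

Lemma inner_ext u v u' v' : (forall y, omega y -> u y = u' y) ->
    (forall y, omega y -> v y = v' y) ->
  inner omega u v = inner omega u' v'.
Proof.
move=> h h'; rewrite /inner !int_zext; congr ii; apply/funext => x.
have [ox|nx] := pselect (omega x); last by rewrite !zext_out.
by rewrite !zext_in// h// h'.
Qed.

Lemma L2v_ext u v : (forall y, omega y -> u y = v y) -> L2v u -> L2v v.
Proof. by move=> uv Lu i; apply: L2_ext (Lu i) => x ox; rewrite /entry uv. Qed.

End Inner.

Section ByParts.
Variable R : realType.
Local Notation plane := (R * R)%type.
Local Notation ii2 := (ii (@leb2 R)).
Implicit Types (phi psi : plane -> R) (i j : 'I_2) (s : seq 'I_2).

Lemma by_parts phi psi i : kern phi -> kern psi ->
  ii2 (fun x => phi x * pd i psi x) = - ii2 (fun x => pd i phi x * psi x).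
Proof.
move=> kp kq; have [sp [M M0 p0]] := kp; have [sq _] := kq.
have kp' := kern_pd i kp; have kq' := kern_pd i kq.
have D x := is_derive_mul (smooth_is_derive sp x i) (smooth_is_derive sq x i).
have c1 := smooth_cont (smoothD (smoothM (smooth_pd i sp) sq) (smoothM sp (smooth_pd i sq))).
have B x : ~ box 0 M x -> phi x * psi x = 0 by move=> /p0 ->; rewrite mul0r.
have := ii_derive_eq0 D c1 B; rewrite iiD; [|exact: ig_mul_kern (ig_kern kp') kq|exact: ig_mul_kern
    (ig_kern kp) kq'].
by move=> /eqP; rewrite addrC addr_eq0 => /eqP.
Qed.

Lemma by_parts_pds phi psi s : kern phi -> kern psi ->
  ii2 (fun x => phi x * pds s psi x) = (-1) ^+ size s * ii2 (fun x => pds (rev s) phi x * psi x).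
Proof.
elim: s phi => [|i s IH] phi kp kq; first by rewrite mul1r.
rewrite (by_parts i kp (kern_pds s kq)) (IH _ (kern_pd i kp) kq) rev_cons pds_rcons exprS mulN1r.
by rewrite mulNr.
Qed.

End ByParts.

Section Operator.
Variable R : realType.
Local Notation plane := (R * R)%type.
Implicit Types (phi psi : plane -> R) (i j : 'I_2) (a b : 'I_2) (m n : 'I_3) (C B : 'M[R]_3)
    (x y : plane).

(** Coefficient of d_a u_i in row [m] of D'(nabla) u. *)
Definition d1 m i a : R :=
  [:: ((i == 0) && (a == 0))%:R; ((i == 1) && (a == 1))%:R; (Num.sqrt 2)^-1 * (i != a)%:R]`_m.

(** Coefficient of d_a d_b u_j in component [i] of L' u; the minus sign is that of D'(-nabla). *)
Definition q2 C i j a b : R := - \sum_m \sum_n d1 m i a * C m n * d1 n j b.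

Lemma DprimeE (u : plane -> 'cV[R]_2) y : Dprime u y =
    \col_m \sum_i \sum_a d1 m i a * pd a (entry u i) y.
Proof.
apply/colP => m; rewrite !mxE sum22; case: (ord3P m) => -> //=;
  rewrite /d1 /= ?mul1r ?mul0r ?addr0 ?add0r ?mulr0 ?mul0r ?mulr1 ?add0r ?addr0 //.
Qed.

Lemma Dprime_negTE (s : plane -> 'cV[R]_3) y : Dprime_negT s y =
    \col_i - \sum_m \sum_a d1 m i a * pd a (entry s m) y.
Proof.
apply/colP => i; rewrite !mxE sum3 !sum2; case: (ord2P i) => -> //=;
  rewrite /d1 /= ?mul1r ?mul0r ?addr0 ?add0r ?mulr0 ?mul0r ?mulr1 ?add0r ?addr0 //;
  by rewrite opprD.
Qed.

Lemma q2T C i j a b : q2 C^T i j a b = q2 C j i b a.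
Proof.
rewrite /q2 exchange_big; congr (- _); apply: eq_bigr => n _; apply: eq_bigr => m _ /=.
by rewrite mxE mulrC [d1 m i a * _]mulrC mulrA.
Qed.

Lemma five_sums (X : 'I_3 -> 'I_2 -> 'I_3 -> 'I_2 -> 'I_2 -> R) :
  \sum_m \sum_a \sum_n \sum_j \sum_b X m a n j b = \sum_j \sum_a \sum_b \sum_m \sum_n X m a n j b.
Proof.
rewrite exchange_big exchange_big /=.
transitivity (\sum_a \sum_j \sum_b \sum_m \sum_n X m a n j b); last exact: exchange_big.
rewrite exchange_big; apply: eq_bigr => a _ /=.
transitivity (\sum_m \sum_j \sum_b \sum_n X m a n j b).
  apply: eq_bigr => m _; rewrite exchange_big; apply: eq_bigr => j _; exact: exchange_big.
rewrite exchange_big; apply: eq_bigr => j _; exact: exchange_big.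
Qed.

Lemma LprimeE C (phi : plane -> 'cV[R]_2) y i : (forall j, smooth (entry phi j)) ->
  Lprime C phi y i 0 = \sum_j \sum_a \sum_b q2 C i j a b * pds [:: a; b] (entry phi j) y.
Proof.
move=> sp; rewrite /Lprime Dprime_negTE mxE.
have S1 n j : smooth (fun z => \sum_b d1 n j b * pd b (entry phi j) z).
  by apply: smooth_sum => b; exact: smooth_pd.
have S2 n : smooth (fun z => \sum_j 1 * \sum_b d1 n j b * pd b (entry phi j) z).
  by apply: smooth_sum => j; exact: S1.
have E m a : pd a (entry (fun z => C *m Dprime phi z) m) y =
    \sum_n \sum_j \sum_b C m n * d1 n j b * pds [:: a; b] (entry phi j) y.
  have -> : entry (fun z => C *m Dprime phi z) m =
      (fun z => \sum_n C m n * (\sum_j 1 * (\sum_b d1 n j b * pd b (entry phi j) z))).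
    apply/funext => z; rewrite /entry mxE; apply: eq_bigr => n _; rewrite DprimeE mxE;
        congr (_ * _).
    by apply: eq_bigr => j _; rewrite mul1r.
  rewrite -[pd a _]/(pds [:: a] _) (pds_sum _ _ S2); apply: eq_bigr => n _.
  rewrite (pds_sum _ _ (S1 n)) mulr_sumr; apply: eq_bigr => j _.
  rewrite mul1r (pds_sum _ _ (fun b => smooth_pd b (sp j))) mulr_sumr; apply: eq_bigr => b _.
  by rewrite mulrA.
transitivity (- \sum_m \sum_a \sum_n \sum_j \sum_b d1 m i a * C m n * d1 n j b * pds [:: a; b]
    (entry phi j) y).
  congr (- _); apply: eq_bigr => m _; apply: eq_bigr => a _; rewrite E.
  rewrite mulr_sumr; apply: eq_bigr => n _; rewrite mulr_sumr; apply: eq_bigr => j _.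
  by rewrite mulr_sumr; apply: eq_bigr => b _; rewrite !mulrA.
rewrite five_sums -sumrN; apply: eq_bigr => j _; rewrite -sumrN; apply: eq_bigr => a _.
rewrite -sumrN; apply: eq_bigr => b _; rewrite /q2 mulNr mulr_suml; congr (- _).
by apply: eq_bigr => m _; rewrite mulr_suml.
Qed.

End Operator.

Section Fields.
Variable R : realType.
Local Notation plane := (R * R)%type.
Local Notation vfield := (vfield R).
Local Notation ig2 := (ig (@leb2 R)).
Local Notation ii2 := (ii (@leb2 R)).
Implicit Types (f g : plane -> R) (x y : plane) (u v w phi psi : vfield) (C B : 'M[R]_3)
    (U : set plane).

Lemma ord21_ind (P : 'I_(2 + 1) -> Prop) : (forall j : 'I_2, P (lshift 1 j)) -> P (rshift 2 0) ->
    forall i, P i.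
Proof.
by move=> P1 P2 i; case: (split_ordP i) => j ->; [exact: P1|rewrite (ord1 j)].
Qed.

Lemma sum21 (F : 'I_(2 + 1) -> R) : \sum_i F i = \sum_(j < 2) F (lshift 1 j) + F (rshift 2 0).
Proof. by rewrite big_split_ord big_ord1. Qed.

Definition testv U phi := forall i, test_fun U (entry phi i).

Lemma test_sum n U (c : 'I_n -> R) (F : 'I_n -> plane -> R) : (forall i, test_fun U (F i)) ->
  test_fun U (fun x => \sum_i c i * F i x).
Proof.
elim: n c F => [|n IH] c F tF.
  have -> : (fun x => \sum_(i < 0) c i * F i x) = (fun=> 0) by apply/funext => x; rewrite big_ord0.
  exact: test_fun0.
have -> : (fun x => \sum_i c i * F i x) = (fun x => c ord0 * F ord0 x +
    \sum_i c (lift ord0 i) * F (lift ord0 i) x).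
  by apply/funext => x; rewrite big_ord_recl.
by apply: test_funD; [exact: test_funZ|exact: IH].
Qed.

(** The factors [1 *] give each level of the sum the shape of a linear combination, so that the
    lemmas on combinations apply level by level. *)
Lemma Lfull_entry1 C phi i : (forall i, smooth (entry phi i)) -> entry (Lfull C phi) (lshift 1 i) =
  (fun y => \sum_j 1 * \sum_a 1 * \sum_b q2 C i j a b * pds [:: a; b] (entry phi (lshift 1 j)) y).
Proof.
move=> sp; apply/funext => y; rewrite /entry /Lfull col_mxEu.
have E j : entry (fun z => usubmx (phi z)) j = entry phi (lshift 1 j).
  by apply/funext => z; rewrite /entry mxE.
rewrite LprimeE; last by move=> j; rewrite E.
by apply: eq_bigr => j _; rewrite mul1r; apply: eq_bigr => a _; rewrite mul1r E.
Qed.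

Lemma Lfull_entry3 C phi : (forall i, smooth (entry phi i)) -> entry3 (Lfull C phi) =
  (fun y => \sum_a 1 * \sum_b c3 C a b * pds (s3 a ++ s3 b) (entry3 phi) y).
Proof.
move=> sp; apply/funext => y; rewrite /entry3 /entry /Lfull col_mxEd mxE L3E;
    last exact: (sp (rshift 2 0)).
by rewrite mulr1n; apply: eq_bigr => a _; rewrite mul1r.
Qed.

Lemma Lfull_test U C phi : testv U phi -> testv U (Lfull C phi).
Proof.
move=> tp; have sp i := (tp i).1; apply: ord21_ind => [i|].
  rewrite (Lfull_entry1 C i sp); apply: test_sum => j; apply: test_sum => a; apply: test_sum => b.
  exact: (test_pds [:: a; b] (tp (lshift 1 j))).
rewrite -[entry _ _]/(entry3 (Lfull C phi)) (Lfull_entry3 C sp); apply: test_sum => a;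
    apply: test_sum => b.
exact: (test_pds (s3 a ++ s3 b) (tp (rshift 2 0))).
Qed.

Variables (omega : set plane) (M0 : R).
Hypotheses (oo : open omega) (oM : omega `<=` box 0 M0).

Lemma L2v_test phi : testv omega phi -> L2v omega phi.
Proof. by move=> tp i; exact: L2_test oo oM _ (tp i). Qed.

Lemma inner_test u phi : L2v omega u -> testv omega phi -> inner omega u phi =
  \sum_j ii2 (fun x => (entry u (lshift 1 j) \_ omega) x * entry phi (lshift 1 j) x) +
  ii2 (fun x => (entry3 u \_ omega) x * entry3 phi x).
Proof.
move=> Lu tp; rewrite (innerE oo Lu (L2v_test tp)) sum21; congr (_ + _).
  by apply: eq_bigr => j _; rewrite (zext_test (tp _)).
by rewrite (zext_test (tp _)).
Qed.

Definition mkfield (f1 : 'I_2 -> plane -> R) (f3 : plane -> R) : vfield :=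
  fun y => col_mx (\col_j f1 j y) (f3 y)%:M.

Lemma entry_mkfield1 (f1 : 'I_2 -> plane -> R) f3 j : entry (mkfield f1 f3) (lshift 1 j) = f1 j.
Proof. by apply/funext => y; rewrite /entry col_mxEu mxE. Qed.

Lemma entry_mkfield3 (f1 : 'I_2 -> plane -> R) f3 : entry (mkfield f1 f3) (rshift 2 0) = f3.
Proof. by apply/funext => y; rewrite /entry col_mxEd mxE mulr1n. Qed.

Section WeakDerivatives.
Variables (w : vfield) (W : 'I_2 -> 'I_2 -> 'I_2 -> plane -> R) (W3 : 'I_3 -> 'I_3 -> plane -> R)
    (C : 'M[R]_3).
Hypotheses (Lw : L2v omega w) (LW : forall i a b, L2z omega (W i a b))
    (LW3 : forall a b, L2z omega (W3 a b)).
Hypothesis wW : forall i a b, wd omega [:: a; b] (entry w (lshift 1 i) \_ omega) (W i a b).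
Hypothesis wW3 : forall a b, wd omega (s3 a ++ s3 b) (entry3 w \_ omega) (W3 a b).

(** The formal transpose of L with matrix [C], evaluated on the weak derivatives of [w]: compared
    with [Lfull_entry1], the roles of [i] and [j] are exchanged. The orders 2 and 4 are even, so no
    sign appears. *)
Definition weakL : vfield := mkfield
  (fun j y => \sum_i 1 * \sum_a 1 * \sum_b q2 C i j a b * W i a b y)
  (fun y => \sum_a 1 * \sum_b c3 C a b * W3 a b y).

Lemma L2v_weakL : L2v omega weakL.
Proof.
apply: ord21_ind => [j|].
  rewrite entry_mkfield1; apply: L2z_L2 => //; apply: L2z_sum => i; apply: L2z_sum => a;
      exact: L2z_sum.
rewrite entry_mkfield3; apply: L2z_L2 => //; apply: L2z_sum => a; exact: L2z_sum.
Qed.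

Lemma ii_mul_sum n (f : plane -> R) (c : 'I_n -> R) (F : 'I_n -> plane -> R) :
  (forall i, ig2 (fun x => f x * F i x)) ->
  ii2 (fun x => f x * \sum_i c i * F i x) = \sum_i c i * ii2 (fun x => f x * F i x).
Proof.
move=> I; rewrite -ii_sum//; congr ii; apply/funext => x.
by rewrite mulr_sumr; apply: eq_bigr => i _; rewrite mulrCA.
Qed.

Lemma ig_mul_sum n (f : plane -> R) (c : 'I_n -> R) (F : 'I_n -> plane -> R) :
  (forall i, ig2 (fun x => f x * F i x)) -> ig2 (fun x => f x * \sum_i c i * F i x).
Proof.
move=> I; rewrite (_ : (fun x => _) = (fun x => \sum_i c i * (f x * F i x))); first exact: ig_sum.
by apply/funext => x; rewrite mulr_sumr; apply: eq_bigr => i _; rewrite mulrCA.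
Qed.

Lemma weakLE phi : testv omega phi -> inner omega w (Lfull C phi) = inner omega weakL phi.
Proof.
move=> tp; have sp i := (tp i).1; have tk i : kern (entry phi i) := test_kern (tp i).
rewrite (inner_test Lw (Lfull_test C tp)) (inner_test L2v_weakL tp).
have zW j : entry weakL (lshift 1 j) \_ omega =
    (fun y => \sum_i 1 * \sum_a 1 * \sum_b q2 C i j a b * W i a b y).
  rewrite entry_mkfield1; apply/funext => x; have [ox|nx] := pselect (omega x);
      first by rewrite zext_in.
  rewrite zext_out// big1// => i _; rewrite big1 ?mulr0// => a _; rewrite big1 ?mulr0// => b _.
  by have [_ _ ->] := LW i a b => //; rewrite mulr0.
have zW3 : entry3 weakL \_ omega = (fun y => \sum_a 1 * \sum_b c3 C a b * W3 a b y).
  rewrite /entry3 entry_mkfield3; apply/funext => x; have [ox|nx] := pselect (omega x);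
      first by rewrite zext_in.
  rewrite zext_out// big1// => a _; rewrite big1 ?mulr0// => b _.
  by have [_ _ ->] := LW3 a b => //; rewrite mulr0.
congr (_ + _); last first.
  rewrite zW3 (Lfull_entry3 C sp).
  have I3 : ig2 (entry3 w \_ omega) := ig_L2z oo oM (L2_zext oo (Lw _)).
  have J a b : ig2 (fun x => (entry3 w \_ omega) x * pds (s3 a ++ s3 b) (entry3 phi) x).
    exact: ig_mul_kern I3 (kern_pds _ (tk (rshift 2 0))).
  rewrite ii_mul_sum; last by move=> a; apply: ig_mul_sum.
  have J' a b : ig2 (fun x => entry3 phi x * W3 a b x).
    have := ig_mul_kern (ig_L2z oo oM (LW3 a b)) (tk (rshift 2 0)).
    by rewrite (_ : (fun x => _) = (fun x => entry3 phi x * W3 a b x))//; apply/funext => x;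
        exact: mulrC.
  transitivity (ii2 (fun x => entry3 phi x * \sum_a 1 * \sum_b c3 C a b * W3 a b x)); last first.
    by congr ii; apply/funext => x; exact: mulrC.
  rewrite ii_mul_sum; last by move=> a; apply: ig_mul_sum.
  apply: eq_bigr => a _; rewrite !mul1r ii_mul_sum// ii_mul_sum//; apply: eq_bigr => b _.
  have := wW3 a b (tp (rshift 2 0)); rewrite -/(entry3 phi) size_cat /= -signr_odd /= mul1r => ->.
  by rewrite (_ : (fun x => W3 a b x * _) = (fun x => entry3 phi x * W3 a b x))//;
      apply/funext => x; exact: mulrC.
have I1 i : ig2 (entry w (lshift 1 i) \_ omega) := ig_L2z oo oM (L2_zext oo (Lw _)).
have J i j a b : ig2 (fun x => (entry w (lshift 1 i) \_ omega) x * pds [:: a; b]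
    (entry phi (lshift 1 j)) x).
  exact: ig_mul_kern (I1 i) (kern_pds _ (tk _)).
have J' i j a b : ig2 (fun x => entry phi (lshift 1 j) x * W i a b x).
  have := ig_mul_kern (ig_L2z oo oM (LW i a b)) (tk (lshift 1 j)).
  by rewrite (_ : (fun x => _) = (fun x => entry phi (lshift 1 j) x * W i a b x))//;
      apply/funext => x; exact: mulrC.
transitivity (\sum_i \sum_j \sum_a \sum_b q2 C i j a b *
    ii2 (fun x => (entry w (lshift 1 i) \_ omega) x * pds [:: a; b] (entry phi (lshift 1 j)) x)).
  apply: eq_bigr => i _; rewrite (Lfull_entry1 C i sp).
  rewrite ii_mul_sum; last by move=> j; apply: ig_mul_sum => a; apply: ig_mul_sum.
  apply: eq_bigr => j _; rewrite mul1r ii_mul_sum; last by move=> a; apply: ig_mul_sum.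
  by apply: eq_bigr => a _; rewrite mul1r ii_mul_sum.
rewrite exchange_big; apply: eq_bigr => j _ /=; rewrite zW.
transitivity (ii2 (fun x => entry phi (lshift 1 j) x * \sum_i 1 * \sum_a 1 * \sum_b q2 C i j a b *
    W i a b x)); last first.
  by congr ii; apply/funext => x; exact: mulrC.
rewrite ii_mul_sum; last by move=> i; apply: ig_mul_sum => a; apply: ig_mul_sum.
apply: eq_bigr => i _; rewrite mul1r ii_mul_sum; last by move=> a; apply: ig_mul_sum.
apply: eq_bigr => a _; rewrite mul1r ii_mul_sum//; apply: eq_bigr => b _.
have := wW i a b (tp (lshift 1 j)); rewrite sqrrN expr1n mul1r => ->.
by rewrite (_ : (fun x => W i a b x * _) = (fun x => entry phi (lshift 1 j) x * W i a b x))//;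
    apply/funext => x; exact: mulrC.
Qed.

End WeakDerivatives.

Lemma sobolev_wd k f s : sobolev omega k f -> (size s <= k)%N ->
  exists2 g, L2z omega g & wd omega s (f \_ omega) g.
Proof.
move=> [_ H] sk; have [g Lg wg] := H s sk; exists (g \_ omega); first exact: L2_zext.
by apply: (weak_zext _ _ _ _).1.
Qed.

Lemma regD_L2v w : regD omega w -> L2v omega w.
Proof. by move=> [H1 H3 _ _ _]; apply: ord21_ind => [j|]; [exact: (H1 j).1.1|exact: H3.1]. Qed.

(** The Sobolev orders 2 and 4 are those of the two blocks of L, so L w is in L^2. Thus a regular
    field with zero jet at O belongs to the domain of A. *)
Lemma regD_distr B w : regD omega w -> exists2 f, L2f omega f & distr_eq B omega w f.
Proof.
move=> rw; have [H1 H3 _ _ _] := rw; have Lw := regD_L2v rw.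
have [W HW] := choice (fun q : 'I_2 * 'I_2 * 'I_2 =>
  let: ex_intro2 g a b := sobolev_wd (s := [:: q.1.2; q.2]) (H1 q.1.1).1 isT in
  ex_intro (fun g => L2z omega g /\ wd omega [:: q.1.2; q.2] (entry w (lshift 1 q.1.1) \_ omega) g)
      g (conj a b)).
have [W3 HW3] := choice (fun q : 'I_3 * 'I_3 =>
  let: ex_intro2 g a b := sobolev_wd (s := s3 q.1 ++ s3 q.2) H3 isT in
  ex_intro (fun g => L2z omega g /\ wd omega (s3 q.1 ++ s3 q.2) (entry3 w \_ omega) g) g
      (conj a b)).
exists (weakL (fun i a b => W (i, a, b)) (fun a b => W3 (a, b)) B^T).
  exact: (L2v_weakL B^T (fun i a b => (HW (i, a, b)).1) (fun a b => (HW3 (a, b)).1)).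
move=> phi tp; apply: weakLE => //.
- by move=> i a b; exact: (HW (i, a, b)).1.
- by move=> a b; exact: (HW3 (a, b)).1.
- by move=> i a b; exact: (HW (i, a, b)).2.
- by move=> a b; exact: (HW3 (a, b)).2.
Qed.

End Fields.

Section TestFields.
Variable R : realType.
Local Notation plane := (R * R)%type.
Local Notation vfield := (vfield R).
Local Notation ig2 := (ig (@leb2 R)).
Local Notation ii2 := (ii (@leb2 R)).
Implicit Types (f g : plane -> R) (x y p : plane) (u v w phi psi : vfield) (B : 'M[R]_3)
    (U : set plane) (i j : 'I_2).

Lemma sum_swap n (X Y : 'I_n -> 'I_n -> R) : (forall a b, X a b = Y b a) ->
  \sum_a 1 * \sum_b X a b = \sum_a 1 * \sum_b Y a b.
Proof.
move=> XY; transitivity (\sum_a \sum_b Y b a).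
  by apply: eq_bigr => a _; rewrite mul1r; apply: eq_bigr => b _.
by rewrite exchange_big; apply: eq_bigr => a _; rewrite mul1r.
Qed.

(** Reversal swaps the two blocks and reverses each of them; within a block only the mixed pair is
    affected, where [pd_comm] applies. *)
Lemma pds_rev_s3 (a b : 'I_3) f : smooth f -> pds (rev (s3 a ++ s3 b)) f = pds (s3 b ++ s3 a) f.
Proof.
move=> sf; have E (c : 'I_3) g : smooth g -> pds (rev (s3 c)) g = pds (s3 c) g.
  move=> sg; case: (ord3P c) => ->.
  - exact: (erefl (pds [:: 0; 0] g)).
  - exact: (erefl (pds [:: 1; 1] g)).
  - exact: (esym (pd_comm sg)).
by rewrite rev_cat !pds_cat (E b _ (smooth_pds _ sf)) (E a _ sf).
Qed.

Lemma test_near0 U f p : test_fun U f -> ~ U p -> \near p, f p = 0.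
Proof.
move=> [_ [K [cK KU K0]]] np; have cKo : open (~` K).
  by apply: closed_openC; apply: compact_closed => //; exact: norm_hausdorff.
have nK : (~` K) p by move=> /KU.
by apply: filterS (open_nbhs_nbhs (conj cKo nK)) => y; exact: K0.
Qed.

Variables (omega : set plane) (M0 : R).
Hypotheses (oo : open omega) (oM : omega `<=` box 0 M0).

(** Classical derivatives are weak ones with the list reversed, which puts [weakLE] at disposal;
    transposing the coefficients compensates for the reversal. *)
Lemma test_Lfull B phi psi : testv omega phi -> testv omega psi ->
  inner omega phi (Lfull B^T psi) = inner omega (Lfull B phi) psi.
Proof.
move=> tp tq; have sp (i : 'I_(2 + 1)) := (tp i).1;
    have tk (i : 'I_(2 + 1)) : kern (entry phi i) := test_kern (tp i).
have Lp := L2v_test oo oM tp.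
pose W i (a b : 'I_2) := pds [:: b; a] (entry phi (lshift 1 i)).
pose W3 (a b : 'I_3) := pds (s3 b ++ s3 a) (entry3 phi).
have LT f : test_fun omega f -> L2z omega f.
  by move=> tf; rewrite -(zext_test tf); apply: (L2_zext oo); exact: (L2_test oo oM tf).
have LW i a b : L2z omega (W i a b) by apply: LT; exact: (test_pds _ (tp (lshift 1 i))).
have LW3 a b : L2z omega (W3 a b) by apply: LT; exact: (test_pds _ (tp (rshift 2 0))).
have wW i a b : wd omega [:: a; b] (entry phi (lshift 1 i) \_ omega) (W i a b).
  by move=> h th; rewrite (zext_test (tp _)) (by_parts_pds _ (tk _) (test_kern th)).
have wW3 a b : wd omega (s3 a ++ s3 b) (entry3 phi \_ omega) (W3 a b).
  move=> h th; rewrite (zext_test (tp _)) (by_parts_pds _ (tk _) (test_kern th)).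
  by rewrite (pds_rev_s3 _ _ (sp (rshift 2 0))).
rewrite (weakLE oo oM B^T Lp LW LW3 wW wW3 tq); apply: inner_ext => // y _.
apply/colP; apply: ord21_ind => [j|].
  rewrite -[LHS]/(entry (weakL W W3 B^T) (lshift 1 j) y)
      -[RHS]/(entry (Lfull B phi) (lshift 1 j) y).
  rewrite /weakL entry_mkfield1 (Lfull_entry1 B j sp); apply: eq_bigr => i _.
  apply: (congr1 ( *%R 1)); apply: sum_swap => a b.
  by rewrite q2T.
rewrite -[LHS]/(entry (weakL W W3 B^T) (rshift 2 0) y) -[RHS]/(entry3 (Lfull B phi) y).
rewrite /weakL entry_mkfield3 (Lfull_entry3 B sp).
apply: sum_swap => a b.
by rewrite /c3 mxE [k3 R b * _]mulrC.
Qed.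

Lemma sobolev_test k f : test_fun omega f -> sobolev omega k f.
Proof.
move=> tf; split; first exact: (L2_test oo oM tf).
move=> s _; have tp := test_pds (rev s) tf; exists (pds (rev s) f); first exact: (L2_test oo oM tp).
apply: (weak_zext _ _ _ _).2; rewrite (zext_test tf) (zext_test tp) => psi tpsi.
exact: (by_parts_pds s (test_kern tf) (test_kern tpsi)).
Qed.

Lemma C0bar_continuous f : continuous f -> C0bar omega f.
Proof. exact: continuous_subspaceT. Qed.

Lemma C1bar_test f : test_fun omega f -> C1bar omega f.
Proof.
move=> tf; split; first exact: (C0bar_continuous (smooth_cont tf.1)).
move=> i; split=> [y _|]; first exact: (is_derive_derivable (smooth_is_derive tf.1 y i)).
by exists (pd i f) => //; exact: (C0bar_continuous (smooth_cont (smooth_pd i tf.1))).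
Qed.

Lemma dnormal0_test f : test_fun omega f -> dnormal0 omega f.
Proof.
move=> tf p n bp _; apply: (@cvg_trans _ ((fun=> 0 : R) @ within omega (nbhs p))).
  apply: near_eq_cvg; rewrite near_withinE.
  have h0 := test_near0 (test_pds [:: 0] tf) (bdry_notin oo bp).
  have h1 := test_near0 (test_pds [:: 1] tf) (bdry_notin oo bp).
  apply: filterS2 h0 h1 => y e0 e1 _; rewrite sum2.
  by rewrite -[pd 0 f y]/(pds [:: 0] f y) -[pd 1 f y]/(pds [:: 1] f y) e0 e1 !mulr0 addr0.
exact: cvg_cst.
Qed.

Lemma regD_test phi : testv omega phi -> regD omega phi.
Proof.
move=> tp; split.
- by move=> i; split; [exact: (sobolev_test _ (tp _))|exact:
    (C0bar_continuous (smooth_cont (tp _).1))].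
- exact: (sobolev_test _ (tp _)).
- exact: (C1bar_test (tp _)).
- move=> p bp; apply/colP => i; rewrite [RHS]mxE.
  exact: (test_fun_out (tp i) (bdry_notin oo bp)).
- exact: (dnormal0_test (tp _)).
Qed.

Lemma zextB f g : (fun y => f y - g y) \_ omega = (fun x => (f \_ omega) x - (g \_ omega) x).
Proof.
apply/funext => x; have [ox|nx] := pselect (omega x); first by rewrite !zext_in.
by rewrite !zext_out// subr0.
Qed.

Lemma L2B f g : L2 omega f -> L2 omega g -> L2 omega (fun y => f y - g y).
Proof.
move=> Lf Lg; rewrite (_ : (fun y => _) = (fun y => f y + - 1 * g y)).
  exact: (L2D oo Lf (L2Z oo (-1) Lg)).
by apply/funext => y; rewrite mulN1r.
Qed.

Lemma sobolevB k f g : sobolev omega k f -> sobolev omega k g ->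
    sobolev omega k (fun y => f y - g y).
Proof.
move=> [Lf Hf] [Lg Hg]; split; first exact: L2B.
move=> s sk; have [f' Lf' wf] := Hf s sk; have [g' Lg' wg] := Hg s sk.
exists (fun y => f' y - g' y); first exact: L2B.
apply: (weak_zext _ _ _ _).2 => phi tp; have kp := test_kern tp; have ks := kern_pds s kp.
rewrite !zextB.
have I h : L2 omega h -> ig2 (h \_ omega) by move=> Lh; exact: (ig_L2z oo oM (L2_zext oo Lh)).
transitivity (ii2 (fun x => (f \_ omega) x * pds s phi x - (g \_ omega) x * pds s phi x)).
  by congr ii; apply/funext => x; rewrite mulrBl.
rewrite iiB; [|exact: (ig_mul_kern (I _ Lf) ks)|exact: (ig_mul_kern (I _ Lg) ks)].
rewrite ((weak_zext _ _ _ _).1 wf _ tp) ((weak_zext _ _ _ _).1 wg _ tp) -mulrBr.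
rewrite -iiB; [|exact: (ig_mul_kern (I _ Lf') kp)|exact: (ig_mul_kern (I _ Lg') kp)].
by congr (_ * ii _ _); apply/funext => x; rewrite mulrBl.
Qed.

Lemma C0barB f g : C0bar omega f -> C0bar omega g -> C0bar omega (fun y => f y - g y).
Proof. by move=> cf cg x; apply: cvgB; [exact: cf|exact: cg]. Qed.

Lemma pdB_at f g i y : derivable f y (basis R i) -> derivable g y (basis R i) ->
  pd i (fun y => f y - g y) y = pd i f y - pd i g y.
Proof. by move=> df dg; exact: deriveB. Qed.

Lemma C1barB f g : C1bar omega f -> C1bar omega g -> C1bar omega (fun y => f y - g y).
Proof.
move=> [cf Hf] [cg Hg]; split; first exact: C0barB.
move=> i; have [df [f' cf' ef]] := Hf i; have [dg [g' cg' eg]] := Hg i; split.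
  by move=> y oy; exact: (derivableB (df y oy) (dg y oy)).
exists (fun y => f' y - g' y); first exact: C0barB.
by move=> y oy; rewrite (pdB_at (df y oy) (dg y oy)) ef// eg.
Qed.

Lemma dnormal0B f g : C1bar omega f -> C1bar omega g -> dnormal0 omega f -> dnormal0 omega g ->
  dnormal0 omega (fun y => f y - g y).
Proof.
move=> [_ Hf] [_ Hg] nf ng p n bp on; have FF : Filter (within omega (nbhs p)) by
    exact: within_filter.
have C := @cvgB _ _ _ _ FF _ _ _ _ (nf p n bp on) (ng p n bp on).
rewrite subr0 in C; apply: cvg_trans C; apply: near_eq_cvg; rewrite near_withinE.
near=> y => oy; rewrite sum2.
rewrite (pdB_at ((Hf 0).1 y oy) ((Hg 0).1 y oy)) (pdB_at ((Hf 1).1 y oy) ((Hg 1).1 y oy)).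
rewrite -[LHS]/(\sum_i n i * pd i f y - \sum_i n i * pd i g y) !sum2.
by move: (pd 0 f y) (pd 0 g y) (pd 1 f y) (pd 1 g y) => a b c d; ring.
Unshelve. all: by end_near. Qed.

Lemma regDB u v : regD omega u -> regD omega v -> regD omega (fun y => u y - v y).
Proof.
move=> [u1 u3 uC u0 un] [v1 v3 vC v0 vn].
have E (i : 'I_(2 + 1)) : entry (fun y => u y - v y) i = (fun y => entry u i y - entry v i y).
  by apply/funext => y; rewrite /entry !mxE.
split.
- move=> i; rewrite E; have [h1 h2] := u1 i; have [h3 h4] := v1 i.
  by split; [exact: sobolevB|exact: C0barB].
- by rewrite /entry3 E; exact: sobolevB.
- by rewrite /entry3 E; exact: C1barB.
- by move=> p bp; rewrite u0// v0// subrr.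
- by rewrite /entry3 E; exact: dnormal0B.
Qed.

(** Affine functions with the prescribed jet, times a bump equal to 1 near [p]. *)
Lemma test_jets (p : plane) (al : 'I_2 -> R) (a : R) (be : 'I_2 -> R) : omega p -> exists phi,
  [/\ testv omega phi, forall i, entry phi (lshift 1 i) p = al i, entry3 phi p = a &
      forall i, pd i (entry3 phi) p = be i].
Proof.
move=> op; have [r r0 rO] := nbhs_boxP (open_nbhs_nbhs (conj oo op)).
have r2 : 0 < r / 2 by rewrite divr_gt0.
pose b := bump2 p (r / 2); have sb : smooth b by exact: smooth_bump2.
have tb f : smooth f -> test_fun omega (fun y => f y * b y).
  move=> sf; split; first exact: (smoothM sf sb).
  exists (box p r); split => //; first exact: compact_box.
  by move=> y nb; rewrite /b bump2_0 ?mulr0// (_ : 2 * (r / 2) = r)//; field.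
have b1 y : box p (r / 2) y -> b y = 1 by exact: bump2_1.
have bp1 : b p = 1 by apply: b1; split; rewrite subrr normr0 ltW.
pose f0 y := y.1 * (fun=> 1 : R) y.2; pose f1 y := (fun=> 1 : R) y.1 * y.2.
have s0 : smooth f0 by exact: (smooth_tensor (@smooth1_id R) (@smooth1_cst R 1)).
have s1 : smooth f1 by exact: (smooth_tensor (@smooth1_cst R 1) (@smooth1_id R)).
pose c := a - be 0 * p.1 - be 1 * p.2.
pose f y := c + (be 0 * f0 y + be 1 * f1 y).
have sf : smooth f by exact: (smoothD (smooth_cst _) (smoothD (smoothZ _ s0) (smoothZ _ s1))).
exists (mkfield (fun i y => (fun=> al i) y * b y) (fun y => f y * b y)); split.
- apply: ord21_ind => [i|]; first by rewrite entry_mkfield1; apply: tb; exact: smooth_cst.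
  by rewrite entry_mkfield3; exact: tb.
- by move=> i; rewrite entry_mkfield1 bp1 mulr1.
- by rewrite /entry3 entry_mkfield3 bp1 mulr1 /f /f0 /f1 /c; ring.
- move=> i; rewrite /entry3 entry_mkfield3.
  have -> : pd i (fun y => f y * b y) p = pd i f p.
    by apply: near_eq_derive; apply: filterS (nbhs_box p r2) => y /b1 ->; rewrite mulr1.
  apply: is_deriveE.
  have D0 : is_derive p (basis R i) f0 (if i == 0 then 1 else 0).
    have := is_derive_fst i (@is_derive_id _ _ p.1 (1 : R)).
    by rewrite (_ : (fun y : plane => y.1) = f0)//; apply/funext => y; rewrite /f0 mulr1.
  have D1 : is_derive p (basis R i) f1 (if i == 0 then 0 else 1).
    have := is_derive_snd i (@is_derive_id _ _ p.2 (1 : R)).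
    by rewrite (_ : (fun y : plane => y.2) = f1)//; apply/funext => y; rewrite /f1 mul1r.
  have D := is_derive_add (is_derive_const p (basis R i) c)
      (is_derive_add (is_derive_scale (be 0) D0) (is_derive_scale (be 1) D1)).
  apply: (is_derive_eq D); case: (ord2P i) => -> /=; rewrite ?mulr1 ?mulr0 ?addr0 ?add0r //.
Qed.

End TestFields.

(** * Test fields that vanish near a point are dense *)

Section Density.
Variable R : realType.
Local Notation plane := (R * R)%type.
Local Notation vfield := (vfield R).
Local Notation mu := (@leb2 R).
Local Notation ig2 := (ig (@leb2 R)).
Local Notation ii2 := (ii (@leb2 R)).
Implicit Types (f g : plane -> R) (x y p : plane) (u v w phi psi : vfield) (B : 'M[R]_3)
    (U : set plane) (i j : 'I_2).
Variables (omega : set plane) (M0 : R).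
Hypotheses (oo : open omega) (oM : omega `<=` box 0 M0).

Lemma leb2_point p : mu [set p] = 0.
Proof.
case: p => a b; have -> : [set (a, b)] = [set a] `*` [set b].
  by apply/seteqP; split => [[c d] [-> ->]//|[c d] [/= -> ->]].
have E := @product_measure1E _ _ _ _ R (@lebesgue_measure R) (@lebesgue_measure R) [set a] [set b]
    (measurable_set1 a) (measurable_set1 b).
exact: (etrans E (etrans (congr2 mule (lebesgue_measure_set1 a) (lebesgue_measure_set1 b))
    (mul0e 0))).
Qed.

Lemma ii_off_point f g p : measurable_fun setT f -> measurable_fun setT g ->
  (forall x, x <> p -> f x = g x) -> ii2 f = ii2 g.
Proof.
move=> mf mg fg; apply: ii_ae => //; exists [set p]; split; last 1 first.
- by move=> x /= n; apply: contrapT => xp; apply: n; exact: fg.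
- by rewrite (_ : [set p] = [set p.1] `*` [set p.2]);
   [exact: (measurableX )| case: p fg => a b _; apply/seteqP;
       split => [[c d] [-> ->]//|[c d] [/= -> ->]]].
- exact: leb2_point.
Qed.

Lemma open_off p : open (omega `\ p).
Proof.
rewrite setDE; apply: openI => //; apply: closed_openC.
by apply: compact_closed; [exact: norm_hausdorff|exact: compact_set1].
Qed.

Lemma testv_off p phi : testv (omega `\ p) phi -> testv omega phi.
Proof.
by move=> tp i; have [sp [K [cK KU K0]]] := tp i; split => //; exists K; split => // x /KU [].
Qed.

(** A point is a null set, so test functions on the punctured domain still approximate all of L^2.
    For p = O such fields have zero jet at O, whence A is densely defined. *)
Lemma test_field_dense p v (e : R) : L2v omega v -> 0 < e -> exists2 phi, testv (omega `\ p) phi &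
  inner omega (fun y => v y - phi y) (fun y => v y - phi y) < e.
Proof.
move=> Lv e0; have op := @open_off p; have oM' : omega `\ p `<=` box 0 M0 by move=> x [/oM].
have e3 : 0 < e / 3 by rewrite divr_gt0.
pose z (i : 'I_(2 + 1)) := entry v i \_ (omega `\ p).
have Zv (i : 'I_(2 + 1)) := L2_zext oo (Lv i).
have Zz (i : 'I_(2 + 1)) : L2z (omega `\ p) (z i).
  apply: L2_zext => //; have [mf If] := Lv i; have mo := open_measurable2 op.
  have sub : omega `\ p `<=` omega by move=> x [].
  split; first exact: (measurable_funS (open_measurable2 oo) sub mf).
  exact: (@integrableS _ _ R mu _ _ _ (open_measurable2 oo) mo sub If).
have [F HF] := choice (fun i : 'I_(2 + 1) => let: ex_intro2 h a b :=
    test_dense op oM' (let: And3 a _ _ := Zz i in a) (let: And3 _ a _ := Zz i in a)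
  (let: And3 _ _ a := Zz i in a) e3 in ex_intro (fun h => test_fun (omega `\ p) h /\
    (ig2 (fun x => (z i x - h x) ^+ 2) /\ ii2 (fun x => (z i x - h x) ^+ 2) < e / 3)) h (conj a b)).
pose phi := mkfield (fun i => F (lshift 1 i)) (F (rshift 2 0)).
have Ep (i : 'I_(2 + 1)) : entry phi i = F i.
  by move: i; apply: ord21_ind => [i|]; [exact: entry_mkfield1|exact: entry_mkfield3].
have tp : testv (omega `\ p) phi by move=> i; rewrite Ep; exact: (HF i).1.
exists phi => //; have tp' := testv_off tp; have Lp := L2v_test oo oM tp'.
have Lvp : L2v omega (fun y => v y - phi y).
  move=> i; rewrite (_ : entry _ i = (fun y => entry v i y - entry phi i y)); first exact: L2B.
  by apply/funext => y; rewrite /entry !mxE.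
have Ee (i : 'I_(2 + 1)) : entry (fun y => v y - phi y) i = (fun y => entry v i y - F i y).
  by apply/funext => y; rewrite -Ep /entry mxE [X in _ + X]mxE.
rewrite (innerE oo Lvp Lvp).
have E (i : 'I_(2 + 1)) : ii2 (fun x => (entry (fun y => v y - phi y) i \_ omega) x *
    (entry (fun y => v y - phi y) i \_ omega) x) < e / 3.
  have [mvp Ivp _] := L2_zext oo (Lvp i).
  apply: le_lt_trans (HF i).2.2; rewrite le_eqVlt; apply/orP; left; apply/eqP.
  have [mz _ _] := Zz i; have mF : measurable_fun setT (F i).
    by apply: continuous_measurable2; exact: (smooth_cont (HF i).1.1).
  apply: (ii_off_point (p := p)).
  - exact: measurable_funM.
  - by apply: (measurable_funX 2); exact: measurable_funB.
  - move=> x xp; rewrite -expr2; congr (_ ^+ 2).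
    have [ox|nx] := pselect (omega x).
      by rewrite Ee /z !zext_in.
    by rewrite zext_out// /z zext_out ?(test_fun_out (HF i).1) ?subr0//; move=> [].
rewrite sum21 sum2; have := E (lshift 1 0); have := E (lshift 1 1); have := E (rshift 2 0).
move: (ii2 _) (ii2 _) (ii2 _) => a b c ha hb hc; rewrite (_ : e = e / 3 + e / 3 + e / 3);
    last by field.
by rewrite !ltrD.
Qed.

(** The integrand is 0 at [p], so the two extended integrands are equal at every point and nothing
    has to be measurable. *)
Lemma inner_off p u v : (forall i : 'I_(2 + 1), u p i 0 * v p i 0 = 0) ->
    inner (omega `\ p) u v = inner omega u v.
Proof.
move=> h; rewrite /inner !int_zext; congr ii; apply/funext => x.
have [->|/eqP xp] := eqVneq x p.
  rewrite zext_out; last by move=> [_ np]; exact: np.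
  have [op|np] := pselect (omega p); last by rewrite zext_out.
  by rewrite zext_in// big1.
have [ox|nx] := pselect (omega x); first by rewrite !zext_in.
by rewrite !zext_out//; move=> [].
Qed.

End Density.

(** * Green columns *)

Section ContinuousUpToBoundary.
Variable R : realType.
Local Notation plane := (R * R)%type.
Local Notation mu := (@leb2 R).
Local Notation ig2 := (ig (@leb2 R)).
Local Notation ii2 := (ii (@leb2 R)).
Implicit Types (f g : plane -> R) (x y p z : plane) (i j : 'I_2).
Variables (omega : set plane) (M0 : R).
Hypotheses (oo : open omega) (oM : omega `<=` box 0 M0).

(** Multiplied by the test functions [approx1 omega n], the zero extension becomes continuous on the
    plane; these products converge to it pointwise. *)
Lemma C0bar_measurable f : C0bar omega f -> measurable_fun setT (f \_ omega).
Proof.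
move=> cf.
have ct n : continuous (fun x => (f \_ omega) x * approx1 omega n x).
  move=> x; have tn := approx1_test omega n.
  have [ox|nx] := pselect (omega x); last first.
    have E : (f \_ omega) x * approx1 omega n x = 0 by rewrite zext_out ?mul0r.
    apply/cvgrPdist_le => e e0; apply: filterS (test_near0 tn nx) => y h.
    by rewrite E h mulr0 subr0 normr0 ltW.
  apply: cvgM; last exact: (smooth_cont tn.1).
  apply/cvgrPdist_le => e e0; have [r r0 Hr] := C0bar_near cf (closure_in ox) e0.
  apply: filterS2 (nbhs_box x r0) (open_nbhs_nbhs (conj oo ox)) => y by_ oy.
  by rewrite !zext_in// distrC; apply: Hr => //; exact: closure_in.
apply: (measurable_fun_cvg (h := fun n x => (f \_ omega) x * approx1 omega n x)) => [n|x _].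
  exact: continuous_measurable2.
have [ox|nx] := pselect (omega x).
  rewrite -[X in _ --> X]mulr1 -(indic_in ox); apply: cvgM; first exact: cvg_cst.
  exact: approx1_cvg.
rewrite zext_out//; rewrite (_ : (fun n => _) = (fun=> 0)); first exact: cvg_cst.
by apply/funext => n; rewrite mul0r.
Qed.

Lemma L2_C0bar f : C0bar omega f -> L2 omega f.
Proof.
move=> cf; have mf := C0bar_measurable cf; apply: L2_of_zext => //.
have /compact_bounded : compact (f @` closure omega) by apply: continuous_compact => //;
    exact: compact_closure oM.
case/pinfty_ex_gt0 => M M1 H; split => //; last by move=> x; exact: zext_out.
have I := igZ (M ^+ 2) (ig_indic_sub oM (open_measurable2 oo) (@subset_refl _ omega)).
apply: (@ig_le _ _ R mu _ _ _ _ I); first exact: (measurable_funX 2 mf).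
move=> x; have [ox|nx] := pselect (omega x).
  rewrite zext_in// (indic_in ox) mulr1 normrX lerXn2r ?nnegrE// ?(ltW M1)//.
  by apply: H; exists x => //; exact: closure_in.
by rewrite zext_out// expr0n normr0 mulr_ge0 ?sqr_ge0// indicE ler0n.
Qed.

Lemma derivable_sequence f x (v : plane) (r : R) : 0 < r -> derivable f x v ->
  (r / n.+1%:R)^-1 * (f ((r / n.+1%:R) *: v + x) - f x) @[n --> \oo] --> ('D_v f x : R).
Proof.
move=> r0 df.
have h0 n : 0 < r / n.+1%:R by rewrite divr_gt0.
have C : (r / n.+1%:R) @[n --> \oo] --> (0 : R)^'.
  move=> A [e /= e0 He]; have [N HN] : exists N : nat, forall n, (N <= n)%N -> r / n.+1%:R < e.
    exists (Num.bound (r / e)) => n hn; rewrite ltr_pdivrMr ?ltr0n// mulrC -ltr_pdivrMr//.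
    apply: lt_le_trans (archi_boundP _) _; first by rewrite divr_ge0// ltW.
    by rewrite ler_nat leqW.
  exists N => // n /= /HN hn; apply: He; last by rewrite gt_eqF.
  by rewrite /ball_ /= sub0r normrN ger0_norm// ltW.
exact: (cvg_comp _ _ C df).
Qed.

Section GradientInPole.
Variable G : plane -> plane -> R.
Hypothesis dG : forall i y z, closure omega y -> omega z -> derivable (G y) z (basis R i).
Hypothesis cG : forall i, {within closure omega `*` omega, continuous (fun q => pd i (G q.1) q.2)}.

Lemma C0bar_pole_gradient i z : omega z -> C0bar omega (fun y => pd i (G y) z).
Proof.
move=> oz; apply: C0barP => p e cp e0.
have /subspace_continuousP /(_ (p, z) (conj cp oz)) /cvgrPdist_le /(_ e e0) := @cG i.
rewrite near_withinE /= => -[[A A'] /= [hA hA'] sub].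
have [r r0 rA] := nbhs_boxP hA; exists r => // y by_ cy; rewrite distrC.
by apply: (sub (y, z)) => //; split => /=; [exact: rA|exact: nbhs_singleton].
Qed.

(** Joint continuity in both variables on a compact product gives a bound uniform in [y], needed to
    dominate difference quotients in the pole. *)
Lemma pole_gradient_bounded i z (r : R) : box z r `<=` omega ->
  exists2 M : R, 0 < M & forall y w, closure omega y -> box z r w -> `|pd i (G y) w| <= M.
Proof.
move=> rO.
have c : {within closure omega `*` box z r, continuous (fun q => pd i (G q.1) q.2)}.
  by apply: continuous_subspaceW (@cG i) => q [h1 h2]; split => //; exact: rO.
have /compact_bounded : compact ((fun q => pd i (G q.1) q.2) @` (closure omega `*` box z r)).
  apply: continuous_compact => //; apply: compact_setX;
      [exact: compact_closure oM|exact: compact_box].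
case/pinfty_ex_gt0 => M M1 H; exists M => // y w cy bw.
by apply: H; exists (y, w).
Qed.

Lemma basis_in_box i z (s r : R) : `|s| <= r -> box z r (s *: basis R i + z).
Proof.
move=> sr; have r0 : 0 <= r by exact: le_trans (normr_ge0 s) sr.
by case: (ord2P i) => ->; split; rewrite /= addrK /GRing.scale /= ?mulr1 ?mulr0 ?normr0.
Qed.

(* Differentiation of HG under the integral sign, dominated by the bound on the gradient of G. *)
Lemma pairing_pole_gradient i z (k phi : plane -> R) : omega z -> kern k -> smooth phi ->
  (forall w, omega w -> L2 omega (G^~ w)) ->
  (forall w, omega w -> ii2 (fun y => (G^~ w \_ omega) y * k y) = phi w) ->
  ii2 (fun y => ((fun y => pd i (G y) z) \_ omega) y * k y) = pd i phi z.
Proof.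
move=> oz kk sphi LG HG.
have [r r0 rO] := nbhs_boxP (open_nbhs_nbhs (conj oo oz)).
have [M M1 HM] := pole_gradient_bounded i rO.
(* Increments of at most [r]: the segment from [z] to the displaced pole stays in the box where the
   gradient in the pole is bounded. *)
pose h (n : nat) : R := r / n.+1%:R.
have h0 n : 0 < h n by rewrite divr_gt0.
have hr n : h n <= r by rewrite ler_pdivrMr ?ltr0n// ler_peMr ?(ltW r0)// ler1n.
pose w n : plane := h n *: basis R i + z.
have ow n : omega (w n) by apply: rO; apply: basis_in_box; rewrite ger0_norm// ltW.
have Iw v : omega v -> ig2 (G^~ v \_ omega) by move=> ov;
    exact: (ig_L2z oo oM (L2_zext oo (LG v ov))).
have mw v : omega v -> measurable_fun setT (G^~ v \_ omega) by move=> ov;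
    have [] := L2_zext oo (LG v ov).
pose F n y := (h n)^-1 * ((G^~ (w n) \_ omega) y * k y - (G^~ z \_ omega) y * k y).
have EF n : ii2 (F n) = (h n)^-1 * (phi (w n) - phi z).
  rewrite /F iiZ; last by apply: igB; apply: ig_mul_kern => //; exact: Iw.
  by rewrite iiB ?HG//; apply: ig_mul_kern => //; exact: Iw.
have [||||_ C] := @ii_cvg _ _ R mu F (fun y => ((fun y => pd i (G y) z) \_ omega) y * k y)
    (fun y => M * `|k y|).
- move=> n; apply: measurable_funM; first exact: measurable_cst.
  by apply: measurable_funB; apply: measurable_funM;
      [exact: mw|exact: kern_meas|exact: mw|exact: kern_meas].
- exact: igZ (ig_abs (ig_kern kk)).
- move=> n y; rewrite /F -mulrBl mulrA normrM ler_wpM2r//.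
  have [oy|ny] := pselect (omega y); last by rewrite !zext_out// subrr mulr0 normr0 ltW.
  rewrite !zext_in//; have cy := closure_in oy.
  pose g (s : R) : R := G y (s *: basis R i + z).
  have Dg (s : R) : 0 <= s <= h n -> is_derive s 1 g (pd i (G y) (s *: basis R i + z)).
    move=> /andP[s0 s1]; apply: is_derive_line; apply: DeriveDef => //.
    by apply: dG => //; apply: rO; apply: basis_in_box; rewrite ger0_norm// (le_trans s1).
  have [||s] := @MVT R g (fun s => pd i (G y) (s *: basis R i + z)) 0 (h n) (h0 n).
  + by move=> s; rewrite in_itv /= => /andP[s0 s1]; apply: Dg; rewrite !ltW.
  + by apply: derivable_within_continuous => s; rewrite in_itv /= => hs;
      exact: is_derive_derivable (Dg s hs).
  rewrite in_itv /= => /andP[s0 s1]; rewrite subr0 {1 2}/g scale0r add0r => E.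
  rewrite -[G y (w n)]/(G y (h n *: basis R i + z)) E mulrCA mulVf ?mulr1 ?gt_eqF//.
  by apply: HM => //; apply: basis_in_box; rewrite ger0_norm ?(ltW s0)// (le_trans (ltW s1)).
- move=> y; have [oy|ny] := pselect (omega y); last first.
    rewrite zext_out// mul0r; rewrite (_ : (fun n => F n y) = (fun=> 0)); first exact: cvg_cst.
    by apply/funext => n; rewrite /F !zext_out// !mul0r subrr mulr0.
  rewrite zext_in//; rewrite (_ : (fun n => F n y) =
      (fun n => ((h n)^-1 * (G y (w n) - G y z)) * k y)); last first.
    by apply/funext => n; rewrite /F !zext_in// -mulrBl mulrA.
  apply: cvgM; last exact: cvg_cst.
  by apply: derivable_sequence => //; apply: dG => //; exact: closure_in.
have C' : ii2 (F n) @[n --> \oo] --> (pd i phi z : R).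
  rewrite (_ : (fun n => ii2 (F n)) = (fun n => (h n)^-1 * (phi (w n) - phi z)));
      last by apply/funext.
  by apply: derivable_sequence => //; exact: is_derive_derivable (smooth_is_derive sphi z i).
by rewrite -(cvg_lim _ C)// -(cvg_lim _ C').
Qed.

End GradientInPole.

End ContinuousUpToBoundary.

Lemma entry3_Lfull (R : realType) (B : 'M[R]_3) (phi : vfield R) x :
  entry3 (Lfull B phi) x = L3 B (entry3 phi) x.
Proof. by rewrite /entry3 /entry /Lfull col_mxEd mxE mulr1n. Qed.

Lemma zext_comb (R : realType) (omega : set (R * R)) (a b c k : R) (f g h : R * R -> R) x :
  ((fun y => a * f y + (b * g y + c * h y)) \_ omega) x * k =
  a * ((f \_ omega) x * k) + (b * ((g \_ omega) x * k) + c * ((h \_ omega) x * k)).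
Proof.
have [ox|nx] := pselect (omega x); first by rewrite !zext_in//; ring.
by rewrite !zext_out// !mul0r !mulr0 !addr0.
Qed.

Lemma sum2_fun (R : realType) (X : Type) (F : 'I_2 -> X -> R) :
  (fun x => \sum_j F j x) = (fun x => F 0 x + F 1 x).
Proof. by apply/funext => x; rewrite sum2. Qed.

Section GreenColumns.
Variable R : realType.
Local Notation plane := (R * R)%type.
Local Notation vfield := (vfield R).
Local Notation ii2 := (ii (@leb2 R)).
Local Notation O2 := (O2 R).
Implicit Types (f g : plane -> R) (x y p z : plane) (u v w phi psi : vfield) (i j : 'I_2).
Variables (omega : set plane) (M0 : R).
Hypotheses (oo : open omega) (oM : omega `<=` box 0 M0) (oO : omega O2).
Variables (B : 'M[R]_3) (G' : plane -> 'M[R]_2) (G3 : plane -> plane -> R).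
Hypotheses (gG' : green_prime B omega G') (gG3 : green3 B omega G3).

(** The part of an element of the adjoint domain contributed by Green functions, including a_0
    G_3(., O), which is counted with w^ in the boundary conditions. *)
Definition green (a0 : R) (a : 'cV[R]_(2 + 2)) : vfield := fun y =>
  a0 *: col_mx 0 (G3 y O2)%:M + Gsharp G' G3 y *m a.

Lemma green_entry1 a0 a i : entry (green a0 a) (lshift 1 i) =
  (fun y => \sum_j a (lshift 2 j) 0 * G' y i j).
Proof.
apply/funext => y; rewrite /entry /green mxE [X in X + _]mxE col_mxEu [X in _ * X]mxE mulr0 add0r.
rewrite mxE big_split_ord /= [X in _ + X]big1 ?addr0.
  by apply: eq_bigr => j _; rewrite /Gsharp block_mxEul mulrC.
by move=> j _; rewrite /Gsharp block_mxEur mxE mul0r.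
Qed.

Lemma green_entry3 a0 a : entry3 (green a0 a) =
  (fun y => a0 * G3 y O2 + (a (rshift 2 0) 0 * G3sup G3 1 y + - a (rshift 2 1) 0 * G3sup G3 0 y)).
Proof.
apply/funext => y; rewrite /entry3 /entry /green mxE [X in X + _]mxE col_mxEd [X in _ * X]mxE
    mulr1n.
congr (_ + _); rewrite mxE big_split_ord /= [X in X + _]big1 ?add0r; last first.
  by move=> j _; rewrite /Gsharp block_mxEdl mxE mul0r.
by rewrite sum2 /Gsharp !block_mxEdr !mxE /= mulrC [_ * a (rshift 2 1) 0]mulrC mulNr mulrN.
Qed.

Lemma L2_green3 : L2 omega (fun y => G3 y O2).
Proof. by have [_ [h _] _ _ _] := gG3.1 O2 oO. Qed.

Lemma L2_G3_ i : L2 omega (G3_ G3 i).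
Proof.
exact: (L2_C0bar oo oM (@C0bar_pole_gradient R omega G3 (fun k => (gG3.2 k).2) i O2 oO)).
Qed.

Lemma L2_G3sup i : L2 omega (G3sup G3 i).
Proof. exact: (L2B oo (L2_G3_ i) (L2Z oo _ L2_green3)). Qed.

Lemma L2v_green a0 a : L2v omega (green a0 a).
Proof.
have [LG' _ _ _ _] := gG'.
apply: ord21_ind => [i|].
  by rewrite green_entry1 sum2_fun; exact: (L2D oo (L2Z oo _ (LG' i 0)) (L2Z oo _ (LG' i 1))).
rewrite -[entry _ _]/(entry3 (green a0 a)) green_entry3.
exact: (L2D oo (L2Z oo a0 L2_green3) (L2D oo (L2Z oo _ (L2_G3sup 1)) (L2Z oo _ (L2_G3sup 0)))).
Qed.

(** The constant in the normalisation of G_3^i, chosen so that G_3^i vanishes at O. *)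
Definition cc i : R := G3_ G3 i O2 / G3 O2 O2.

Lemma G3_pairing phi : testv omega phi ->
  ii2 (fun x => ((fun y => G3 y O2) \_ omega) x * entry3 (Lfull B^T phi) x) = entry3 phi O2.
Proof.
move=> tp; have [_ _ _ _ h] := gG3.1 O2 oO.
rewrite -(h (entry3 phi) (tp (rshift 2 0))) int_zext_mul; congr ii; apply/funext => x.
by rewrite entry3_Lfull.
Qed.

Lemma G3_grad_pairing i phi : testv omega phi ->
  ii2 (fun x => (G3_ G3 i \_ omega) x * entry3 (Lfull B^T phi) x) = pd i (entry3 phi) O2.
Proof.
move=> tp; have tL := Lfull_test B^T tp.
apply: (@pairing_pole_gradient R omega M0 oo oM G3 _ _ i O2 _ (entry3 phi) oO
    (test_kern (tL (rshift 2 0))) (tp (rshift 2 0)).1).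
- by move=> k y z cy oz; exact: (gG3.2 k).1.
- by move=> k; exact: (gG3.2 k).2.
- by move=> w ow; have [_ [h _] _ _ _] := gG3.1 w ow.
- move=> w ow; have [_ _ _ _ h] := gG3.1 w ow.
  rewrite -(h (entry3 phi) (tp (rshift 2 0))) int_zext_mul; congr ii; apply/funext => x.
  by rewrite -[entry _ _ x]/(entry3 (Lfull B^T phi) x) entry3_Lfull.
Qed.

Lemma G3sup_pairing i phi : testv omega phi ->
  ii2 (fun x => (G3sup G3 i \_ omega) x * entry3 (Lfull B^T phi) x) =
      pd i (entry3 phi) O2 - cc i * entry3 phi O2.
Proof.
move=> tp; have tL := Lfull_test B^T tp; have kL := test_kern (tL (rshift 2 0)).
have I1 := ig_mul_kern (ig_L2z oo oM (L2_zext oo (L2_G3_ i))) kL.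
have I2 := ig_mul_kern (ig_L2z oo oM (L2_zext oo L2_green3)) kL.
rewrite -(G3_grad_pairing i tp) -(G3_pairing tp) -(iiZ (cc i) I2) -(iiB I1 (igZ (cc i) I2)).
by congr ii; apply/funext => x; rewrite /G3sup zextB zextZ mulrBl mulrA.
Qed.

Lemma Gprime_pairing j phi : testv omega phi ->
  \sum_i ii2 (fun x => ((fun y => G' y i j) \_ omega) x * entry (Lfull B^T phi) (lshift 1 i) x) =
      entry phi (lshift 1 j) O2.
Proof.
move=> tp; have [LG' _ _ _ h] := gG'; have tL := Lfull_test B^T tp.
pose phi' : plane -> 'cV[R]_2 := fun y => usubmx (phi y).
have E i : entry phi' i = entry phi (lshift 1 i) by apply/funext => y; rewrite /entry mxE.
have EL i : entry (Lprime B^T phi') i = entry (Lfull B^T phi) (lshift 1 i).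
  by apply/funext => y; rewrite /entry /Lfull col_mxEu.
have tp' i : test_fun omega (entry phi' i) by rewrite E.
have := h phi' j tp'; rewrite -[phi' O2 j 0]/(entry phi' j O2) E => <-.
have EG i : entry (fun y => col j (G' y)) i = (fun y => G' y i j).
  by apply/funext => y; rewrite /entry mxE.
rewrite (innerE oo) => [|i|i].
- by apply: eq_bigr => i _; rewrite EG EL (zext_test (tL _)).
- by rewrite EG.
- by rewrite EL; exact: (L2_test oo oM (tL _)).
Qed.

(** Each column contributes its own functional of the jet of [phi] at O. The last two coefficients
    go with G_3^2 and -G_3^1, hence the crossed indices and the sign. *)
Lemma green_pairing a0 a phi : testv omega phi ->
  inner omega (green a0 a) (Lfull B^T phi) = a0 * entry3 phi O2 +
  \sum_j a (lshift 2 j) 0 * entry phi (lshift 1 j) O2 +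
  (a (rshift 2 0) 0 * (pd 1 (entry3 phi) O2 - cc 1 * entry3 phi O2) -
   a (rshift 2 1) 0 * (pd 0 (entry3 phi) O2 - cc 0 * entry3 phi O2)).
Proof.
move=> tp; have tL := Lfull_test B^T tp; have [LG' _ _ _ _] := gG'.
have kL (i : 'I_(2 + 1)) := test_kern (tL i).
rewrite (inner_test oo oM (L2v_green a0 a) tL) [LHS]addrC [RHS]addrAC; congr (_ + _); last first.
  have E j : a (lshift 2 j) 0 * entry phi (lshift 1 j) O2 = \sum_i a (lshift 2 j) 0 *
      ii2 (fun x => ((fun y => G' y i j) \_ omega) x * entry (Lfull B^T phi) (lshift 1 i) x).
    by rewrite -(Gprime_pairing j tp) mulr_sumr.
  rewrite [RHS](eq_bigr _ (fun j _ => E j)) [RHS]exchange_big; apply: eq_bigr => i _ /=;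
      rewrite green_entry1.
  have I j := ig_mul_kern (ig_L2z oo oM (L2_zext oo (LG' i j))) (kL (lshift 1 i)).
  rewrite -ii_sum//; congr ii; apply/funext => x.
  have [ox|nx] := pselect (omega x).
    by rewrite zext_in// mulr_suml; apply: eq_bigr => j _; rewrite zext_in// mulrA.
  by rewrite zext_out// mul0r big1// => j _; rewrite zext_out// mul0r mulr0.
rewrite green_entry3.
have I1 := ig_mul_kern (ig_L2z oo oM (L2_zext oo L2_green3)) (kL (rshift 2 0)).
have I2 i := ig_mul_kern (ig_L2z oo oM (L2_zext oo (L2_G3sup i))) (kL (rshift 2 0)).
rewrite -!(G3sup_pairing _ tp) -(G3_pairing tp) -mulNr.
rewrite -(iiZ a0 I1) -(iiZ (a (rshift 2 0) 0) (I2 1)) -(iiZ (- a (rshift 2 1) 0) (I2 0)).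
rewrite -(iiD (igZ _ (I2 1)) (igZ _ (I2 0))) -(iiD (igZ a0 I1) (igD (igZ _ (I2 1)) (igZ _ (I2 0)))).
congr ii; apply/funext => x; exact: zext_comb.
Qed.

End GreenColumns.

(** * Self-adjointness *)

Section SchurComplement.
Variables (R : realType) (A : 'M[R]_(3 + 3)).
Hypothesis pA : posdef A.

Let S := drsubmx A.

Lemma posdef_form_ge0 (n : nat) (C : 'M[R]_n) (x : 'cV[R]_n) : posdef C -> 0 <= (x^T *m C *m x) 0 0.
Proof.
move=> [_ h]; have [->|/h/ltW//] := eqVneq x 0.
by rewrite mulmx0 mxE.
Qed.

Lemma sym_blocks : [/\ (ulsubmx A)^T = ulsubmx A, (ursubmx A)^T = dlsubmx A & S^T = S].
Proof.
have [sA _] := pA; have := sA; rewrite -{1 2}(submxK A) tr_block_mx => /eq_block_mx [h1 _ h3 h4].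
by split.
Qed.

(** A row [u] in the kernel of the block would give the vector (0, u) zero energy under the positive
    definite [A]. *)
Lemma schur_unit : S \in unitmx.
Proof.
have [_ _ sS] := sym_blocks; rewrite -row_free_unit -kermx_eq0; apply/eqP/row_matrixP => i;
    rewrite row0.
set u := row i (kermx S); have uS : u *m S = 0 by rewrite /u -row_mul mulmx_ker row0.
apply/eqP; apply: contraT => u0; have [_ pos] := pA.
pose X : 'cV[R]_(3 + 3) := col_mx 0 u^T.
have X0 : X != 0.
  apply: contra u0 => /eqP/(congr1 dsubmx); rewrite /X col_mxKd linear0 => /(congr1 trmx).
  by rewrite trmxK trmx0 => ->.
have := pos X X0; rewrite -mulmxA -(submxK A) /X mul_block_col !mulmx0 !add0r.
rewrite -/S (_ : S *m u^T = 0); last by rewrite -sS -trmx_mul uS trmx0.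
by rewrite tr_col_mx mul_row_col trmx0 mul0mx mulmx0 addr0 mxE ltxx.
Qed.

Lemma schur_sym : (schur A)^T = schur A.
Proof.
have [h1 h2 h3] := sym_blocks; rewrite /schur linearB /= h1 !trmx_mul trmx_inv h3 -h2 trmxK h2.
by rewrite mulmxA.
Qed.

(** The form of the Schur complement at [x] is that of [A] at the extension of [x] whose second half
    minimises the energy, namely -S^{-1} A_{zy} x. *)
Lemma schur_form_ge0 (x : 'cV[R]_3) : 0 <= (x^T *m schur A *m x) 0 0.
Proof.
pose X : 'cV[R]_(3 + 3) := col_mx x (- (invmx S *m dlsubmx A *m x)).
have E : A *m X = col_mx (schur A *m x) 0.
  rewrite -{1}(submxK A) /X mul_block_col; congr col_mx.
    by rewrite /schur mulmxBl mulmxN !mulmxA.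
  by rewrite mulmxN !mulmxA mulmxV ?schur_unit// mul1mx subrr.
have := posdef_form_ge0 X pA; rewrite -mulmxA E /X tr_col_mx mul_row_col mulmx0 addr0.
by rewrite mulmxA.
Qed.

End SchurComplement.

Opaque inner Lfull.

(** * The boundary form and the extension A_M *)

Section SelfAdjoint.
Variable R : realType.
Local Notation plane := (R * R)%type.
Local Notation vfield := (vfield R).
Local Notation O2 := (O2 R).
Implicit Types (x y : plane) (u v w phi psi f g h : vfield) (i j : 'I_2) (a b : 'cV[R]_(2 + 2)).
Variables (omega : set plane) (M0 : R).
Hypotheses (oo : open omega) (oM : omega `<=` box 0 M0) (oO : omega O2) (sb : smooth_bdry omega).
Variables (B : 'M[R]_3) (G' : plane -> 'M[R]_2) (G3 : plane -> plane -> R).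
Hypotheses (Bs : B^T = B) (Bp : forall x : 'cV[R]_3, 0 <= (x^T *m B *m x) 0 0).
Hypotheses (gG' : green_prime B omega G') (gG3 : green3 B omega G3).
Local Notation T := (opA B omega).
Local Notation ip := (inner omega).
Local Notation green := (green G' G3).
Local Notation wrepr := (wrepr G' G3).
Hypothesis adjA : forall v f, adjoint omega T v f <-> opAstar B omega G' G3 v f.

Let L u := Lfull B u.

Lemma wreprE w (a0 : R) a y : wrepr w a0 a y = w y + green a0 a y.
Proof. by rewrite /wrepr /what /green addrA. Qed.

Lemma test_off_point phi i : testv (omega `\ O2) phi ->
  [/\ phi O2 = 0, Lfull B^T phi O2 = 0 & pd i (entry3 phi) O2 = 0].
Proof.
move=> tp; have nO : ~ (omega `\ O2) O2 by move=> [_ h]; exact: h.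
split.
- by apply/colP => k; rewrite [RHS]mxE; exact: (test_fun_out (tp k) nO).
- by apply/colP => k; rewrite [RHS]mxE; exact: (test_fun_out (Lfull_test B^T tp k) nO).
- exact: (test_fun_out (test_pds [:: i] (tp (rshift 2 0))) nO).
Qed.

Lemma distr_off v f : (forall phi, testv (omega `\ O2) phi -> ip v (Lfull B^T phi) = ip f phi) ->
  distr_eq B (omega `\ O2) v f.
Proof.
move=> H phi tp; have [e1 e2 _] := test_off_point 0 tp.
rewrite !inner_off; [exact: H|by move=> i; rewrite e1 mxE mulr0|by move=> i; rewrite e2 mxE mulr0].
Qed.

Lemma opA_regD w : regD omega w -> w O2 = 0 -> (forall i, pd i (entry3 w) O2 = 0) -> exists f,
    T w f.
Proof.
move=> rw w0 dw; have [f Lf df] := regD_distr oo oM B rw; exists f; split => //.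
  exact: (regD_L2v rw).
by exists w; split => //; apply: aeW.
Qed.

Lemma opA_attributes v f : T v f -> exists u, [/\ regD omega u, u O2 = 0, forall i,
    pd i (entry3 u) O2 = 0
  & ae_on omega v (wrepr u 0 0)].
Proof.
move=> [_ _ _ [u [ru u0 du uv]]]; exists u; split => //.
by apply: ae_imp uv => y h oy; rewrite wreprE /green scale0r mulmx0 !addr0 h.
Qed.

(** Symmetry of A, read off from the description of the adjoint: a field in the domain of A is its
    own regular part, with zero coefficients. *)
Lemma opA_adj v f : T v f -> adjoint omega T v f.
Proof.
move=> Tv; have [u [ru _ _ vu]] := opA_attributes Tv; have [Lv Lf df _] := Tv.
apply/adjA; split => //; last by exists u, 0, 0.
by apply: distr_off => phi tp; apply: df; exact: testv_off tp.
Qed.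

Lemma opA_dense : densely_defined omega T.
Proof.
move=> v Lv e e0; have [phi tp le] := test_field_dense oo oM O2 Lv e0.
have [f Tf] : exists f, T phi f.
  apply: opA_regD; first exact: (regD_test oo oM (testv_off tp)).
    by have [] := test_off_point 0 tp.
  by move=> i; have [] := test_off_point i tp.
by exists phi, f.
Qed.

Let Lneg u : L2v omega u -> L2v omega (fun y => (-1) *: u y).
Proof. exact: L2vZ. Qed.

(** The domain of A is dense. The conclusion is a vanishing pairing, in accordance with fields being
    known only almost everywhere. *)
Lemma opA_orth f h : L2v omega f -> L2v omega h -> (forall u g, T u g -> ip u f = 0) -> ip f h = 0.
Proof.
move=> Lf Lh H; apply/eqP; apply: contraT => x0.
pose P := ip f f + 1; have P0 : 0 < P by rewrite ltr_wpDl// inner_ge0.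
have e0 : 0 < (ip f h) ^+ 2 / P by rewrite divr_gt0// lt_neqAle eq_sym sqrf_eq0 x0 sqr_ge0.
have [u [g [Tu lt]]] := opA_dense Lh e0; have Lu : L2v omega u by have [] := Tu.
pose k y := h y + (-1) *: u y.
have Ek : (fun y => h y - u y) = k by apply/funext => y; rewrite /k scaleN1r.
rewrite Ek in lt; have Lk : L2v omega k by exact: (L2vD oo Lh (Lneg Lu)).
have fk : ip f k = ip f h.
  by rewrite (innerDr oo Lh (Lneg Lu) Lf) (innerZr oo _ Lu Lf) (inner_sym _ f u) (H u g Tu) mulr0
      addr0.
(* Expanding the squared norm of k - t f, with [k] = h - u so close to 0 that its squared norm is
   below (f, h)^2 / P, gives a negative number. The 1 added in [P] avoids dividing by zero. *)
pose t : R := ip f h / P; pose s : R := - t.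
have Lsf := L2vZ oo s Lf.
have := inner_ge0 omega (fun y => k y + s *: f y).
rewrite (innerDl oo Lk Lsf (L2vD oo Lk Lsf)) !(innerDr oo Lk Lsf) ?(innerZl oo) ?(innerZr oo)//.
rewrite (inner_sym _ k f) fk => ge.
have : ip k k - (ip f h) ^+ 2 / P * (2 - ip f f / P) >= 0.
  apply: le_trans ge _; rewrite le_eqVlt; apply/orP; left; apply/eqP.
  by rewrite /s /t; field; rewrite gt_eqF.
have q1 : ip f f / P <= 1 by rewrite ler_pdivrMr// mul1r /P lerDl.
move: lt e0 q1; move: (ip k k) ((ip f h) ^+ 2 / P) (ip f f / P) => K E Q lt e0 q1.
by rewrite subr_ge0 => hh; exfalso; nra.
Qed.

(** The right-hand side of [green_pairing] for any field that has a jet at O: the delta functions of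
    the Green columns applied to [w]. *)
Definition trace (a0 : R) a w : R := a0 * entry3 w O2 +
  \sum_j a (lshift 2 j) 0 * entry w (lshift 1 j) O2 +
  (a (rshift 2 0) 0 * (pd 1 (entry3 w) O2 - cc G3 1 * entry3 w O2) -
   a (rshift 2 1) 0 * (pd 0 (entry3 w) O2 - cc G3 0 * entry3 w O2)).

Lemma green_trace (a0 : R) a phi : testv omega phi ->
    ip (green a0 a) (Lfull B^T phi) = trace a0 a phi.
Proof. exact: (green_pairing oo oM oO gG' gG3). Qed.

Lemma L2v_wrepr phi (a0 : R) a : testv omega phi -> L2v omega (wrepr phi a0 a).
Proof.
move=> tp; have := L2vD oo (L2v_test oo oM tp) (L2v_green oo oM oO gG' gG3 a0 a).
by apply: L2v_ext => // y _; rewrite wreprE.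
Qed.

Lemma wrepr_ip phi (a0 : R) a h : testv omega phi -> L2v omega h ->
  ip (wrepr phi a0 a) h = ip phi h + ip (green a0 a) h.
Proof.
move=> tp Lh; rewrite -(innerDl oo (L2v_test oo oM tp) (L2v_green oo oM oO gG' gG3 a0 a) Lh).
by apply: inner_ext => // y _; exact: wreprE.
Qed.

Lemma L2v_L phi : testv omega phi -> L2v omega (L phi).
Proof. by move=> tp; exact: (L2v_test oo oM (Lfull_test B tp)). Qed.

(** On test fields supported off O the Green columns pair to zero with the operator, so the image of
    the sum is that of the test field alone. *)
Lemma adj_wrepr phi (a0 : R) a : testv omega phi -> adjoint omega T (wrepr phi a0 a) (L phi).
Proof.
move=> tp; apply/adjA; split; [exact: L2v_wrepr|exact: L2v_L| |].
  apply: distr_off => psi tpsi; have tpsi' := testv_off tpsi.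
  rewrite wrepr_ip//; last exact: (L2v_test oo oM (Lfull_test _ tpsi')).
  rewrite (green_trace _ _ tpsi') (test_Lfull oo oM B tp tpsi') /trace.
  have [e1 _ e3] := test_off_point 0 tpsi; have [_ _ e4] := test_off_point 1 tpsi.
  have E k : entry psi k O2 = 0 by rewrite /entry e1 mxE.
  rewrite e3 e4 /entry3 E big1 => [|j _]; last by rewrite E mulr0.
  by rewrite !mulr0 !subr0 !mulr0 subr0 !addr0.
exists phi, a0, a; split; first exact: (regD_test oo oM tp).
by apply: aeW.
Qed.

(** The test field [phi] has the jet of [w] at O, so w - phi lies in the domain of A. The images add
    up because the difference of both sides is orthogonal to that dense domain. *)
Lemma decomposition v f w (a0 : R) a : adjoint omega T v f -> regD omega w ->
    ae_on omega v (wrepr w a0 a) ->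
  exists phi u0 f0, [/\ testv omega phi, forall (b0 : R) b, trace b0 b phi = trace b0 b w, T u0 f0,
    (forall h, L2v omega h -> ip h v = ip h u0 + ip h (wrepr phi a0 a)) &
    forall h, L2v omega h -> ip f h = ip f0 h + ip (L phi) h].
Proof.
move=> av rw vw; have [Lv Lf af] := av.
have [phi [tp p1 p3 pd3]] := test_jets oo (fun i => entry w (lshift 1 i) O2) (entry3 w O2)
    (fun i => pd i (entry3 w) O2) oO.
have rp := regD_test oo oM tp; have ru := regDB oo oM rw rp.
pose u0 y := w y - phi y.
have E k : entry u0 k = (fun y => entry w k y - entry phi k y) by apply/funext => y;
    rewrite /entry !mxE.
have [f0 Tu] : exists f0, T u0 f0.
  apply: opA_regD => //.
    apply/colP; apply: ord21_ind => [i|]; rewrite [RHS]mxE.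
      by rewrite -[LHS]/(entry u0 (lshift 1 i) O2) E p1 subrr.
    by rewrite -[LHS]/(entry u0 (rshift 2 0) O2) E; move: p3; rewrite /entry3 => ->; rewrite subrr.
  move=> i; rewrite /entry3 E; have [_ _ [_ Cw] _ _] := rw; have [_ _ [_ Cp] _ _] := rp.
  by rewrite (pdB_at ((Cw i).1 _ oO) ((Cp i).1 _ oO)) pd3 subrr.
have [Lu Lf0 _ _] := Tu; have Lpsi := L2v_wrepr a0 a tp; have LL := L2v_L tp.
have Vip h : L2v omega h -> ip h v = ip h u0 + ip h (wrepr phi a0 a).
  move=> Lh; rewrite -(innerDr oo Lu Lpsi Lh) !(inner_sym _ h);
      apply: (inner_ae oo Lv (L2vD oo Lu Lpsi) Lh).
  by apply: ae_imp vw => y h' oy; rewrite h'// !wreprE [RHS]addrA /u0 subrK.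
exists phi, u0, f0; split => //.
  by move=> b0 b; rewrite /trace p3 !pd3; congr (_ + _ + _); apply: eq_bigr => j _; rewrite p1.
move=> h Lh; pose k y := f y + (-1) *: (f0 y + L phi y).
have L0 := L2vD oo Lf0 LL; have Lk : L2v omega k by exact: (L2vD oo Lf (Lneg L0)).
have : ip k h = 0.
  apply: opA_orth => // u g Tug; have [Lu' Lg _ _] := Tug.
  have [_ _ a1] := opA_adj Tu; have [_ _ a2] := adj_wrepr a0 a tp.
  rewrite (innerDr oo Lf (Lneg L0) Lu') (innerZr oo _ L0 Lu') (innerDr oo Lf0 LL Lu').
  by rewrite -(af u g Tug) -(a1 u g Tug) -(a2 u g Tug) Vip// mulN1r subrr.
rewrite (innerDl oo Lf (Lneg L0) Lh) (innerZl oo _ L0 Lh) (innerDl oo Lf0 LL Lh) mulN1r.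
by move=> /eqP; rewrite subr_eq0 => /eqP.
Qed.

Lemma cancel_form (p q r s t t' : R) : p + q + (r + (s + t')) - (p + r + (q + (s + t))) = t' - t.
Proof. by ring. Qed.

(** After [decomposition], every pairing with an element of the domain of A cancels by definition of
    the adjoint, and the pairings of test fields cancel by symmetry of L. No pairing of two Green
    columns arises, as their image is 0; test fields against Green columns remain. *)
Lemma boundary_form v f w (a0 : R) a v' f' w' (a0' : R) a' :
  adjoint omega T v f -> regD omega w -> ae_on omega v (wrepr w a0 a) ->
  adjoint omega T v' f' -> regD omega w' -> ae_on omega v' (wrepr w' a0' a') ->
  ip f v' - ip v f' = trace a0' a' w - trace a0 a w'.
Proof.
move=> av rw vw av' rw' vw'.
have [phi [u [g [tp tr Tu Vip Fip]]]] := decomposition av rw vw.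
have [phi' [u' [g' [tp' tr' Tu' Vip' Fip']]]] := decomposition av' rw' vw'.
have [Lv Lf _] := av; have [Lv' Lf' _] := av'.
have [Lu Lg _ _] := Tu; have [Lu' Lg' _ _] := Tu'.
have LL := L2v_L tp; have LL' := L2v_L tp'.
have LW := L2v_wrepr a0 a tp; have LW' := L2v_wrepr a0' a' tp'.
have [_ _ a1] := opA_adj Tu'; have [_ _ a2] := adj_wrepr a0' a' tp';
    have [_ _ a3] := adj_wrepr a0 a tp.
have E : ip phi' (L phi) = ip phi (L phi').
  by rewrite /L -{1}Bs (test_Lfull oo oM B tp' tp) inner_sym.
have t' : ip (green a0' a') (L phi) = trace a0' a' w by rewrite /L -{1}Bs (green_trace _ _ tp) tr.
have t : ip (green a0 a) (L phi') = trace a0 a w' by rewrite /L -{1}Bs (green_trace _ _ tp') tr'.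
have X : ip f v' = ip g' u + ip (L phi') u + (ip (L phi) u' + (ip phi' (L phi) + trace a0' a' w)).
  have e1 := etrans (a1 _ _ Tu) (inner_sym omega u g').
  have e2 := etrans (a2 _ _ Tu) (inner_sym omega u (L phi')).
  have e3 := etrans (inner_sym omega (L phi) (wrepr phi' a0' a')) (wrepr_ip a0' a' tp' LL).
  have e4 := etrans (Vip' _ LL) (congr1 (+%R _) (etrans e3 (congr1 (+%R _) t'))).
  exact: (etrans (Fip _ Lv') (congr2 +%R (etrans (Vip' _ Lg) (congr2 +%R e1 e2)) e4)).
have X' : ip v f' = ip g' u + ip (L phi) u' + (ip (L phi') u + (ip phi' (L phi) + trace a0 a w')).
  have e1 := a1 _ _ Tu; have e2 := etrans (a3 _ _ Tu') (inner_sym omega u' (L phi)).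
  have e3 := etrans (inner_sym omega (L phi') (wrepr phi a0 a)) (wrepr_ip a0 a tp LL').
  have e4 := etrans (Vip _ LL') (congr1 (+%R _) (etrans e3 (congr2 +%R (esym E) t))).
  have e5 := etrans (Fip' _ Lv) (congr2 +%R (etrans (Vip _ Lg') (congr1 (+%R _) e2)) e4).
  exact: (etrans (inner_sym omega v f') e5).
rewrite X X'; exact: cancel_form.
Qed.

Let gam : R := G3 O2 O2.
Let gam0 : gam != 0. Proof. exact: (green_pos oo oM sb Bs gG3 Bp oO). Qed.

Lemma cc_gam i : cc G3 i * gam = G3_ G3 i O2.
Proof. exact: (divfK gam0). Qed.

Lemma what_values w (a0 : R) : regD omega w ->
  [/\ forall i, entry (what G3 w a0) (lshift 1 i) O2 = entry w (lshift 1 i) O2,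
      entry3 (what G3 w a0) O2 = entry3 w O2 + a0 * gam &
      forall i, pd i (entry3 (what G3 w a0)) O2 = pd i (entry3 w) O2 + a0 * G3_ G3 i O2].
Proof.
move=> rw.
have E3 : entry3 (what G3 w a0) = (fun y => entry3 w y + a0 * G3 y O2).
  apply/funext => y; rewrite /entry3 /entry /what mxE; congr (_ + _).
  by rewrite mxE col_mxEd mxE mulr1n.
split.
- by move=> i; rewrite /entry /what mxE [X in _ + X]mxE col_mxEu mxE mulr0 addr0.
- by rewrite E3.
- move=> i; rewrite E3; have [_ _ [_ Cw] _ _] := rw; have [[_ CG] _ _ _ _] := gG3.1 O2 oO.
  rewrite /G3_ -(green_grad_sym oo oM sb Bs gG3 i oO).
  have D1 := derivableP ((Cw i).1 _ oO); have D2 := derivableP ((CG i).1 _ oO).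
  exact: (is_deriveE (is_derive_add D1 (is_derive_scale a0 D2))).
Qed.

Lemma dsharp_entries u :
  [/\ forall i, dsharp u (lshift 2 i) 0 = entry u (lshift 1 i) O2,
      dsharp u (rshift 2 0) 0 = pd 1 (entry3 u) O2 & dsharp u (rshift 2 1) 0 =
          - pd 0 (entry3 u) O2].
Proof.
split; rewrite ?/dsharp ?mxE //.
by move=> i; case: (ord2P i) => ->; rewrite mxE.
Qed.

Lemma dot_cV a b : (a^T *m b) 0 0 = \sum_j a (lshift 2 j) 0 * b (lshift 2 j) 0 +
  (a (rshift 2 0) 0 * b (rshift 2 0) 0 + a (rshift 2 1) 0 * b (rshift 2 1) 0).
Proof.
rewrite mxE big_split_ord /= [X in _ + X]sum2 !mxE; congr (_ + _).
by apply: eq_bigr => j _; rewrite mxE.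
Qed.

Lemma trace_algebra (b0 w3 a0 g S p q d1' d0' c1 c0 g1 g0 : R) : c1 * g = g1 -> c0 * g = g0 ->
  b0 * w3 + S + (p * (d1' - c1 * w3) - q * (d0' - c0 * w3)) =
  b0 * (w3 + a0 * g - a0 * g) + (S + (p * (d1' + a0 * g1) + q * - (d0' + a0 * g0))) -
  (w3 + a0 * g) * (p * c1 - q * c0).
Proof. by move=> <- <-; ring. Qed.

(** The combination d_i w_3 - c_i w_3 at O takes the same value on w and on w^. Once it is written
    with w^, the c_i occur only in a multiple of w^_3(O), the quantity that the boundary condition
    sets to 0. *)
Lemma trace_what w (a0 b0 : R) b : regD omega w ->
  trace b0 b w = b0 * (entry3 (what G3 w a0) O2 - a0 * gam) + (b^T *m dsharp (what G3 w a0)) 0 0 -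
    entry3 (what G3 w a0) O2 * (b (rshift 2 0) 0 * cc G3 1 - b (rshift 2 1) 0 * cc G3 0).
Proof.
move=> rw; have [e1 e3 ed] := what_values a0 rw; have [d1' d2 d3] := dsharp_entries (what G3 w a0).
rewrite dot_cV d2 d3 !ed e3 /trace -(trace_algebra _ _ _ _ _ _ _ _ (cc_gam 1) (cc_gam 0)).
by congr (_ + _ + _); apply: eq_bigr => j _; rewrite d1' e1.
Qed.

Variable M : 'M[R]_(2 + 2).
Hypothesis Ms : M^T = M.

Local Notation AM := (op_restrict (adjoint omega T) (domAM omega G' G3 M)).

Lemma form_sym a b : (a^T *m (M *m b)) 0 0 = (b^T *m (M *m a)) 0 0.
Proof.
have E : (a^T *m (M *m b))^T = b^T *m (M *m a) by rewrite !trmx_mul trmxK Ms mulmxA.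
by rewrite -E [RHS]mxE.
Qed.

Lemma trace_domAM w (a0 b0 : R) a b : regD omega w -> dsharp (what G3 w a0) = M *m a ->
  entry3 (what G3 w a0) O2 = 0 -> trace b0 b w = - (b0 * a0 * gam) + (b^T *m (M *m a)) 0 0.
Proof. by move=> rw dw w3; rewrite (trace_what a0 b0 b rw) dw w3; ring. Qed.

Lemma AM_extends : op_extends AM T.
Proof.
move=> v f Tv; split; first exact: opA_adj.
have [u [ru u0 du vu]] := opA_attributes Tv; exists u, 0, 0.
have [e1 e3 ed] := what_values 0 ru; have [d1' d2 d3] := dsharp_entries (what G3 u 0).
have U k : entry u k O2 = 0 by rewrite /entry u0 mxE.
have e3' : entry3 (what G3 u 0) O2 = 0 by rewrite e3 /entry3 U mul0r addr0.
split => //; apply/colP => k; rewrite mulmx0 [RHS]mxE.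
case: (split_ordP k) => i ->; first by rewrite d1' e1 U.
by case: (ord2P i) => ->; rewrite ?d2 ?d3 ed du mul0r addr0 ?oppr0.
Qed.

(** On the domain of A_M the trace becomes a bilinear form in the two sets of coefficients,
    symmetric because [M] is, so the boundary form is 0. *)
Lemma AM_symmetric v f v' f' : AM v f -> AM v' f' -> ip f v' = ip v f'.
Proof.
move=> [av [w [a0 [a [[rw vw] dw w3]]]]] [av' [w' [a0' [a' [[rw' vw'] dw' w3']]]]].
have := boundary_form av rw vw av' rw' vw'.
rewrite (trace_domAM a0' a' rw dw w3) (trace_domAM a0 a rw' dw' w3') form_sym.
by move=> /eqP; rewrite (mulrC a0') subrr subr_eq0 => /eqP.
Qed.

(** The boundary conditions prescribe only a jet of the regular part, so any coefficients are
    attained, with a test field as regular part. *)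
Lemma AM_test (b0 : R) b : exists phi, [/\ testv omega phi, dsharp (what G3 phi b0) = M *m b,
  entry3 (what G3 phi b0) O2 = 0 & AM (wrepr phi b0 b) (L phi)].
Proof.
pose W := M *m b.
(* The jet solves the boundary conditions for w^, from which the value and gradient of b_0 G_3(., O)
   at O are subtracted; the sign in the first derivative is that of the last entry of d^#. *)
have [phi [tp p1 p3 pd3]] := test_jets oo (fun i => W (lshift 2 i) 0) (- (b0 * gam))
  (fun i => if i == 0 then - W (rshift 2 1) 0 - b0 * G3_ G3 0 O2 else W (rshift 2 0) 0 - b0 * G3_
      G3 1 O2) oO.
have rp := regD_test oo oM tp.
have [e1 e3 ed] := what_values b0 rp; have [d1' d2 d3] := dsharp_entries (what G3 phi b0).
have D : dsharp (what G3 phi b0) = M *m b.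
  apply/colP => k; case: (split_ordP k) => i ->; first by rewrite d1' e1 p1.
  by case: (ord2P i) => ->; rewrite ?d2 ?d3 ed pd3 /= subrK ?opprK.
have E : entry3 (what G3 phi b0) O2 = 0 by rewrite e3 p3 addNr.
exists phi; split => //; split; first exact: adj_wrepr.
by exists phi, b0, b; split => //; split => //; apply: aeW.
Qed.

Lemma AM_maximal v f : adjoint omega AM v f -> AM v f.
Proof.
move=> [Lv Lf H].
have av : adjoint omega T v f by split => // u g /AM_extends; exact: H.
have [_ _ _ [w [a0 [a [rw vw]]]]] := (adjA v f).1 av.
split => //; exists w, a0, a.
(* The boundary form vanishes against all elements of [AM_test], which leaves a linear identity in
   arbitrary b_0 and b. *)
have key (b0 : R) b : - (a0 * b0 * gam) + (a^T *m (M *m b)) 0 0 - trace b0 b w = 0.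
  have [phi [tp D E Aphi]] := AM_test b0 b; have rp := regD_test oo oM tp.
  have vp : ae_on omega (wrepr phi b0 b) (wrepr phi b0 b) by apply: aeW.
  rewrite -(trace_domAM a0 a rp D E) -(boundary_form Aphi.1 rp vp av rw vw) (H _ _ Aphi).
  exact: subrr.
(* With b_0 = 1 and b = 0 only the value w^_3(O) survives. *)
have w3 : entry3 (what G3 w a0) O2 = 0.
  have := key 1 0; rewrite (trace_what a0 1 0 rw) mulmx0 mulmx0 trmx0 mul0mx !mxE.
  by move: (entry3 _ _) => e3 hh; lra.
(* With b_0 = 0 and b a unit vector, one entry of the boundary condition at a time. *)
have D : dsharp (what G3 w a0) = M *m a.
  apply/colP => k; have := key 0 (delta_mx k 0).
  have dot (X : 'cV[R]_(2 + 2)) : ((delta_mx k 0 : 'cV[R]_(2 + 2))^T *m X) 0 0 = X k 0.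
    by rewrite trmx_delta -rowE mxE.
  rewrite (trace_what a0 0 _ rw) w3 form_sym !dot !mulr0 !mul0r !oppr0 !add0r addr0.
  by move=> /eqP; rewrite subr_eq0 => /eqP.
by split.
Qed.

Lemma AM_self_adjoint : self_adjoint omega AM.
Proof.
split.
  move=> v Lv e e0; have [u [f [Tu le]]] := opA_dense Lv e0.
  by exists u, f; split => //; exact: AM_extends.
move=> v f; split; last exact: AM_maximal.
move=> Av; have [[Lv Lf _] _] := Av; split => // u g Au; exact: (AM_symmetric Au Av).
Qed.

End SelfAdjoint.

Theorem theorem10 (R : realType) (omega : set (R * R))
  (omega_open : open omega) (omega_conn : connected omega)
  (omega_bounded : bounded_set omega) (omega_smooth : smooth_bdry omega)
  (omega_O : omega (O2 R))
  (A : 'M[R]_(3 + 3)) (A_pos : posdef A)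
  (G' : R * R -> 'M[R]_2) (G'_green : green_prime (schur A) omega G')
  (G3 : R * R -> R * R -> R) (G3_green : green3 (schur A) omega G3)
  (* the given description of the adjoint (domain and action) *)
  (adjA : forall v f, adjoint omega (opA (schur A) omega) v f <->
                      opAstar (schur A) omega G' G3 v f)
  (M : 'M[R]_4) (M_sym : M^T = M) :
  let AM := op_restrict (adjoint omega (opA (schur A) omega))
                        (domAM omega G' G3 M) in
  self_adjoint omega AM /\ op_extends AM (opA (schur A) omega).
Proof.
have [M0 _ oM] := bounded_in_box omega_bounded.
have Bs := schur_sym A_pos; have Bp := schur_form_ge0 A_pos.
split.
  exact: (AM_self_adjoint omega_open oM omega_O omega_smooth Bs Bp G'_green G3_green adjA M_sym).
exact: (AM_extends omega_open oM omega_O omega_smooth Bs G3_green adjA).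
Qed.
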